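(* Assume that $\ell\ge5$, let $\mathcal{A}$ be a hyperplane arrangement in $V=\mathbb{K}^\ell$, let $H\in\mathcal{A}$, and assume that $\mathcal{A}$ is locally free along $H$. Then $\mathcal{A}$ is tame if and only if the Ziegler restriction $(\mathcal{A}^H,m^H)$ is tame. Explicitly, the following are equivalent: (1) $\mathcal{A}$ is tame. (2) $\mathrm{pd}_S\,\Omega^1(\mathcal{A})\le1$. (3) $(\mathcal{A}^H,m^H)$ is tame. (4) $\mathrm{pd}_{\overline{S}}\,\Omega^1(\mathcal{A}^H,m^H)\le1$, where $\overline{S}=S/\alpha_HS$.
   Context: Let $\mathbb{K}$ be a field, $V=\mathbb{K}^\ell$, $S=\mathbb{K}[x_1,\ldots,x_\ell]$ the coordinate ring of $V$. An arrangement $\mathcal{A}$ in $V$ is a finite set of linear hyperplanes of $V$; for each $H\in\mathcal{A}$ fix a linear form $\alpha_H\in V^*$ with $H=\ker\alpha_H$. A multiplicity is a function $m:\mathcal{A}\to\mathbb{Z}_{>0}$, the pair $(\mathcal{A},m)$ is a multiarrangement, and $Q(\mathcal{A},m)=\prod_{H\in\mathcal{A}}\alpha_H^{m(H)}$. Let $\Omega^1_V=\bigoplus_{i=1}^\ell S\,dx_i$ and $\Omega^p_V=\wedge^p\Omega^1_V$. For $0\le p\le\ell$, $$\Omega^p(\mathcal{A},m)=\{\omega\in \tfrac{1}{Q(\mathcal{A},m)}\Omega^p_V \mid Q(\mathcal{A},m)\,d\alpha_H\wedge\omega\in\alpha_H^{m(H)}\Omega^{p+1}_V\ (\forall H\in\mathcal{A})\},$$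 and $\Omega^p(\mathcal{A})=\Omega^p(\mathcal{A},1)$ for the constant multiplicity $1$. $\mathcal{A}$ is free if $\Omega^1(\mathcal{A})$ is a free $S$-module. $(\mathcal{A},m)$ is tame if $\mathrm{pd}_S\,\Omega^p(\mathcal{A},m)\le p$ for all $p$; $\mathcal{A}$ is tame if $(\mathcal{A},1)$ is. For $x\in V$ let $\mathcal{A}_x=\{L\in\mathcal{A}\mid x\in L\}$; $\mathcal{A}$ is locally free along $X\subset V$ if $\mathcal{A}_x$ is free for all $0\ne x\in X$. For $H\in\mathcal{A}$, $\mathcal{A}^H=\{H\cap L\mid L\in\mathcal{A}\setminus\{H\}\}$, an arrangement in $H\cong\mathbb{K}^{\ell-1}$ with coordinate ring $\overline{S}$. The Ziegler restriction of $\mathcal{A}$ onto $H$ is the multiarrangement $(\mathcal{A}^H,m^H)$ in $H$ with $m^H(X)=|\{L\in\mathcal{A}\setminus\{H\}\mid L\cap H=X\}|$ for $X\in\mathcal{A}^H$; its tameness is taken over $\overline{S}$. *)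

(* Defs.v *)
From HB Require Import structures.
From mathcomp Require Import all_boot all_algebra.
From mathcomp Require Import boolp finmap mpoly zify.

Set Implicit Arguments.
Unset Strict Implicit.
Unset Printing Implicit Defensive.

Import GRing.Theory.
Local Open Scope ring_scope.

Local Notation "x %:F" := (@FracField.tofrac _ x) : ring_scope.

(** * Modules: freeness and projective dimension *)

Definition is_basis (R : nzRingType) (M : lmodType R) (I : eqType)
    (e : I -> M) : Prop :=
  (forall x : M, exists (s : seq I) (c : I -> R),
     x = \sum_(i <- s) c i *: e i) /\
  (forall (s : seq I) (c : I -> R), uniq s ->
     \sum_(i <- s) c i *: e i = 0 -> forall i, i \in s -> c i = 0).

Definition free_module (R : nzRingType) (M : lmodType R) : Prop :=
  exists (I : eqType) (e : I -> M), is_basis e.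

Definition projective (R : nzRingType) (P : lmodType R) : Prop :=
  forall (M N : lmodType R) (g : {linear M -> N}) (f : {linear P -> N}),
    (forall y, exists x, g x = y) ->
    exists h : {linear P -> M}, forall x, g (h x) = f x.

(* There is a projective resolution
     0 -> P p -> ... -> P 1 -> P 0 -> M -> 0.
   In particular the zero module satisfies this for every p. *)
Definition pd_le (R : nzRingType) (M : lmodType R) (p : nat) : Prop :=
  exists (P : nat -> lmodType R) (d : forall i, {linear P i.+1 -> P i})
         (e : {linear P 0 -> M}),
    [/\ forall i, projective (P i),
        forall y, exists x, e x = y,
        forall x, e x = 0 <-> exists y, d 0 y = x,
        forall i x, d i x = 0 <-> exists y, d i.+1 y = x
      & forall i, (p < i)%N -> forall x : P i, x = 0].

(** * The fraction field of [R] as an [R]-module *)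

Section FracModule.
Variable R : idomainType.
Implicit Types (a b : R) (x y : {fraction R}).

Definition frac_scale a x : {fraction R} := a%:F * x.

Lemma frac_scaleA a b x : frac_scale a (frac_scale b x) = frac_scale (a * b) x.
Proof. by rewrite /frac_scale tofracM mulrA. Qed.

Lemma frac_scale1 : left_id 1 frac_scale.
Proof. by move=> x; rewrite /frac_scale tofrac1 mul1r. Qed.

Lemma frac_scaleDr : right_distributive frac_scale +%R.
Proof. by move=> a x y; rewrite /frac_scale mulrDr. Qed.

Lemma frac_scaleDl x : {morph frac_scale^~ x : a b / a + b}.
Proof. by move=> a b; rewrite /frac_scale tofracD mulrDl. Qed.

HB.instance Definition _ := GRing.Zmodule_isLmodule.Build R {fraction R}
  frac_scaleA frac_scale1 frac_scaleDr frac_scaleDl.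

Lemma frac_scaleE a x : a *: x = a%:F * x.
Proof. by []. Qed.

End FracModule.

(** * Differential forms *)

(* The exterior algebra on dx_0, ..., dx_(n-1) over R; [w I] is the
   coefficient of dx_(i_1) /\ ... /\ dx_(i_p), where I = {i_1 < ... < i_p}. *)
Definition form (n : nat) (R : Type) := {ffun {set 'I_n} -> R}.

HB.instance Definition _ n (R : zmodType) := GRing.Zmodule.on (form n R).
HB.instance Definition _ n (A : nzRingType) (R : lmodType A) :=
  GRing.Lmodule.on (form n R).

Definition pform n (R : zmodType) (p : nat) (w : form n R) : Prop :=
  forall I : {set 'I_n}, #|I| != p -> w I = 0.

Definition inversions n (I J : {set 'I_n}) : nat :=
  #|[set ij : 'I_n * 'I_n | [&& ij.1 \in I, ij.2 \in J & (ij.2 < ij.1)%N]]|.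

(* dx_I /\ dx_J = (-1)^(inversions I J) dx_(I u J) if I and J are disjoint,
   and 0 otherwise. *)
Definition wedge n (R : nzRingType) (u v : form n R) : form n R :=
  [ffun K : {set 'I_n} => \sum_(I : {set 'I_n} | I \subset K)
     (-1) ^+ inversions I (K :\: I) * u I * v (K :\: I)].

Definition differential (K : fieldType) n (f : {mpoly K[n]}) :
    form n {mpoly K[n]} :=
  [ffun I : {set 'I_n} => \sum_(i < n | I == [set i]) f^`M(i)].

Definition ratform (K : fieldType) n := form n {fraction {mpoly K[n]}}.

HB.instance Definition _ (K : fieldType) n :=
  GRing.Lmodule.on (ratform K n).

Definition ratform_of (K : fieldType) n (w : form n {mpoly K[n]}) :
    ratform K n :=
  [ffun I => (w I)%:F].

(** * Arrangements and multiarrangements *)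

Local Open Scope fset_scope.
Local Open Scope ring_scope.

Definition arrangement (K : fieldType) n (A : {fset {vspace 'rV[K]_n}}) : Prop :=
  forall H, H \in A -> (\dim H).+1 = n.

Definition defform (K : fieldType) n (H : {vspace 'rV[K]_n}) :
    'Hom('rV[K]_n, K^o) :=
  if pselect (exists f : 'Hom('rV[K]_n, K^o), lker f == H) is left ex
  then xchoose ex else 0.

Lemma lker_defform (K : fieldType) n (H : {vspace 'rV[K]_n}) :
  (\dim H).+1 = n -> lker (defform H) = H.
Proof.
move=> dH; rewrite /defform; case: pselect => [ex|[]].
  by apply/eqP; apply: (xchooseP ex).
have dC : \dim H^C = 1%N by rewrite dimv_compl dimvf /= /dim /= mul1n -{1}dH subSnn.
pose v := vpick H^C%VS.
have v0 : v != 0 by rewrite vpick0 -dimv_eq0 dC.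
have HC : H^C%VS = <[v]>%VS.
  by apply/esym/eqP; rewrite eqEdim -memvE memv_pick dim_vline v0 dC.
have fv : free [:: v] by rewrite seq1_free.
exists (linfun (coord [tuple v] ord0 : 'rV[K]_n -> K^o) \o daddv_pi H^C H)%VF.
apply/eqP/vspaceP => x; rewrite memv_ker comp_lfunE /= lfunE /=.
have cap : (H :&: H^C = 0)%VS by apply: capv_compl.
have cap' : (H^C :&: H = 0)%VS by rewrite capvC.
have xin : x \in (H + H^C)%VS by rewrite addv_complf memvf.
have := daddv_pi_add cap xin; set y := daddv_pi H _ x; set z := daddv_pi _ H x.
have zv : z \in <[v]>%VS by rewrite -HC memv_pi.
have yH : y \in H by rewrite memv_pi.
move=> xE; have -> : (coord [tuple v] ord0 z == 0) = (z == 0).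
  case/vlineP: zv => c ->; rewrite linearZ /= scaler_eq0 (negPf v0) orbF.
  have -> : v = [tuple v]`_(ord0 : 'I_1) by [].
  by rewrite coord_free //= mulr1.
apply/eqP/idP => [z0|xH]; first by rewrite -xE z0 addr0.
apply/eqP; rewrite -memv0 -cap memv_cap memv_pi andbT.
by rewrite (_ : z = x - y) ?rpredB // -xE addrC addKr.
Qed.

Definition linpoly (K : fieldType) n (f : 'Hom('rV[K]_n, K^o)) : {mpoly K[n]} :=
  \sum_(i < n) (f (delta_mx 0 i) : K) *: 'X_i.

Definition alpha (K : fieldType) n (H : {vspace 'rV[K]_n}) : {mpoly K[n]} :=
  linpoly (defform H).

Definition defpoly (K : fieldType) n (A : {fset {vspace 'rV[K]_n}})
    (m : {vspace 'rV[K]_n} -> nat) : {mpoly K[n]} :=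
  \prod_(H <- A) alpha H ^+ m H.

Section Multiarrangement.
Variables (K : fieldType) (n : nat) (A : {fset {vspace 'rV[K]_n}}).
Variables (m : {vspace 'rV[K]_n} -> nat) (p : nat).
Local Notation S := {mpoly K[n]}.
Local Notation Q := (defpoly A m).

Definition is_logform (w : ratform K n) : Prop :=
  (exists eta : form n S,
     pform p eta /\ w = [ffun I => (eta I)%:F / Q%:F]) /\
  (forall H, H \in A -> exists eta : form n S,
     pform p.+1 eta /\
     Q *: wedge (ratform_of (differential (alpha H))) w =
       alpha H ^+ m H *: ratform_of eta).

Definition logforms : {pred ratform K n} := fun w => `[< is_logform w >].

Lemma wedge_linear (u : ratform K n) (a : S) (v w : ratform K n) :
  wedge u (a *: v + w) = a *: wedge u v + wedge u w.
Proof.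
apply/ffunP => J; rewrite !ffunE frac_scaleE big_distrr -big_split /=.
apply: eq_bigr => I _; rewrite !ffunE frac_scaleE mulrDr.
by congr (_ + _); rewrite [RHS]mulrCA.
Qed.

Lemma logforms_submod_closed : submod_closed logforms.
Proof.
have pform_lin q (a : S) (e f : form n S) :
    pform q e -> pform q f -> pform q [ffun I => a * e I + f I].
  by move=> He Hf I HI; rewrite !ffunE He // Hf // mulr0 addr0.
split.
  apply/asboolP; split.
    exists 0; split; first by move=> I _; rewrite ffunE.
    by apply/ffunP => I; rewrite !ffunE tofrac0 mul0r.
  move=> H _; exists 0; split; first by move=> I _; rewrite ffunE.
  have -> : ratform_of (0 : form n S) = 0.
    by apply/ffunP => I; rewrite !ffunE tofrac0.
  rewrite scaler0; apply/ffunP => I; rewrite !ffunE big1 ?scaler0 // => J _.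
  by rewrite !ffunE mulr0.
move=> a v w /asboolP[[e1 [He1 Ev]] Hv] /asboolP[[e2 [He2 Ew]] Hw].
apply/asboolP; split.
  exists [ffun I => a * e1 I + e2 I]; split; first exact: pform_lin.
  apply/ffunP => I; rewrite Ev Ew !ffunE frac_scaleE tofracD.
  by rewrite tofracM mulrDl mulrA.
move=> H HA; have [f1 [Hf1 E1]] := Hv H HA; have [f2 [Hf2 E2]] := Hw H HA.
exists [ffun I => a * f1 I + f2 I]; split; first exact: pform_lin.
rewrite wedge_linear scalerDr scalerA mulrC -scalerA E1 E2.
apply/ffunP => I; rewrite !ffunE !frac_scaleE tofracD tofracM.
by rewrite mulrDr mulrCA.
Qed.

HB.instance Definition _ :=
  GRing.isSubmodClosed.Build S (ratform K n) logforms logforms_submod_closed.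

(* The S-module of logarithmic p-forms of (A, m). *)
Record Omega := LogForm { logform_val :> ratform K n; _ : logform_val \in logforms }.

HB.instance Definition _ := [isSub for logform_val].
HB.instance Definition _ := [Choice of Omega by <:].
HB.instance Definition _ := [SubChoice_isSubLmodule of Omega by <:].

End Multiarrangement.

Arguments Omega {K n} A m p.

Definition mult1 (K : fieldType) n : {vspace 'rV[K]_n} -> nat := fun=> 1%N.
Arguments mult1 {K n}.

Definition free_arrangement (K : fieldType) n (A : {fset {vspace 'rV[K]_n}}) :
    Prop :=
  free_module (Omega A mult1 1).

Definition tame (K : fieldType) n (A : {fset {vspace 'rV[K]_n}})
    (m : {vspace 'rV[K]_n} -> nat) : Prop :=
  forall p : nat, (p <= n)%N -> pd_le (Omega A m p) p.

Definition localization (K : fieldType) n (A : {fset {vspace 'rV[K]_n}})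
    (x : 'rV[K]_n) : {fset {vspace 'rV[K]_n}} :=
  [fset L in A | x \in L].

Definition locally_free_along (K : fieldType) n (A : {fset {vspace 'rV[K]_n}})
    (X : {vspace 'rV[K]_n}) : Prop :=
  forall x, x \in X -> x != 0 -> free_arrangement (localization A x).

(** * The Ziegler restriction onto [H], read in K^k through a linear
    isomorphism [phi] from K^k onto [H] *)

Section Ziegler.
Variables (K : fieldType) (k n : nat) (phi : 'Hom('rV[K]_k, 'rV[K]_n)).
Variables (A : {fset {vspace 'rV[K]_n}}) (H : {vspace 'rV[K]_n}).

Definition restriction : {fset {vspace 'rV[K]_k}} :=
  [fset (phi @^-1: (H :&: L))%VS | L in A `\ H].

Definition ziegler_mult (X : {vspace 'rV[K]_k}) : nat :=
  #|` [fset L in A `\ H | (phi @^-1: (L :&: H))%VS == X] |.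

End Ziegler.

Lemma restriction_arrangement (K : fieldType) n
    (phi : 'Hom('rV[K]_n.-1, 'rV[K]_n)) (A : {fset {vspace 'rV[K]_n}})
    (H : {vspace 'rV[K]_n}) :
  lker phi = 0%VS -> limg phi = H -> arrangement A -> H \in A ->
  arrangement (restriction phi A H).
Proof.
move=> inj im arrA HA X /imfsetP[L /=]; rewrite !inE => /andP[neLH LA] {X}->.
set U := (H :&: L)%VS.
have := arrA H HA; have := arrA L LA => dL dH.
have dU : \dim (phi @^-1: U) = \dim U.
  rewrite -[in RHS](_ : phi @: (phi @^-1: U) = U)%VS; last first.
    by rewrite lpreimK // im capvSl.
  by rewrite limg_dim_eq // inj capv0.
rewrite dU.
have nsub : ~~ (H <= L)%VS.
  by apply: contra neLH => sHL; rewrite eq_sym eqEdim sHL -ltnS dL dH leqnn.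
have hs : \dim (H + L) = n.
  apply/eqP; rewrite eqn_leq; apply/andP; split.
    by apply: leq_trans (dimvS (subvf _)) _; rewrite dimvf /= /dim /= mul1n.
  rewrite -{1}dL ltnNge; apply/negP => le.
  have /eqP LE : L == (H + L)%VS by rewrite eqEdim addvSr.
  by rewrite LE addvSl in nsub.
have := dimv_sum_cap H L; rewrite -/U hs => e.
move: e dL dH; move: (\dim U) (\dim H) (\dim L) => a b c; lia.
Qed.

(* The pullback of polynomial functions along [phi]. When [phi] is an
   isomorphism from K^k onto a hyperplane H, [pullback_surj] and
   [pullback_eq0] identify {mpoly K[k]} with {mpoly K[n]} / (alpha H). *)
Section CoordinateRing.
Variables (K : fieldType) (k n : nat) (phi : 'Hom('rV[K]_k, 'rV[K]_n)).

Definition pullback : {mpoly K[n]} -> {mpoly K[k]} :=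
  comp_mpoly [tuple \sum_(j < k) phi (delta_mx 0 j) 0 i *: 'X_j | i < n].

HB.instance Definition _ := GRing.Linear.copy pullback
  (comp_mpoly [tuple \sum_(j < k) phi (delta_mx 0 j) 0 i *: 'X_j | i < n]).
HB.instance Definition _ := GRing.RMorphism.copy pullback
  (comp_mpoly [tuple \sum_(j < k) phi (delta_mx 0 j) 0 i *: 'X_j | i < n]).
End CoordinateRing.

Lemma pullback_linpoly (K : fieldType) k n (phi : 'Hom('rV[K]_k, 'rV[K]_n)) f :
  pullback phi (linpoly f) = linpoly (f \o phi)%VF.
Proof.
rewrite /linpoly /pullback raddf_sum /=.
under eq_bigr => i _.
  rewrite linearZ /= comp_mpolyXU (nth_map i) ?size_enum_ord //.
  rewrite nth_ord_enum scaler_sumr; over.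
rewrite exchange_big; apply: eq_bigr => j _ /=.
rewrite comp_lfunE {2}[phi _]row_sum_delta linear_sum scaler_suml.
by apply: eq_bigr => i _; rewrite scalerA linearZ /= mulrC.
Qed.

Lemma linpolyD (K : fieldType) n (f g : 'Hom('rV[K]_n, K^o)) :
  linpoly (f + g) = linpoly f + linpoly g.
Proof.
rewrite -big_split; apply: eq_bigr => i _ /=.
by rewrite add_lfunE scalerDl.
Qed.

Lemma linpolyZ (K : fieldType) n c (f : 'Hom('rV[K]_n, K^o)) :
  linpoly (c *: f) = c *: linpoly f.
Proof.
rewrite scaler_sumr; apply: eq_bigr => i _ /=.
by rewrite scale_lfunE scalerA.
Qed.

Lemma lker_multiple (K : fieldType) n (f g : 'Hom('rV[K]_n, K^o)) :
  f != 0 -> (lker f <= lker g)%VS -> exists c : K, g = c *: f.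
Proof.
move=> f0 sfg.
have [v fv] : exists v, f v != 0.
  apply/not_existsP => h; move/eqP: f0; apply; apply/lfunP => x.
  by rewrite zero_lfunE; apply/eqP; apply: contra_notT (h x).
exists ((g v : K) / (f v : K)); apply/lfunP => x; rewrite scale_lfunE.
have : x - ((f x : K) / (f v : K)) *: v \in lker g.
  apply: subvP sfg _ _; rewrite memv_ker linearB linearZ /= subr_eq0.
  by rewrite -[_ *: _]/(_ * _) divfK.
rewrite memv_ker linearB linearZ /= subr_eq0 => /eqP ->.
by rewrite -![_ *: _]/((_ : K) * (_ : K)) mulrAC [RHS]mulrAC [in LHS](mulrC (f x : K)).
Qed.

Lemma coord_form (K : fieldType) n (i : 'I_n) :
  exists2 c : 'Hom('rV[K]_n, K^o), (forall x, c x = x 0 i) & linpoly c = 'X_i.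
Proof.
have lin : linear (fun x : 'rV[K]_n => x 0 i : K^o).
  by move=> a x y; rewrite !mxE.
pose F : {linear 'rV[K]_n -> K^o} :=
  HB.pack (fun x : 'rV[K]_n => x 0 i : K^o) (GRing.isLinear.Build _ _ _ _ _ lin).
have FE x : linfun F x = x 0 i by rewrite lfunE.
exists (linfun F) => //; rewrite /linpoly (bigD1 i) //= big1 => [|j ji].
  by rewrite FE mxE !eqxx scale1r addr0.
by rewrite FE mxE eq_sym (negPf ji) andbF scale0r.
Qed.

Lemma pullback_surj (K : fieldType) k n (phi : 'Hom('rV[K]_k, 'rV[K]_n)) :
  lker phi = 0%VS -> forall g, exists f, pullback phi f = g.
Proof.
move=> /eqP inj; elim/mpolyind => [|c m g _ _ [f <-]].
  by exists 0; rewrite linear0.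
suff [h <-] : exists h, pullback phi h = 'X_[m].
  by exists (c *: h + f); rewrite linearP.
suff hX (j : 'I_k) : exists h, pullback phi h = 'X_j.
  have /choice[h hE] := hX.
  exists (\prod_(j < k) h j ^+ m j); rewrite rmorph_prod mpolyXE_id.
  by apply: eq_bigr => j _; rewrite rmorphXn /= hE.
have [b _ <-] := coord_form K j.
exists (linpoly (b \o phi^-1)%VF); rewrite pullback_linpoly.
congr linpoly; apply/lfunP => x.
by rewrite !comp_lfunE lker0_lfunK.
Qed.

Lemma pullback_eq0 (K : fieldType) k n (phi : 'Hom('rV[K]_k, 'rV[K]_n)) H f :
  limg phi = H -> (\dim H).+1 = n ->
  pullback phi f = 0 <-> exists g, f = alpha H * g.
Proof.
move=> im dH; rewrite /alpha; set a := defform H.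
have ka : lker a = H by apply: lker_defform.
have a0 : a != 0.
  apply: contra_eqN dH => /eqP a0; rewrite -ka a0 (_ : lker 0 = fullv).
    by rewrite dimvf /= /dim /= mul1n neq_ltn ltnSn orbT.
  by apply/vspaceP => x; rewrite memv_ker zero_lfunE eqxx memvf.
split; last first.
  case=> g ->; rewrite rmorphM /= pullback_linpoly (_ : (a \o phi)%VF = 0).
    by rewrite /linpoly big1 ?mul0r // => i _; rewrite zero_lfunE scale0r.
  apply/lfunP => x; rewrite comp_lfunE zero_lfunE.
  by apply/eqP; rewrite -memv_ker ka -im memv_img ?memvf.
pose tau q := pullback phi^-1%VF (pullback phi q).
have tauM p q : tau (p * q) = tau p * tau q by rewrite /tau !rmorphM.
pose P q := exists g, q - tau q = linpoly a * g.
have PM p q : P p -> P q -> P (p * q).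
  move=> [g1 e1] [g2 e2]; exists (p * g2 + g1 * tau q).
  by rewrite mulrDr mulrCA -e2 mulrA -e1 tauM mulrBr mulrBl addrA subrK.
have P1 : P 1 by exists 0; rewrite /tau !rmorph1 subrr mulr0.
suff : P f by move=> [g] + f0; rewrite /tau f0 rmorph0 subr0 => ->; exists g.
elim/mpolyind: f => [|c m q _ _ [g2 e2]].
  by exists 0; rewrite /tau !rmorph0 subrr mulr0.
suff [g1 e1] : P 'X_[m].
  exists (c *: g1 + g2); rewrite mulrDr -scalerAr -e1 -e2.
  have -> : tau (c *: 'X_[m] + q) = c *: tau 'X_[m] + tau q.
    by rewrite /tau linearP /= linearP.
  by rewrite opprD scalerBr addrACA.
rewrite mpolyXE_id; apply: (big_ind P); [exact: P1|exact: PM|move=> i _].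
elim: (m i) => [|d IH]; first by rewrite expr0; exact: P1.
rewrite exprS; apply: PM; last exact: IH.
have [b _ <-] := coord_form K i.
have [|e ce] := @lker_multiple K n a (b - ((b \o phi) \o phi^-1)%VF) a0.
  apply/subvP => x; rewrite ka -im => xH; rewrite memv_ker add_lfunE opp_lfunE.
  by rewrite !comp_lfunE limg_lfunVK ?subrr.
exists e%:MP; rewrite /tau !pullback_linpoly mulrC mul_mpolyC -linpolyZ -ce.
have linpolyN (h : 'Hom('rV[K]_n, K^o)) : linpoly (- h) = - linpoly h.
  by rewrite -scaleN1r linpolyZ scaleN1r.
by rewrite linpolyD linpolyN.
Qed.

(* Main.v *)
Require Import Defs.
From HB Require Import structures.
From mathcomp Require Import all_boot all_order all_algebra.
From mathcomp Require Import boolp finmap mpoly zify ring.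

Set Implicit Arguments.
Unset Strict Implicit.
Unset Printing Implicit Defensive.

Import GRing.Theory.
Local Open Scope ring_scope.

(* Up to the factor 1/Q, the module of logarithmic p-forms of A is the direct sum
   of M_p and M_(p-1), where M_p consists of forms on H with coefficients in S.
   Put f_x = prod_(x \notin L) alpha_L. As A is locally free along H,
   multiplication by f_x on M_1 factors through a free module for all nonzero
   x in H, and the powers of the f_x generate an ideal containing, for each
   exponent, homogeneous elements h_j that restrict to powers of the coordinates
   of H; these form a regular sequence of length l - 1.

   Let 0 -> F_1 -> F_0 -> M_1 -> 0 be exact with F_0, F_1 free. Up to a factor
   and up to powers of the f_x, M_p is the exterior power of F_0 modulo the
   forms generated by F_1. These have free resolutions of length at most p,
   and Koszul cohomology of h kills the discrepancy as long as that length is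
   smaller than l - 1. Hence pd M_p <= p for p <= l - 3, and Hilbert's syzygy
   theorem bounds pd M_p by l - 2 in general. The same argument over S/alpha_H
   identifies M_p / alpha_H M_p with N_p, the module of the Ziegler restriction,
   in the range 0 < p <= l - 3.

   Conversely, let pd N_1 <= 1. If h_j^e u is the class of a logarithmic
   coboundary for all j, then Koszul cohomology of N_1 in degree 1, which
   vanishes as l - 1 > 3, shows that u is a coboundary up to alpha_H u', where u'
   has the same property for the exponent e + 1. By degree reasons u is a
   coboundary, so M_1 -> N_1 is surjective and pd M_1 = pd N_1. *)

(** Where [M_1] is locally free, its exterior powers, its syzygies and its restriction behave as
    expected; what can go wrong globally is torsion killed by powers of the f_x. Depth removes it: a
    submodule of a free module with a resolution of [n] terms is closed under division by a regular
    sequence of more than [n] elements ([torsion_sub]). Local freeness therefore enters not through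
    localised rings but as the matrix identity [factors_free], which survives exterior powers and
    reduction modulo alpha_H. A [p]-th exterior power raises the multiplier to its [p]-th power,
    which is why powers of the f_x occur. The matrix of the factorisation has logarithmic vector
    fields as columns, and pairing with them shows which forms come from the exterior power. The
    splitting into two summands comes from contraction with the Euler field. Graded minimal covers
    replace localisation at the irrelevant ideal: they pass from projective to finite free
    resolutions and from S / alpha_H back to S. *)

Definition mklin (R : nzRingType) (U V : lmodType R) (f : U -> V)
    (Hf : linear f) : {linear U -> V} :=
  HB.pack f (GRing.isLinear.Build R U V _ f Hf).

Lemma pair_ext (T U : Type) (x y : T * U) : x.1 = y.1 -> x.2 = y.2 -> x = y.
Proof. by case: x y => ? ? [? ?] /= -> ->. Qed.

(** * Submodules, exact sequences and resolutions *)

Section Submodule.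
Variables (R : nzRingType) (V : lmodType R).

Record submodule := Submodule {
  sm_pred :> V -> Prop;
  _ : sm_pred 0;
  _ : forall a x y, sm_pred x -> sm_pred y -> sm_pred (a *: x + y) }.

Definition sm_mem (U : submodule) : {pred V} := fun x => `[< U x >].

Lemma sm0 (U : submodule) : U 0. Proof. by case: U. Qed.
Lemma smL (U : submodule) a x y : U x -> U y -> U (a *: x + y).
Proof. by case: U => P P0 PL /=; apply: PL. Qed.
Lemma smD (U : submodule) x y : U x -> U y -> U (x + y).
Proof. by move=> Ux Uy; rewrite -[x]scale1r; apply: smL. Qed.
Lemma smZ (U : submodule) a x : U x -> U (a *: x).
Proof. by move=> Ux; rewrite -[_ *: x]addr0; apply: smL => //; apply: sm0. Qed.
Lemma smN (U : submodule) x : U x -> U (- x).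
Proof. by move=> Ux; rewrite -scaleN1r; apply: smZ. Qed.
Lemma smB (U : submodule) x y : U x -> U y -> U (x - y).
Proof. by move=> Ux Uy; apply: smD => //; apply: smN. Qed.
Lemma sm_sum (U : submodule) (I : Type) (s : seq I) (P : pred I) (F : I -> V) :
  (forall i, P i -> U (F i)) -> U (\sum_(i <- s | P i) F i).
Proof. by move=> UF; apply: (big_ind U) => //; [apply: sm0 | apply: smD]. Qed.

Lemma sm_closed U : submod_closed (sm_mem U).
Proof.
split; first by apply/asboolP; apply: sm0.
by move=> a x y /asboolP Ux /asboolP Uy; apply/asboolP; apply: smL.
Qed.

HB.instance Definition _ U := GRing.isSubmodClosed.Build R V (sm_mem U) (sm_closed U).

Record subT (U : submodule) := SubT { subT_val : V; _ : subT_val \in sm_mem U }.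

HB.instance Definition _ U := [isSub for @subT_val U].
HB.instance Definition _ U := [Choice of subT U by <:].
HB.instance Definition _ U := [SubChoice_isSubLmodule of subT U by <:].

Definition inc (U : submodule) : {linear subT U -> V} := \val.

Lemma incP (U : submodule) (x : subT U) : U (inc U x).
Proof. by apply/asboolP; apply: (valP x). Qed.

Lemma inc_inj (U : submodule) : injective (inc U).
Proof. exact: val_inj. Qed.

Definition toS (U : submodule) x (Ux : U x) : subT U :=
  SubT (introT (asboolP (U x)) Ux : x \in sm_mem U).

Lemma toSK (U : submodule) x (Ux : U x) : inc U (toS Ux) = x.
Proof. by []. Qed.

End Submodule.

Section LinearSub.
Variables (R : nzRingType) (V W : lmodType R).

Fact corestr_lin (U : submodule V) (f : {linear W -> V}) (Hf : forall x, U (f x)) :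
  linear (fun x => toS (Hf x)).
Proof. by move=> a x y; apply: inc_inj; rewrite [RHS]linearP; exact: linearP. Qed.
Definition corestr (U : submodule V) (f : {linear W -> V}) (Hf : forall x, U (f x))
  : {linear W -> subT U} := mklin (corestr_lin Hf).

Definition kersm (f : {linear V -> W}) : submodule V.
Proof.
exists (fun x => f x = 0); first exact: linear0.
by move=> a x y fx fy; rewrite linearP fx fy scaler0 addr0.
Defined.

Definition imsm (f : {linear W -> V}) : submodule V.
Proof.
exists (fun x => exists y, f y = x); first by exists 0; apply: linear0.
by move=> a x y [x' <-] [y' <-]; exists (a *: x' + y'); rewrite linearP.
Defined.

End LinearSub.

Section Ses.
Variable R : nzRingType.
Implicit Types A B C P M : lmodType R.

Definition ses A B C (i : {linear A -> B}) (q : {linear B -> C}) : Prop :=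
  [/\ injective i, (forall c, exists b, q b = c)
    & (forall b, q b = 0 <-> exists a, i a = b)].

Lemma lin_inj A B (f : {linear A -> B}) :
  (forall x, f x = 0 -> x = 0) -> injective f.
Proof.
move=> f0 x y fxy; apply/eqP; rewrite -subr_eq0; apply/eqP/f0.
by rewrite linearB fxy subrr.
Qed.

Lemma ses_ker B C (q : {linear B -> C}) :
  (forall c, exists b, q b = c) -> ses (inc (kersm q)) q.
Proof.
move=> qs; split => //; first exact: inc_inj.
move=> b; split=> [qb|[a <-]]; last exact: (incP a).
by exists (toS (qb : kersm q b)).
Qed.

Variable cls : lmodType R -> Prop.

(* A resolution of [M] with [n] terms: projective dimension less than [n]. *)
Fixpoint res n M : Prop :=
  match n with
  | 0 => forall x : M, x = 0
  | n'.+1 => exists (A P : lmodType R) (i : {linear A -> P}) (q : {linear P -> M}),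
      [/\ cls P, ses i q & res n' A]
  end.

Lemma res_iso n M M' (f : {linear M -> M'}) :
  injective f -> (forall y, exists x, f x = y) -> res n M -> res n M'.
Proof.
move=> fi fs; case: n => [|n] /= => [M0 y|].
  by have [x <-] := fs y; rewrite (M0 x) linear0.
move=> [A [P [i [q [cP [ii qs iq] rA]]]]].
have lq : linear (fun x => f (q x)) by move=> a x y; rewrite !linearP.
exists A, P, i, (mklin lq); split=> //; split=> // [c|b].
  by have [x <-] := fs c; have [b <-] := qs x; exists b.
rewrite -iq; split=> [/= fq|/= ->]; last by rewrite linear0.
by apply: fi; rewrite fq linear0.
Qed.

Lemma bij_inv_lin M M' (f : {linear M -> M'}) :
  injective f -> (forall y, exists x, f x = y) ->
  exists g : {linear M' -> M}, cancel f g /\ cancel g f.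
Proof.
move=> fi /choice[g fg].
have lg : linear g by move=> a x y; apply: fi; rewrite linearP !fg.
exists (mklin lg); split=> // x; apply: fi; exact: fg.
Qed.

Lemma res_iso' n M M' (f : {linear M -> M'}) :
  injective f -> (forall y, exists x, f x = y) -> res n M' -> res n M.
Proof.
move=> fi fs; have [g [fg gf]] := bij_inv_lin fi fs.
apply: (@res_iso _ _ _ g); first exact: can_inj gf.
by move=> y; exists (f y).
Qed.

Hypothesis cls0 : exists2 Z : lmodType R, cls Z & forall z : Z, z = 0.
Hypothesis clsD : forall P Q, cls P -> cls Q -> cls (P * Q)%type.
Hypothesis cls_proj : forall P, cls P -> projective P.

Lemma res_cls P : cls P -> res 1 P.
Proof.
move=> cP; have [Z cZ Z0] := cls0.
have l0 : linear (fun _ : Z => 0 : P) by move=> a x y; rewrite scaler0 addr0.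
have l1 : linear (fun x : P => x) by [].
exists Z, P, (mklin l0), (mklin l1); split=> //; split=> /=.
- by move=> x y _; rewrite (Z0 x) (Z0 y).
- by move=> c; exists c.
- by move=> b; split=> [->|[_ <-]] //; exists 0.
Qed.

Lemma resS n M : res n M -> res n.+1 M.
Proof.
elim: n M => [|n IH] M.
  move=> M0; have [Z cZ Z0] := cls0.
  have l0 : linear (fun _ : Z => 0 : M) by move=> a x y; rewrite scaler0 addr0.
  have l1 : linear (fun x : Z => x) by [].
  exists Z, Z, (mklin l1), (mklin l0); split=> //; split=> /=.
  - by move=> x y _; rewrite (Z0 x) (Z0 y).
  - by move=> c; exists 0; rewrite (M0 c).
  - by move=> b; split=> // _; exists b.
by move=> [A [P [i [q [cP s rA]]]]]; exists A, P, i, q; split=> //; apply: IH.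
Qed.

Lemma res_le n m M : (n <= m)%N -> res n M -> res m M.
Proof.
move=> /subnK <-; elim: (m - n)%N => // d IH /IH; exact: resS.
Qed.

Lemma proj_lift P (M N : lmodType R) (g : {linear M -> N}) (f : {linear P -> N}) :
  cls P -> (forall y, exists x, g x = y) ->
  exists h : {linear P -> M}, forall x, g (h x) = f x.
Proof. by move=> cP gs; apply: cls_proj. Qed.

(** Horseshoe lemma: the cover of [C] lifts to [B] by projectivity, and the kernel of [P * Q ->> B]
    is again an extension of the two kernels, which feeds the induction. *)
Lemma res_horseshoe n A B C (i : {linear A -> B}) (q : {linear B -> C}) :
  ses i q -> res n A -> res n C -> res n B.
Proof.
elim: n A B C i q => [|n IH] A B C i q [ii qs iq] /=.
  move=> A0 C0 x; have /iq[a <-] : q x = 0 by rewrite (C0 (q x)).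
  by rewrite (A0 a) linear0.
move=> [A1 [P [i1 [q1 [cP [i1i q1s iq1] rA]]]]].
move=> [C1 [Q [i2 [q2 [cQ [i2i q2s iq2] rC]]]]].
have [h qh] := proj_lift q2 cQ qs.
have lq : linear (fun x : P * Q => i (q1 x.1) + h x.2).
  by move=> a x y /=; rewrite !linearP /= scalerDr addrACA.
pose q3 := mklin lq.
have q3s : forall b, exists x, q3 x = b.
  move=> b; have [y y1] := q2s (q b).
  have /iq[a aE] : q (b - h y) = 0 by rewrite linearB qh y1 subrr.
  have [x xE] := q1s a; exists (x, y).
  by rewrite /= xE aE subrK.
exists (subT (kersm q3)), (P * Q)%type, (inc _), q3; split; first exact: clsD.
  exact: ses_ker.
have j1P : forall x, kersm q3 (i1 x, 0).
  move=> x /=; rewrite linear0 addr0 (_ : q1 (i1 x) = 0) ?linear0 //.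
  by apply/iq1; exists x.
have lj1 : linear (fun x => (i1 x, 0) : P * Q).
  by move=> a x y; rewrite linearP; congr pair; rewrite /= scaler0 addr0.
pose j1 := @corestr R (P * Q)%type A1 (kersm q3) (mklin lj1) j1P.
have pP (x : subT (kersm q3)) : exists c, i2 c = (inc _ x).2.
  apply/iq2; rewrite -qh; have /= e := incP x.
  have := congr1 q e; rewrite linearD linear0 => /= <-.
  by rewrite (_ : q (i _) = 0) ?add0r //; apply/iq; exists (q1 (inc _ x).1).
have [p pE] := choice pP.
have lp : linear p.
  by move=> a x y; apply: i2i; rewrite linearP !pE linearP.
apply: (IH A1 _ C1 j1 (mklin lp)) => //; split.
- by move=> x y /(congr1 (inc _)) /= [] /i1i.
- move=> c.
  have /iq[a aE] : q (- h (i2 c)) = 0.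
    rewrite linearN qh (_ : q2 (i2 c) = 0) ?oppr0 //; apply/iq2; by exists c.
  have [x xE] := q1s a.
  have kx : kersm q3 (x, i2 c) by rewrite /= xE aE addNr.
  by exists (toS kx); apply: i2i; rewrite /= pE.
- move=> b; split=> [/= pb|[a <-]]; last first.
    by apply: i2i; rewrite /= pE /= linear0.
  have b2 : (inc _ b).2 = 0 by rewrite -pE pb linear0.
  have /iq1[a aE] : q1 (inc _ b).1 = 0.
    apply: ii; rewrite linear0; have /= := incP b.
    by rewrite -/(inc _ b) b2 linear0 addr0.
  exists a; apply: inc_inj; rewrite -[LHS]/(i1 a, 0) aE.
  by apply: pair_ext; rewrite //= [RHS]b2.
Qed.

Lemma ses_prod A C : exists (i : {linear A -> (A * C)%type})
    (q : {linear (A * C)%type -> C}), ses i q /\ (forall x, q x = x.2).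
Proof.
have li : linear (fun x => (x, 0) : A * C).
  by move=> a x y; congr pair; rewrite /= scaler0 addr0.
have lq : linear (fun x : A * C => x.2) by [].
exists (mklin li), (mklin lq); split=> //; split=> /=.
- by move=> x y [].
- by move=> c; exists (0, c).
- by move=> [x y] /=; split=> [->|[z [_ ->]]] //; exists x.
Qed.

Lemma ses_prod' A C : exists (i : {linear A -> (C * A)%type})
    (q : {linear (C * A)%type -> C}), ses i q.
Proof.
have li : linear (fun x => (0, x) : C * A).
  by move=> a x y; congr pair; rewrite /= scaler0 addr0.
have lq : linear (fun x : C * A => x.1) by [].
exists (mklin li), (mklin lq); split=> //=.
- by move=> x y [].
- by move=> c; exists (c, 0).
- by move=> [x y] /=; split=> [->|[z [-> _]]] //; exists y.
Qed.

Lemma res_prod n A C : res n A -> res n C -> res n (A * C)%type.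
Proof. have [i [q [s _]]] := ses_prod A C; exact: res_horseshoe s. Qed.

(* With q1 : P ->> B, the kernel of P ->> C is an extension of A by ker q1. *)
Lemma res_cone n A B C (i : {linear A -> B}) (q : {linear B -> C}) :
  ses i q -> res n A -> res n.+1 B -> res n.+1 C.
Proof.
move=> [ii qs iq] rA [K [P [i1 [q1 [cP [i1i q1s iq1] rK]]]]].
have lq2 : linear (fun x => q (q1 x)) by move=> a x y; rewrite !linearP.
pose q2 := mklin lq2.
exists (subT (kersm q2)), P, (inc _), q2; split=> //.
  apply: ses_ker => c; have [b <-] := qs c; have [x <-] := q1s b.
  by exists x.
have j1P x : kersm q2 (i1 x).
  by rewrite /= (_ : q1 (i1 x) = 0) ?linear0 //; apply/iq1; exists x.
have pP (x : subT (kersm q2)) : exists a, i a = q1 (inc _ x).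
  by apply/iq; exact: (incP x).
have [p pE] := choice pP.
have lp : linear p.
  by move=> a x y; apply: ii; rewrite linearP !pE -linearP.
apply: (@res_horseshoe _ _ _ _ (corestr j1P) (mklin lp)) rK rA; split.
- by move=> x y /(congr1 (inc _)) /i1i.
- move=> a; have [x xE] := q1s (i a).
  have kx : kersm q2 x by rewrite /= xE; apply/iq; exists a.
  by exists (toS kx); apply: ii; rewrite /= pE.
- move=> b; split=> [/= pb|[a <-]]; last first.
    by apply: ii; rewrite /= pE linear0; apply/iq1; exists a.
  have /iq1[a aE] : q1 (inc _ b) = 0 by rewrite -pE pb linear0.
  by exists a; apply: inc_inj.
Qed.

End Ses.

Arguments res {R} cls n M.

Lemma sub_res (R : nzRingType) (c1 c2 : lmodType R -> Prop) n M :
  (forall P, c1 P -> c2 P) -> res c1 n M -> res c2 n M.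
Proof.
move=> c12; elim: n M => //= n IH M [A [P [i [q [cP s rA]]]]].
by exists A, P, i, q; split=> //; [apply: c12 | apply: IH].
Qed.

(** * Projective and finite free modules *)

Section Projective.
Variable R : nzRingType.
Implicit Types (A P Q M : lmodType R).

Lemma proj_prod P Q : projective P -> projective Q -> projective (P * Q)%type.
Proof.
move=> pP pQ M N g f gs.
have l1 : linear (fun x => f (x, 0)).
  move=> a x y; rewrite -linearP; congr (f _).
  by congr pair; rewrite /= scaler0 addr0.
have l2 : linear (fun y => f (0, y)).
  move=> a x y; rewrite -linearP; congr (f _).
  by congr pair; rewrite /= scaler0 addr0.
have [h1 E1] := pP _ _ g (mklin l1) gs.
have [h2 E2] := pQ _ _ g (mklin l2) gs.
have lh : linear (fun x : P * Q => h1 x.1 + h2 x.2).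
  by move=> a x y /=; rewrite !linearP scalerDr addrACA.
exists (mklin lh) => -[x y] /=; rewrite linearD E1 E2 /= -linearD.
by congr (f _); congr pair; rewrite ?addr0 ?add0r.
Qed.

Lemma proj_retract P Q (i : {linear Q -> P}) (q : {linear P -> Q}) :
  cancel i q -> projective P -> projective Q.
Proof.
move=> iq pP M N g f gs.
have lf : linear (fun x => f (q x)) by move=> a x y; rewrite !linearP.
have [h hE] := pP _ _ g (mklin lf) gs.
have lh : linear (fun x => h (i x)) by move=> a x y; rewrite !linearP.
by exists (mklin lh) => x; rewrite /= hE /= iq.
Qed.

Lemma proj_zero : exists2 Z : lmodType R, projective Z & forall z : Z, z = 0.
Proof.
have Z0 (z : {ffun 'I_0 -> R^o}) : z = 0 by apply/ffunP => -[].
exists {ffun 'I_0 -> R^o} => // M N g f gs.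
have l0 : linear (fun _ : {ffun 'I_0 -> R^o} => 0 : M).
  by move=> a x y; rewrite scaler0 addr0.
by exists (mklin l0) => x; rewrite /= (Z0 x) !linear0.
Qed.

Lemma proj_section P M (q : {linear M -> P}) :
  projective P -> (forall c, exists b, q b = c) ->
  exists s : {linear P -> M}, cancel s q.
Proof.
move=> pP qs; have l1 : linear (fun x : P => x) by [].
by have [h hE] := pP _ _ q (mklin l1) qs; exists h.
Qed.

Definition pres := res (@projective R).

Lemma res_projP M : pres 1 M <-> projective M.
Proof.
split=> [[A [P [i [q [pP [ii qs iq] A0]]]]]|].
  have qi : injective q.
    by apply: lin_inj => x /iq[a <-]; rewrite (A0 a) linear0.
  have [g [qg gq]] := bij_inv_lin qi qs.
  exact: proj_retract gq pP.
by apply: res_cls proj_zero _.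
Qed.

(** The fibre product [X] of two projective covers of [M] is an extension of [P] by [A'], which
    bounds its resolution, and of [P'] by [A], which splits. So [A] inherits the bound from [X]. *)
Lemma schanuel n A P M (i : {linear A -> P}) (q : {linear P -> M}) :
  ses i q -> projective P -> pres n.+2 M -> pres n.+1 A.
Proof.
move=> [ii qs iq] pP [A' [P' [i' [q' [pP' [i'i q's iq'] rA']]]]].
have lX : linear (fun x : P * P' => q x.1 - q' x.2).
  by move=> a x y; rewrite /= linearP linearP scalerBr opprD addrACA.
pose X := kersm (mklin lX).
have XE (x : subT X) : q (inc _ x).1 = q' (inc _ x).2.
  by apply/eqP; rewrite -subr_eq0; apply/eqP; exact: (incP x).
have lp1 : linear (fun x : subT X => (inc _ x).1) by [].
have lp2 : linear (fun x : subT X => (inc _ x).2) by [].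
have j1P a : X (0, i' a).
  by rewrite /= linear0 (_ : q' _ = 0) ?subrr //; apply/iq'; exists a.
have lj1 : linear (fun a => (0, i' a) : P * P').
  by move=> a x y; rewrite linearP; congr pair; rewrite /= scaler0 addr0.
have j2P a : X (i a, 0).
  by rewrite /= linear0 (_ : q _ = 0) ?subrr //; apply/iq; exists a.
have lj2 : linear (fun a => (i a, 0) : P * P').
  by move=> a x y; rewrite linearP; congr pair; rewrite /= scaler0 addr0.
have s1 : ses (@corestr _ _ _ X (mklin lj1) j1P) (mklin lp1).
  split=> [x y /(congr1 (inc _)) /= [] /i'i //|c|b].
    have [y yE] := q's (q c).
    have Xc : X (c, y) by rewrite /= yE subrr.
    by exists (toS Xc).
  split=> [/= b1|[a <-]] //.
  have /iq'[a aE] : q' (inc _ b).2 = 0 by rewrite -XE b1 linear0.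
  exists a; apply: inc_inj; rewrite -[LHS]/(0, i' a) aE.
  by apply: pair_ext; rewrite //= [RHS]b1.
have s2 : ses (@corestr _ _ _ X (mklin lj2) j2P) (mklin lp2).
  split=> [x y /(congr1 (inc _)) /= [] /ii //|c|b].
    have [y yE] := qs (q' c).
    have Xc : X (y, c) by rewrite /= yE subrr.
    by exists (toS Xc).
  split=> [/= b1|[a <-]] //.
  have /iq[a aE] : q (inc _ b).1 = 0 by rewrite XE b1 linear0.
  exists a; apply: inc_inj; rewrite -[LHS]/(i a, 0) aE.
  by apply: pair_ext; rewrite //= [RHS]b1.
have rX : pres n.+1 (subT X).
  apply: (res_horseshoe proj_prod _ s1) => //.
  apply: (res_le proj_zero (n := 1)) => //; exact/res_projP.
have [_ p2s ip2] := s2; have [s sE] := proj_section pP' p2s.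
pose p2 := mklin lp2; pose j2 := @corestr _ _ _ X (mklin lj2) j2P.
have j2i : injective j2 by have [] := s2.
have lD : linear (fun x => x - s (p2 x)).
  by move=> a x y; rewrite (linearP p2) (linearP s) scalerBr opprD addrACA.
have rP (x : subT X) : exists a, j2 a = mklin lD x.
  by apply/ip2; rewrite [LHS](linearB p2) [X in _ - X]sE subrr.
have [r rE] := choice rP.
have lr : linear r by move=> a x y; apply: j2i; rewrite linearP !rE linearP.
have p2j a : p2 (j2 a) = 0 by apply/ip2; exists a.
have rj a : r (j2 a) = a.
  by apply: j2i; rewrite rE -[RHS]subr0 -[in RHS](linear0 s) -(p2j a).
(* For [n = 0], [res_cone] would require [P'] to have a resolution without terms, so the retraction
   of [X] onto [A] is used directly. *)
case: n rX rA' => [|n] rX rA'.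
  move/res_projP: rX => pX; apply/res_projP.
  by apply: (@proj_retract _ _ j2 (mklin lr)) pX.
have js : ses s (mklin lr).
  split=> [x y sxy|a|b]; first by rewrite -[x]sE sxy sE.
    by exists (j2 a); apply: rj.
  split=> [/= rb|[a <-]].
    exists (p2 b); apply/esym/eqP; rewrite -subr_eq0.
    by rewrite -[_ - _]/(mklin lD b) -rE rb linear0.
  by apply: j2i; rewrite linear0 rE -[LHS]/(s a - s (p2 (s a))) (sE a : p2 _ = _) subrr.
apply: (res_cone proj_prod _ js) => //.
apply: (res_le proj_zero (n := 1)) => //; exact/res_projP.
Qed.

Lemma pd_leP p M : pd_le M p <-> pres p.+1 M.
Proof.
split.
  elim: p M => [|p IH] M [P [d [e [pP es ed dd P0]]]].
    apply/res_projP; have ei : injective e.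
      by apply: lin_inj => x /ed[y <-]; rewrite (P0 1%N isT y) linear0.
    have [g [qg gq]] := bij_inv_lin ei es.
    exact: proj_retract gq (pP 0%N).
  have HK (y : P 1%N) : kersm e (d 0%N y) by apply/ed; exists y.
  exists (subT (kersm e)), (P 0%N), (inc _), e; split=> //; first exact: ses_ker.
  apply: IH; exists (fun i => P i.+1), (fun i => d i.+1), (corestr HK).
  split=> //.
  - move=> y; have /ed[x xE] := incP y; exists x; exact: inc_inj.
  - move=> x; rewrite -dd; split=> [/(congr1 (inc _)) //|dx].
    exact: inc_inj.
  - by move=> i ip; apply: P0.
suff H n : pres n M -> exists (P : nat -> lmodType R)
    (d : forall i, {linear P i.+1 -> P i}) (e : {linear P 0 -> M}),
    [/\ forall i, projective (P i), forall y, exists x, e x = y,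
        forall x, e x = 0 <-> exists y, d 0 y = x,
        forall i x, d i x = 0 <-> exists y, d i.+1 y = x
      & forall i, (n <= i)%N -> forall x : P i, x = 0] by apply: H.
elim: n M => [|n IH] M.
  move=> M0; have [Z pZ Z0] := proj_zero.
  have l0 (N : lmodType R) : linear (fun _ : Z => 0 : N).
    by move=> a x y; rewrite scaler0 addr0.
  exists (fun=> Z), (fun=> mklin (l0 Z)), (mklin (l0 M)); split=> //.
  - by move=> y; exists 0; rewrite (M0 y).
  - by move=> x; rewrite (Z0 x); split=> // _; exists 0; rewrite linear0.
  - by move=> i x; rewrite (Z0 x); split=> // _; exists 0; rewrite linear0.
move=> [A [Q [i [q [pQ [ii qs iq] /IH[P [d [e [pP es ed dd P0]]]]]]]]].
have l1 : linear (fun x => i (e x)) by move=> a x y; rewrite !linearP.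
pose P' := fun j => if j is j'.+1 then P j' else Q.
pose d' j : {linear P' j.+1 -> P' j} :=
  match j with 0 => mklin l1 | j'.+1 => d j' end.
exists P', d', q; split=> //.
- by case.
- move=> x; rewrite iq; split=> [[a <-]|[y <-]]; last by exists (e y).
  by have [y <-] := es a; exists y.
- case=> [|j] x /=; last exact: dd.
  rewrite -ed; split=> [ie|->]; last by rewrite linear0.
  by apply: ii; rewrite ie linear0.
- by case.
Qed.

End Projective.

Section FiniteFree.
Variable R : nzRingType.

Definition finfree (P : lmodType R) : Prop :=
  exists n (f : {linear {ffun 'I_n -> R^o} -> P}),
    injective f /\ forall y, exists x, f x = y.

Definition unitv (J : finType) (j : J) : {ffun J -> R^o} :=
  [ffun j' => (j' == j)%:R].

Lemma ffun_expand (J : finType) (v : {ffun J -> R^o}) :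
  v = \sum_j (v j : R) *: unitv j.
Proof.
apply/ffunP => j; rewrite sum_ffunE (bigD1 j) //= big1 ?addr0 => [|j' jj'].
  by rewrite !ffunE eqxx [_ *: _]mulr1.
by rewrite !ffunE eq_sym (negPf jj') [_ *: _]mulr0.
Qed.

Lemma lincomb_lin (J : finType) (V : lmodType R) (E : J -> V) :
  linear (fun v : {ffun J -> R^o} => \sum_j (v j : R) *: E j).
Proof.
move=> a x y; rewrite scaler_sumr -big_split; apply: eq_bigr => j _ /=.
by rewrite !ffunE scalerDl scalerA.
Qed.
Definition lincomb (J : finType) (V : lmodType R) (E : J -> V) :
  {linear {ffun J -> R^o} -> V} := mklin (lincomb_lin E).

Lemma lincomb_unitv (J : finType) (V : lmodType R) (E : J -> V) j :
  lincomb E (unitv j) = E j.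
Proof.
rewrite /= (bigD1 j) //= big1 ?addr0 => [|j' jj'].
  by rewrite !ffunE eqxx scale1r.
by rewrite !ffunE (negPf jj') scale0r.
Qed.

Lemma linear_lincomb (J : finType) (V : lmodType R)
  (f : {linear {ffun J -> R^o} -> V}) v : f v = lincomb (fun j => f (unitv j)) v.
Proof.
rewrite [in LHS](ffun_expand v) linear_sum; apply: eq_bigr => j _.
by rewrite linearZ.
Qed.

Lemma linear_eq (J : finType) (V : lmodType R) (f g : {ffun J -> R^o} -> V) :
  linear f -> linear g -> (forall j, f (unitv j) = g (unitv j)) -> f =1 g.
Proof.
move=> lf lg fg x; have := linear_lincomb (mklin lf) x => /= ->.
have := linear_lincomb (mklin lg) x => /= ->.
by apply: eq_bigr => j _; rewrite fg.
Qed.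

Definition ffun_sum (I1 I2 : finType) (u1 : {ffun I1 -> R^o}) (u2 : {ffun I2 -> R^o})
  : {ffun I1 + I2 -> R^o} := [ffun i => match i with inl i => u1 i | inr i => u2 i end].

Lemma lincomb_sum (I1 I2 : finType) (V : lmodType R) (E : I1 + I2 -> V) u1 u2 :
  lincomb E (ffun_sum u1 u2) =
  lincomb (fun i => E (inl i)) u1 + lincomb (fun i => E (inr i)) u2.
Proof.
rewrite /= big_sumType /=; congr (_ + _); by apply: eq_bigr => i _; rewrite ffunE.
Qed.

Lemma proj_ffun (J : finType) : projective {ffun J -> R^o}.
Proof.
move=> M N g f gs.
have /choice[y yE] : forall j, exists y, g y = f (unitv j) by move=> j; apply: gs.
exists (lincomb y) => x; rewrite [RHS]linear_lincomb /= linear_sum.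
by apply: eq_bigr => j _; rewrite linearZ /= yE.
Qed.

Lemma finfree_iso (P Q : lmodType R) (f : {linear P -> Q}) :
  injective f -> (forall y, exists x, f x = y) -> finfree P -> finfree Q.
Proof.
move=> fi fs [n [g [gi gs]]].
have l : linear (fun x => f (g x)) by move=> a x y; rewrite !linearP.
exists n, (mklin l); split=> [x y /fi/gi //|y].
by have [x <-] := fs y; have [z <-] := gs x; exists z.
Qed.

Lemma finfree_proj (P : lmodType R) : finfree P -> projective P.
Proof.
move=> [n [f [fi fs]]]; have [g [fg gf]] := bij_inv_lin fi fs.
exact: proj_retract gf (@proj_ffun _).
Qed.

Lemma finfree_ffun (J : finType) : finfree {ffun J -> R^o}.
Proof.
have l : linear (fun v : {ffun 'I_#|J| -> R^o} => [ffun j => v (enum_rank j)] : {ffun J -> R^o}).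
  by move=> a x y; apply/ffunP => j; rewrite !ffunE.
exists #|J|, (mklin l); split=> [x y /ffunP xy|y].
  by apply/ffunP => i; have := xy (enum_val i); rewrite !ffunE enum_valK.
exists [ffun i => y (enum_val i)]; apply/ffunP => j.
by rewrite !ffunE enum_rankK.
Qed.

Lemma finfree_zero : exists2 Z : lmodType R, finfree Z & forall z : Z, z = 0.
Proof.
by exists {ffun 'I_0 -> R^o}; [exact: finfree_ffun|move=> z; apply/ffunP => -[]].
Qed.

Lemma finfree_prod (P Q : lmodType R) :
  finfree P -> finfree Q -> finfree (P * Q)%type.
Proof.
move=> [n [f [fi fs]]] [m [g [gi gs]]].
pose h (v : {ffun 'I_n + 'I_m -> R^o}) : P * Q :=
  (f [ffun i => v (inl i)], g [ffun i => v (inr i)]).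
have l : linear h.
  move=> a x y; apply: pair_ext => /=.
    by rewrite -(linearP f); congr (f _); apply/ffunP => i; rewrite !ffunE.
  by rewrite -(linearP g); congr (g _); apply/ffunP => i; rewrite !ffunE.
apply: (@finfree_iso _ _ (mklin l)); last exact: finfree_ffun.
  move=> x y [] /fi/ffunP e1 /gi/ffunP e2; apply/ffunP => -[] i.
    by have := e1 i; rewrite !ffunE.
  by have := e2 i; rewrite !ffunE.
move=> [y1 y2]; have [x1 <-] := fs y1; have [x2 <-] := gs y2.
exists [ffun i => match i with inl i => x1 i | inr i => x2 i end].
by apply: pair_ext => /=; [congr (f _)|congr (g _)]; apply/ffunP => i; rewrite !ffunE.
Qed.

(** Finite free terms are Koszul exact, which the depth arguments need; [graded_fres] returns to
    them from projective terms. *)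
Definition fres := res finfree.

End FiniteFree.

Arguments unitv R {J} j.

(** * Exterior multiplication and contraction *)

Section Exterior.
Variables (R : comNzRingType) (n : nat).
Implicit Types (i j : 'I_n) (K : {set 'I_n}) (u v : {ffun 'I_n -> R^o}).

Definition below i K := #|[set j in K | (j < i)%N]|.
Definition sgn i K : R := (-1) ^+ below i K.

Lemma below_del i j K : below i K = (((j \in K) && (j < i)%N) + below i (K :\ j))%N.
Proof.
rewrite /below (cardsD1 j) inE; congr (_ + _)%N.
by apply: eq_card => x; rewrite !inE andbA.
Qed.

Lemma sgn_del i j K : sgn i K = (-1) ^+ ((j \in K) && (j < i)%N) * sgn i (K :\ j).
Proof. by rewrite /sgn (below_del i j) exprD. Qed.

Lemma sgn_self i K : sgn i (i |: K) = sgn i K.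
Proof.
rewrite (sgn_del i i) ltnn andbF expr0 mul1r [RHS](sgn_del i i) ltnn andbF.
rewrite expr0 mul1r; congr sgn; apply/setP => x; rewrite !inE.
by case: eqVneq.
Qed.

Lemma sgn_sqr i K : sgn i K * sgn i K = 1.
Proof. by rewrite /sgn -exprD addnn -mul2n exprM sqrrN expr1n expr1n. Qed.

Lemma sgn_swap i j K : i != j -> i \in K -> j \in K ->
  sgn i K * sgn j (K :\ i) = - (sgn j K * sgn i (K :\ j)).
Proof.
move=> ij iK jK; rewrite (sgn_del i j K) (sgn_del j i K) iK jK /=.
have [h|h|/val_inj h] := ltngtP i j; last by rewrite h eqxx in ij.
  by rewrite expr0 expr1; ring.
by rewrite expr0 expr1; ring.
Qed.

Section Values.
Variable V : lmodType R.
Implicit Types w : {ffun {set 'I_n} -> V}.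

(** Left multiplication by dx_i; [divx] is contraction with the dual basis vector. Coefficients lie
    in any module, so that both differential forms and Koszul cochains are covered. *)
Definition mulx i w : {ffun {set 'I_n} -> V} :=
  [ffun K : {set 'I_n} => if i \in K then sgn i K *: w (K :\ i) else 0].
Definition divx i w : {ffun {set 'I_n} -> V} :=
  [ffun K : {set 'I_n} => if i \in K then 0 else sgn i K *: w (i |: K)].

Lemma mulx_lin i : linear (mulx i).
Proof.
move=> a x y; apply/ffunP => K; rewrite !ffunE.
case: ifP => _; last by rewrite scaler0 addr0.
by rewrite scalerDr !scalerA mulrC.
Qed.
HB.instance Definition _ i := GRing.isLinear.Build R _ _ _ (mulx i) (mulx_lin i).

Lemma divx_lin i : linear (divx i).
Proof.
move=> a x y; apply/ffunP => K; rewrite !ffunE.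
case: ifP => _; first by rewrite scaler0 addr0.
by rewrite scalerDr !scalerA mulrC.
Qed.
HB.instance Definition _ i := GRing.isLinear.Build R _ _ _ (divx i) (divx_lin i).

Lemma mulxC i j w : i != j -> mulx i (mulx j w) = - mulx j (mulx i w).
Proof.
move=> ij; apply/ffunP => K; rewrite !ffunE !inE (negPf ij) [j == i]eq_sym (negPf ij) /=.
case iK: (i \in K); case jK: (j \in K); rewrite ?scaler0 ?oppr0 //.
rewrite !scalerA -scaleNr -sgn_swap //; congr (_ *: w _).
by apply/setP => x; rewrite !inE andbCA.
Qed.

Lemma mulxx i w : mulx i (mulx i w) = 0.
Proof.
apply/ffunP => K; rewrite !ffunE !inE eqxx /=.
by case: ifP => //; rewrite scaler0.
Qed.

Lemma setUD1C i j K : i != j -> (j |: K) :\ i = j |: (K :\ i).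
Proof.
move=> ij; apply/setP => x; rewrite !inE.
by case: (x =P j) => [->|_]; rewrite //= eq_sym ij.
Qed.

Lemma mulx_divx i j w :
  mulx i (divx j w) + divx j (mulx i w) = (i == j)%:R *: w.
Proof.
apply/ffunP => K; rewrite !ffunE !inE; case: eqVneq => [->|ij] /=.
  rewrite ?eqxx /= scale1r; case iK: (i \in K).
    by rewrite addr0 scalerA -(sgn_self i (K :\ i)) setD1K // sgn_sqr scale1r.
  rewrite add0r scalerA sgn_self sgn_sqr scale1r; congr (w _).
  by apply/setP => x; rewrite !inE; case: (x =P i) => [->|].
rewrite scale0r; move: ij; rewrite eq_sym => ij.
case iK: (i \in K); case jK: (j \in K); rewrite ?scaler0 ?addr0 //.
rewrite !scalerA setUD1C // -scalerDl.
suff -> : sgn i K * sgn j (K :\ i) + sgn j K * sgn i (j |: K) = 0 by rewrite scale0r.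
have := @sgn_swap i j (j |: K) ij; rewrite !inE !eqxx iK orbT => /(_ isT isT).
rewrite setUD1C // !sgn_self => e.
have -> : sgn i K = sgn i ((j |: K) :\ j).
  by congr sgn; apply/setP => x; rewrite !inE; case: (x =P j) => [->|].
(* The swap rule gives [a * b = - (c * d)], whereas [d * b + c * a = 0] is wanted. As [a] and [d]
   square to 1, multiplication by [a * d] turns one into the other. *)
have := congr1 (fun t => sgn i (j |: K) * sgn i ((j |: K) :\ j) * t) e.
set a := sgn i (j |: K); set b := sgn j (K :\ i); set c := sgn j K.
set d := sgn i _ => e'.
have a2 : a * a = 1 := sgn_sqr _ _; have d2 : d * d = 1 := sgn_sqr _ _.
have x1 : a * d * (a * b) = d * b.
  by transitivity (a * a * (d * b)); [ring | rewrite a2 mul1r].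
have x2 : a * d * - (c * d) = - (c * a).
  by transitivity (- (d * d * (c * a))); [ring | rewrite d2 mul1r].
by rewrite -x1 e' x2 addNr.
Qed.

Definition ew u w : {ffun {set 'I_n} -> V} := \sum_i (u i : R) *: mulx i w.
Definition iv v w : {ffun {set 'I_n} -> V} := \sum_i (v i : R) *: divx i w.

Lemma ew_lin u : linear (ew u).
Proof.
move=> a x y; rewrite /ew scaler_sumr -big_split; apply: eq_bigr => i _ /=.
by rewrite linearP scalerDr !scalerA mulrC.
Qed.
HB.instance Definition _ u := GRing.isLinear.Build R _ _ _ (ew u) (ew_lin u).

Lemma iv_lin u : linear (iv u).
Proof.
move=> a x y; rewrite /iv scaler_sumr -big_split; apply: eq_bigr => i _ /=.
by rewrite linearP scalerDr !scalerA mulrC.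
Qed.
HB.instance Definition _ u := GRing.isLinear.Build R _ _ _ (iv u) (iv_lin u).

Lemma ewDl a u v w : ew (a *: u + v) w = a *: ew u w + ew v w.
Proof.
rewrite /ew scaler_sumr -big_split; apply: eq_bigr => i _ /=.
by rewrite !ffunE scalerDl scalerA.
Qed.

Lemma ew0l w : ew 0 w = 0.
Proof. by rewrite /ew big1 // => i _; rewrite ffunE scale0r. Qed.

Lemma ewD u v w : ew (u + v) w = ew u w + ew v w.
Proof. by rewrite -[u]scale1r ewDl !scale1r. Qed.

Lemma ewZl a u w : ew (a *: u) w = a *: ew u w.
Proof. by rewrite -[a *: u]addr0 ewDl ew0l addr0. Qed.

Lemma ewN u w : ew (- u) w = - ew u w.
Proof. by rewrite -scaleN1r ewZl scaleN1r. Qed.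

Lemma ew_unitv i w : ew (unitv R i) w = mulx i w.
Proof.
rewrite /ew (bigD1 i) //= big1 ?addr0 => [|j ji]; first by rewrite !ffunE eqxx scale1r.
by rewrite !ffunE (negPf ji) scale0r.
Qed.

Lemma iv_unitv i w : iv (unitv R i) w = divx i w.
Proof.
rewrite /iv (bigD1 i) //= big1 ?addr0 => [|j ji]; first by rewrite !ffunE eqxx scale1r.
by rewrite !ffunE (negPf ji) scale0r.
Qed.

Lemma sum_antisym (U : zmodType) (F : 'I_n -> 'I_n -> U) :
  (forall i, F i i = 0) -> (forall i j, i != j -> F i j = - F j i) ->
  \sum_i \sum_j F i j = 0.
Proof.
move=> F0 FN.
have -> : \sum_i \sum_j F i j = \sum_(i : 'I_n) \sum_(j : 'I_n | (i < j)%N) F i j + \sum_(i : 'I_n) \sum_(j : 'I_n | (j < i)%N) F i j.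
  rewrite -big_split; apply: eq_bigr => i _ /=.
  rewrite (bigID (fun j : 'I_n => (i < j)%N)) /=; congr (_ + _).
  rewrite (bigD1 i) ?ltnn //= F0 add0r; apply: eq_bigl => j.
  by rewrite -leqNgt ltn_neqAle andbC.
rewrite [X in _ + X](exchange_big_dep xpredT) //= -big_split big1 //= => i _.
rewrite -big_split big1 //= => j ij; rewrite [F j i]FN ?subrr //.
by rewrite -val_eqE /= gtn_eqF.
Qed.

Lemma ewE u v w : ew u (ew v w) = \sum_i \sum_j ((u i : R) * v j) *: mulx i (mulx j w).
Proof.
rewrite /ew; apply: eq_bigr => i _; rewrite linear_sum scaler_sumr.
by apply: eq_bigr => j _; rewrite linearZ scalerA.
Qed.

Lemma ewK u w : ew u (ew u w) = 0.
Proof.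
rewrite ewE; apply: sum_antisym => [i|i j ij]; first by rewrite mulxx scaler0.
by rewrite mulxC // scalerN mulrC.
Qed.

Lemma ewC u v w : ew u (ew v w) = - ew v (ew u w).
Proof.
apply/eqP; rewrite -addr_eq0; apply/eqP.
have := ewK (u + v) w; rewrite !ewD !linearD /= !ewK.
by rewrite add0r addr0 addrC.
Qed.

Definition dot u v : R := \sum_i (u i : R) * v i.

Lemma dotDl a u v v' : dot (a *: u + v) v' = a * dot u v' + dot v v'.
Proof.
rewrite /dot mulr_sumr -big_split; apply: eq_bigr => i _ /=.
by rewrite !ffunE mulrDl mulrA.
Qed.

(** The Clifford relation. It is the homotopy behind Koszul exactness, contraction of logarithmic
    forms and the splitting along [H]. *)
Lemma ew_iv u v w : ew u (iv v w) + iv v (ew u w) = dot u v *: w.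
Proof.
have -> : ew u (iv v w) = \sum_i \sum_j ((u i : R) * v j) *: mulx i (divx j w).
  rewrite /ew; apply: eq_bigr => i _; rewrite linear_sum scaler_sumr.
  by apply: eq_bigr => j _; rewrite linearZ scalerA.
have -> : iv v (ew u w) = \sum_i \sum_j ((u i : R) * v j) *: divx j (mulx i w).
  rewrite exchange_big; apply: eq_bigr => i _; rewrite linear_sum scaler_sumr.
  by apply: eq_bigr => j _; rewrite linearZ scalerA mulrC.
rewrite -big_split /dot scaler_suml; apply: eq_bigr => i _ /=.
rewrite -big_split (bigD1 i) //= big1 ?addr0 => [|j ji].
  by rewrite -scalerDr mulx_divx eqxx scale1r.
by rewrite -scalerDr mulx_divx eq_sym (negPf ji) scale0r scaler0.
Qed.

Lemma iv_ew u v w : iv v (ew u w) = dot u v *: w - ew u (iv v w).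
Proof. by rewrite -(ew_iv u v w) addrC addKr. Qed.

Lemma pform0 p : @pform n V p 0.
Proof. by move=> K _; rewrite ffunE. Qed.

Lemma pformL p a w w' : pform p w -> pform p w' -> pform p (a *: w + w').
Proof. by move=> h h' K pK; rewrite !ffunE h // h' // scaler0 addr0. Qed.

Lemma pform_mulx p i w : pform p w -> pform p.+1 (mulx i w).
Proof.
move=> h K pK; rewrite ffunE; case: ifP => // iK; rewrite h ?scaler0 //.
by move: pK; rewrite (cardsD1 i K) iK eqSS.
Qed.

Lemma pform_divx p i w : pform p.+1 w -> pform p (divx i w).
Proof.
move=> h K pK; rewrite ffunE; case: ifP => // iK; rewrite h ?scaler0 //.
by rewrite cardsU1 iK eqSS.
Qed.

Lemma pform_sum p (F : 'I_n -> {ffun {set 'I_n} -> V}) :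
  (forall i, pform p (F i)) -> pform p (\sum_i F i).
Proof.
move=> h; apply: (big_ind (@pform n V p)) => // [|x y hx hy].
  exact: pform0.
by rewrite -[x]scale1r; apply: pformL.
Qed.

Lemma pformZ p a w : pform p w -> pform p (a *: w).
Proof. by move=> h K pK; rewrite ffunE h ?scaler0. Qed.

Lemma pform_ew p u w : pform p w -> pform p.+1 (ew u w).
Proof.
by move=> h; apply: pform_sum => i; apply/pformZ/pform_mulx.
Qed.

Lemma pform_iv p v w : pform p.+1 w -> pform p (iv v w).
Proof.
by move=> h; apply: pform_sum => i; apply/pformZ/pform_divx.
Qed.

Lemma iv_pform0 v w : pform 0 w -> iv v w = 0.
Proof.
move=> h; rewrite /iv big1 // => i _; apply/ffunP => K.
rewrite !ffunE; case: ifP => iK; first by rewrite scaler0.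
by rewrite h ?scaler0 // cardsU1 iK.
Qed.

Definition hproj p w : {ffun {set 'I_n} -> V} :=
  [ffun K : {set 'I_n} => if #|K| == p then w K else 0].

Lemma ew_hproj p u w : pform p.+1 (ew u w) -> ew u w = ew u (hproj p w).
Proof.
move=> h; apply/ffunP => K; have [pK|pK] := boolP (#|K| == p.+1); last first.
  rewrite h // (_ : ew u (hproj p w) K = 0) //; apply: pform_ew pK => L pL.
  by rewrite ffunE (negPf pL).
rewrite /ew !sum_ffunE; apply: eq_bigr => k _; rewrite !ffunE.
by case: ifP => // kK; move: pK; rewrite (cardsD1 k K) kK eqSS => ->.
Qed.

Lemma ew_set0 u w : ew u w set0 = 0.
Proof. by rewrite sum_ffunE big1 // => i _; rewrite !ffunE inE scaler0. Qed.

Lemma ew_set1 u w i : ew u w [set i] = (u i : R) *: w set0.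
Proof.
rewrite sum_ffunE (bigD1 i) //= big1 ?addr0 => [|j ji].
  rewrite !ffunE set11 setDv scalerA (_ : sgn _ _ = 1) ?mulr1 //.
  rewrite /sgn (_ : below _ _ = 0%N) //; apply/eqP; rewrite cards_eq0.
  by apply/eqP/setP => x; rewrite !inE; case: (x =P i) => [->|]; rewrite ?ltnn.
by rewrite !ffunE inE (negPf ji) scaler0.
Qed.

End Values.
End Exterior.

Lemma ew_map (R : comNzRingType) n (V W : lmodType R) (f : {linear V -> W})
    (u : {ffun 'I_n -> R^o}) (w : {ffun {set 'I_n} -> V}) :
  ew u [ffun K => f (w K)] = [ffun K => f (ew u w K)].
Proof.
apply/ffunP => K; rewrite /ew !sum_ffunE !ffunE sum_ffunE linear_sum.
apply: eq_bigr => i _; rewrite !ffunE /=.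
by rewrite [RHS]linearZ_LR; case: ifP => _; rewrite ?linear0 ?(linearZ_LR f).
Qed.

(** * Koszul cohomology of a regular sequence *)

Section Koszul.
Variables (R : comNzRingType) (r : nat) (g : {ffun 'I_r -> R^o}).

Definition seqideal (j : nat) (x : R) : Prop :=
  exists c : 'I_r -> R, x = \sum_(i < r | (i < j)%N) c i * g i.

Definition regular_seq : Prop :=
  forall (j : 'I_r) x, seqideal j (g j * x) -> seqideal j x.

Lemma seqideal0 j : seqideal j 0.
Proof. by exists (fun=> 0); rewrite big1 // => i _; rewrite mul0r. Qed.

Lemma seqidealL j a x y : seqideal j x -> seqideal j y -> seqideal j (a * x + y).
Proof.
move=> [c ->] [d ->]; exists (fun i => a * c i + d i).
by rewrite mulr_sumr -big_split; apply: eq_bigr => i _ /=; rewrite mulrDl mulrA.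
Qed.

Lemma seqidealS (j : 'I_r) x :
  seqideal j.+1 x <-> exists b, seqideal j (x - g j * b).
Proof.
have sumS c : \sum_(i < r | (i < j.+1)%N) c i * g i =
    c j * g j + \sum_(i < r | (i < j)%N) c i * g i.
  rewrite (bigD1 j) //=; congr (_ + _); apply: eq_bigl => i.
  by rewrite ltnS [RHS]ltn_neqAle andbC.
split=> [[c ->]|[b [c e]]].
  by exists (c j); exists c; rewrite sumS mulrC addrC addKr.
exists (fun i => if i == j then b else c i); rewrite sumS eqxx.
rewrite -[LHS](subrK (g j * b)) e addrC mulrC; congr (_ + _).
by apply: eq_bigr => i ij; rewrite -val_eqE /= ltn_eqF.
Qed.

Definition koszul_exact (V : lmodType R) : Prop :=
  forall s (w : {ffun {set 'I_r} -> V}), (s < r)%N -> pform s w ->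
    ew g w = 0 -> exists y, w = ew g y.

Hypothesis greg : regular_seq.

(* Since [g j] acts as zero on cohomology, through contraction with the
   [j]-th coordinate, vanishing modulo g_0, ..., g_j descends to vanishing in
   one degree more modulo g_0, ..., g_(j-1). *)
Lemma koszul_mod d j s (w : {ffun {set 'I_r} -> R^o}) : (d + j)%N = r ->
  (s < d)%N -> pform s w -> (forall K, seqideal j (ew g w K)) ->
  exists y, forall K, seqideal j (w K - ew g y K).
Proof.
elim: d j s w => // d IH j s w djr sd pw gw.
have jr : (j < r)%N by rewrite -djr addSn ltnS leq_addl.
pose jo := Ordinal jr; pose z := iv (unitv R jo) w.
have zE K : (ew g z) K = g jo * w K - iv (unitv R jo) (ew g w) K.
  rewrite iv_ew !ffunE /z opprB addrC -[_ *: w K]/(_ * w K).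
  rewrite (_ : dot g _ = g jo); first by rewrite subrK.
  rewrite /dot (bigD1 jo) //= big1 => [|i ij]; first by rewrite ffunE eqxx mulr1 addr0.
  by rewrite ffunE (negPf ij) mulr0.
have ij K : seqideal j (iv (unitv R jo) (ew g w) K).
  rewrite iv_unitv ffunE; case: ifP => _; first exact: seqideal0.
  by rewrite -[_ *: _]addr0; apply: seqidealL (seqideal0 _).
have [y yE] : exists y, forall K, seqideal j.+1 (z K - ew g y K).
  case: s sd pw gw @z zE => [|s] sd pw gw z zE.
    exists 0 => K; rewrite /z iv_pform0 // linear0 subrr; exact: seqideal0.
  apply: (IH j.+1 s) => //; first by rewrite addnS -addSn.
    exact: pform_iv.
  move=> K; apply/(seqidealS jo); exists (w K); rewrite zE addrC addKr.
  by rewrite -mulN1r -[_ * _]addr0; apply: seqidealL (seqideal0 _).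
have /choice[b bE] : forall K, exists b, seqideal j (z K - ew g y K - g jo * b).
  by move=> K; apply/(seqidealS jo).
(* Wedging the congruence z = g /\ y + g_j b with [g] gives g_j (w - g /\ b) = 0 modulo g_0, ...,
   g_(j-1), and regularity cancels g_j. *)
exists [ffun K => b K] => K; apply: (greg (j := jo)) => /=.
set b' := [ffun _ => _].
have eb (y1 : {ffun {set 'I_r} -> R^o}) L (P : forall K, seqideal j (y1 K)) :
    seqideal j (ew g y1 L).
  rewrite sum_ffunE; apply: (big_ind (seqideal j)) => [|a c ja jc|i _].
  - exact: seqideal0.
  - by rewrite -[a]mul1r; apply: seqidealL.
  rewrite !ffunE; case: ifP => _; last by rewrite scaler0; apply: seqideal0.
  by rewrite scalerA -[_ *: _]addr0; apply: seqidealL (seqideal0 _).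
have := eb (z - ew g y - g jo *: b') K.
have -> : (ew g (z - ew g y - g jo *: b')) K =
    g jo * w K - iv (unitv R jo) (ew g w) K - g jo * ew g b' K.
  by rewrite !linearB linearZ /= ewK subr0 ffunE zE !ffunE.
move=> H; have {}H : seqideal j (g jo * w K - iv (unitv R jo) (ew g w) K -
    g jo * ew g b' K).
  by apply: H => L; rewrite !ffunE; exact: bE.
have := seqidealL 1 H (ij K); rewrite mul1r mulrBr; congr seqideal.
by rewrite addrAC subrK.
Qed.

Lemma koszul_exact_ring : koszul_exact R^o.
Proof.
have i0 x : seqideal 0 x <-> x = 0.
  by split=> [[c ->]|->]; [rewrite big_pred0 | exact: seqideal0].
move=> s w sr pw gw.
have [||y yE] := @koszul_mod r 0 s w _ sr pw; first by rewrite addn0.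
  by move=> K; apply/i0; rewrite gw ffunE.
by exists y; apply/ffunP => K; apply/eqP; rewrite -subr_eq0; apply/eqP/i0.
Qed.

Lemma koszul_exact_ffun (J : finType) : koszul_exact {ffun J -> R^o}.
Proof.
move=> s w sr pw gw.
pose w_ j : {ffun {set 'I_r} -> R^o} := [ffun K => w K j].
have lE j : linear (fun v : {ffun J -> R^o} => v j) by move=> a x y; rewrite !ffunE.
have /choice[y yE] : forall j, exists y, w_ j = ew g y.
  move=> j; apply: (koszul_exact_ring sr).
    by move=> K pK; rewrite ffunE pw ?ffunE.
  have -> : w_ j = [ffun K => mklin (lE j) (w K)] by apply/ffunP => K; rewrite !ffunE.
  by rewrite ew_map gw; apply/ffunP => K; rewrite !ffunE /= ffunE.
exists [ffun K => [ffun j => y j K]]; apply/ffunP => K; apply/ffunP => j.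
have := congr1 (fun z : {ffun _ -> _} => z K) (yE j); rewrite ffunE => ->.
set y' := [ffun _ => _].
have -> : y j = [ffun K => mklin (lE j) (y' K)].
  by apply/ffunP => L; rewrite !ffunE /= ffunE.
by rewrite ew_map ffunE.
Qed.

Lemma koszul_exact_finfree (P : lmodType R) : finfree P -> koszul_exact P.
Proof.
move=> [n [f [fi fs]]] s w sr pw gw.
have [h [fh hf]] := bij_inv_lin fi fs.
have [||y yE] := @koszul_exact_ffun 'I_n s [ffun K => h (w K)] sr.
- by move=> K pK; rewrite ffunE pw ?linear0.
- by rewrite ew_map gw; apply/ffunP => K; rewrite !ffunE linear0.
exists [ffun K => f (y K)]; rewrite ew_map -yE.
by apply/ffunP => K; rewrite !ffunE hf.
Qed.

(** With [i] read as an inclusion, Koszul cohomology of [V / A] vanishes in degree [s]. Each term of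
    the resolution of [A] shifts the degree by one, whence [s + n < r]. *)
Lemma koszul_res n (A V : lmodType R) (i : {linear A -> V}) s
    (w : {ffun {set 'I_r} -> V}) (u : {ffun {set 'I_r} -> A}) :
  fres n A -> koszul_exact V -> injective i -> (s + n < r)%N -> pform s w ->
  ew g w = [ffun K => i (u K)] ->
  exists a y, w = [ffun K => i (a K)] + ew g y.
Proof.
elim: n A V i s w u => [|n IH] A V i s w u.
  move=> A0 kV ii; rewrite addn0 => sr pw gw.
  have [y ->] : exists y, w = ew g y.
    by apply: (kV s) => //; rewrite gw; apply/ffunP => K; rewrite !ffunE (A0 (u K)) linear0.
  exists (0 : {ffun {set 'I_r} -> A}), y.
  rewrite (_ : [ffun _ => _] = 0) ?add0r //.
  by apply/ffunP => K; rewrite !ffunE linear0.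
move=> [A' [P [j [q [cP [ji qs jq] rA']]]]] kV ii snr pw gw.
have gu : ew g u = 0.
  apply/ffunP => K; apply: ii; rewrite [in RHS]ffunE linear0.
  have := congr1 (fun z : {ffun _ -> V} => z K) (ew_map i g u).
  by rewrite [RHS]ffunE => <-; rewrite -gw ewK ffunE.
have pu : pform s.+1 u.
  move=> K pK; apply: ii; rewrite linear0.
  by have := pform_ew g pw pK; rewrite gw ffunE.
(* Lift the [A]-valued coboundary [u] to the cover [P]: the coboundary of the lift lies in the
   syzygies [A'], so induction applies in degree [s.+1] and exhibits [u] as a coboundary within
   [A]. *)
have /choice[t tE] : forall K, exists t, q t = u K /\ (#|K| != s.+1 -> t = 0).
  move=> K; have [pK|pK] := boolP (#|K| != s.+1).
    by exists 0; rewrite linear0 pu.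
  by have [t] := qs (u K); exists t.
pose tf := [ffun K => t K].
have qt : [ffun K => q (tf K)] = u by apply/ffunP => K; rewrite !ffunE (tE K).1.
have /choice[u' u'E] : forall K, exists a, j a = ew g tf K.
  move=> K; apply/jq; have := congr1 (fun z : {ffun _ -> A} => z K) (ew_map q g tf).
  by rewrite [RHS]ffunE qt gu ffunE => <-.
have [||||||a [y ty]] := IH A' P j s.+1 tf [ffun K => u' K] => //.
- exact: koszul_exact_finfree.
- by rewrite addSnnS.
- by move=> K pK; rewrite ffunE (tE K).2.
- by apply/ffunP => K; rewrite !ffunE u'E.
pose y' := [ffun K => q (y K)].
have uE : u = ew g y'.
  rewrite ew_map -qt ty; apply/ffunP => K; rewrite !ffunE linearD.
  by rewrite (_ : q (j _) = 0) ?add0r //; apply/jq; exists (a K).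
rewrite uE in pu; have uE' := uE; rewrite (ew_hproj pu) in uE'.
have [|||x xE] := kV s (w - [ffun K => i (hproj s y' K)]).
- by apply: leq_ltn_trans snr; rewrite leq_addr.
- by move=> K pK; rewrite !ffunE pw // (negPf pK) linear0 subr0.
- by rewrite linearB /= gw ew_map -uE'; apply/ffunP => K; rewrite !ffunE subrr.
by exists (hproj s y'), x; rewrite -xE addrC subrK.
Qed.

End Koszul.

(** * Functoriality of the exterior algebra *)

Local Notation forms n R := {ffun {set 'I_n} -> R^o}.
Local Notation vec n R := {ffun 'I_n -> R^o}.

Section Ext.
Variable R : comNzRingType.

Definition one n : forms n R := [ffun K => (K == set0)%:R].

Lemma pform_one n : pform 0 (one n).
Proof. by move=> K; rewrite ffunE cards_eq0 => /negPf ->. Qed.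

Lemma form0_one n (w : forms n R) : pform 0 w -> w = (w set0 : R) *: one n.
Proof.
move=> w0; apply/ffunP => K; rewrite !ffunE.
have [->|K0] := eqVneq K set0; first by rewrite [_ *: _]mulr1.
by rewrite w0 ?cards_eq0 // [_ *: _]mulr0.
Qed.

Lemma pform_ind n (P : nat -> forms n R -> Prop) :
  (forall p, P p 0) ->
  (forall p a x y, P p x -> P p y -> P p (a *: x + y)) ->
  P 0 (one n) -> (forall p i w, P p w -> P p.+1 (mulx i w)) ->
  forall p w, pform p w -> P p w.
Proof.
move=> P0 PL P1 PE p w pw.
have PZ q c x : P q x -> P q (c *: x).
  by move=> Px; rewrite -[c *: x]addr0; apply: PL => //; exact: P0.
have PK q (K : {set 'I_n}) : #|K| = q -> P q (unitv R K).
  elim: q K => [|q IH] K cK.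
    move/eqP: cK; rewrite cards_eq0 => /eqP ->.
    by have -> : unitv R set0 = one n by apply/ffunP => L; rewrite !ffunE.
  have [i iK] : exists i, i \in K by apply/set0Pn; rewrite -cards_eq0 cK.
  have := PE q i (unitv R (K :\ i)).
  have -> : unitv R K = sgn R i K *: mulx i (unitv R (K :\ i)).
    apply/ffunP => L; rewrite !ffunE.
    have [->|LK] := eqVneq L K; first by rewrite iK eqxx [sgn R i K *: 1]mulr1 [RHS]sgn_sqr.
    case: ifP => [iL|_]; last by rewrite scaler0.
    suff /negPf -> : L :\ i != K :\ i by rewrite !scaler0.
    by apply: contra LK => /eqP e; rewrite -(setD1K iL) e setD1K.
  move=> H; apply: PZ; apply: H; apply: IH.
  by apply/eqP; rewrite -eqSS -cK [in X in _ == X](cardsD1 i K) iK.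
rewrite (ffun_expand w); apply: (big_ind (P p)) => [|x y Px Py|K _]; first exact: P0.
  by rewrite -[x]scale1r; apply: PL.
have [/eqP cK|cK] := boolP (#|K| == p); last by rewrite pw // scale0r; exact: P0.
by apply: PZ; apply: PK.
Qed.

Lemma form_ind n (P : forms n R -> Prop) :
  P 0 -> (forall a x y, P x -> P y -> P (a *: x + y)) ->
  P (one n) -> (forall i w, P w -> P (mulx i w)) -> forall w, P w.
Proof.
move=> P0 PL P1 PE w; rewrite (ffun_expand w).
apply: (big_ind P) => [|x y Px Py|K _]; first exact: P0.
  by rewrite -[x]scale1r; apply: PL.
rewrite -[(w K : R) *: _]addr0; apply: (PL); last exact: P0.
apply: (@pform_ind n (fun=> P) (fun=> P0) (fun=> PL) P1 (fun=> PE) #|K|) => L.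
by rewrite ffunE; case: (L =P K) => // ->; rewrite eqxx.
Qed.

Section ExtT.
Variables (a b : nat) (T : 'I_a -> vec b R).

Definition wprod (s : seq 'I_a) (K : {set 'I_a}) : forms b R :=
  foldr (fun i w => if i \in K then ew (T i) w else w) (one b) s.

Lemma wprod_mulx s K i : sorted (fun i j : 'I_a => (i < j)%N) s -> i \in s ->
  ew (T i) (wprod s K) = if i \in K then 0 else
   (-1) ^+ #|[set j in K | (j < i)%N && (j \in s)]| *: wprod s (i |: K).
Proof.
elim: s => // j s IH /= sS; rewrite inE.
have tr : transitive (fun i j : 'I_a => (i < j)%N) by move=> ? ? ? /ltn_trans; apply.
have js x : x \in s -> (j < x)%N.
  by move=> xs; move: sS; rewrite (path_sortedE tr) => /andP[/allP/(_ x xs)].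
have jNs : j \notin s by apply/negP => /js; rewrite ltnn.
have eqw (t : seq 'I_a) : j \notin t -> wprod t (j |: K) = wprod t K.
  elim: t => //= x t IHt; rewrite inE negb_or => /andP[jx /IHt ->].
  by rewrite !inE [x == j]eq_sym (negPf jx).
have [->|ij] /= := eqVneq i j.
  move=> _; rewrite ?inE ?eqxx /=; case: ifP => jK; first by rewrite ewK.
  rewrite (_ : #|_| = 0%N) ?scale1r ?eqw //; apply/eqP; rewrite cards_eq0.
  apply/eqP/setP => x; rewrite !inE; apply/negbTE/negP => /and3P[_ xj].
  case/orP => [/eqP xe|/js]; first by rewrite xe ltnn in xj.
  by rewrite ltnNge (ltnW xj).
move=> is_; have ji := js i is_.
have sS' : sorted (fun i j : 'I_a => (i < j)%N) s by apply: path_sorted sS.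
rewrite !inE [j == i]eq_sym (negPf ij) /=; case: ifP => jK.
  rewrite ewC IH //; case: ifP => iK; first by rewrite linear0 oppr0.
  rewrite linearZ /= -scaleNr; congr (_ *: _).
  rewrite -[LHS]mulN1r -exprS; congr (_ ^+ _).
  rewrite [RHS](cardsD1 j) !inE jK ji ?eqxx /= add1n; congr _.+1.
  apply: eq_card => x; rewrite !inE; have [->|xj] //= := eqVneq x j.
  by rewrite (negPf jNs) !andbF.
rewrite IH //; case: ifP => iK //; congr (_ ^+ _ *: _).
apply: eq_card => x; rewrite !inE; have [->|xj] //= := eqVneq x j.
by rewrite jK.
Qed.

(** The map of exterior algebras induced by the matrix [T]; [ext_unique] is its universal
    property. *)
Definition ext (w : forms a R) : forms b R :=
  \sum_K (w K : R) *: wprod (enum 'I_a) K.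

Lemma ext_lin : linear ext.
Proof. exact: (lincomb_lin (fun K => wprod (enum 'I_a) K)). Qed.
HB.instance Definition _ := GRing.isLinear.Build R _ _ _ ext ext_lin.

Lemma ext_unitv (K : {set 'I_a}) : ext (unitv R K) = wprod (enum 'I_a) K.
Proof. exact: (lincomb_unitv (fun K => wprod (enum 'I_a) K)). Qed.

Lemma ext_one : ext (one a) = one b.
Proof.
have -> : one a = unitv R set0 by apply/ffunP => L; rewrite !ffunE.
by rewrite ext_unitv; elim: (enum _) => //= i s ->; rewrite inE.
Qed.

Lemma mulx_unitv i (K : {set 'I_a}) : mulx i (unitv R K) =
  if i \in K then 0 else sgn R i K *: unitv R (i |: K).
Proof.
apply/ffunP => L; rewrite !ffunE; case iK: (i \in K).
  rewrite ffunE; case: ifP => // iL; rewrite (_ : (_ == _) = false) ?scaler0 //.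
  by apply/negP => /eqP e; move: iK; rewrite -e !inE eqxx.
rewrite !ffunE; have [->|LK] := eqVneq L (i |: K).
  rewrite setU11 sgn_self setU1K ?iK // eqxx //.
case: ifP => iL; last by rewrite scaler0.
rewrite (_ : (_ == _) = false) ?scaler0 //; apply: contraNF LK => /eqP <-.
by rewrite setD1K.
Qed.

Lemma sorted_enum_ord : sorted (fun i j : 'I_a => (i < j)%N) (enum 'I_a).
Proof.
by have := iota_ltn_sorted 0 a; rewrite -val_enum_ord sorted_map.
Qed.

Lemma ext_mulx i w : ext (mulx i w) = ew (T i) (ext w).
Proof.
move: w; apply: linear_eq => [c x y|c x y|K]; try by rewrite !linearP.
rewrite ext_unitv mulx_unitv.
rewrite wprod_mulx ?sorted_enum_ord ?mem_enum //; case: ifP => iK.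
  by rewrite linear0.
rewrite linearZ /= ext_unitv /sgn /below; congr (_ ^+ _ *: _).
by apply: eq_card => j; rewrite !inE mem_enum !andbT.
Qed.

Lemma ext_ew u w : ext (ew u w) = ew (lincomb T u) (ext w).
Proof.
move: u; apply: linear_eq => [c x y|c x y|i].
- by rewrite ewDl linearP.
- by rewrite linearP ewDl.
- by rewrite ew_unitv ext_mulx lincomb_unitv.
Qed.

Lemma pform_ext p w : pform p w -> pform p (ext w).
Proof.
apply: (@pform_ind a (fun p w => pform p (ext w))) => {p w} [p|p c x y hx hy||p i w h].
- rewrite linear0; exact: pform0.
- by rewrite linearP; apply: pformL.
- by rewrite ext_one; apply: pform_one.
- by rewrite ext_mulx; apply: pform_ew.
Qed.

Lemma dot_unitv n i (v : vec n R) : dot (unitv R i) v = v i.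
Proof.
rewrite /dot (bigD1 i) //= big1 => [|j ji]; first by rewrite ffunE eqxx mul1r addr0.
by rewrite ffunE (negPf ji) mul0r.
Qed.

Lemma dotC n (u v : vec n R) : dot u v = dot v u.
Proof. by apply: eq_bigr => i _; rewrite mulrC. Qed.

Lemma iv_one n (v : vec n R) : iv v (one n) = 0.
Proof. by apply: iv_pform0; apply: pform_one. Qed.

Lemma iv_ext (v : vec b R) w :
  iv v (ext w) = ext (iv [ffun i => dot (T i) v] w).
Proof.
move: w; apply: form_ind => [|c x y hx hy||i w h].
- by rewrite !linear0.
- by rewrite !linearP /= hx hy.
- by rewrite ext_one !iv_one linear0.
rewrite ext_mulx iv_ew h -[mulx i w]ew_unitv iv_ew linearB linearZ /=.
rewrite ext_ew lincomb_unitv; congr (_ *: _ - _).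
by rewrite dot_unitv ffunE.
Qed.

Lemma ext_unique (F : {linear forms a R -> forms b R}) :
  F (one a) = one b -> (forall i w, F (mulx i w) = ew (T i) (F w)) ->
  forall w, F w = ext w.
Proof.
move=> F1 FE; apply: form_ind => [|c x y hx hy||i w h].
- by rewrite !linear0.
- by rewrite !linearP /= hx hy.
- by rewrite F1 ext_one.
- by rewrite FE ext_mulx h.
Qed.

End ExtT.

Lemma ext_comp a b c (T : 'I_a -> vec b R) (T' : 'I_b -> vec c R) w :
  ext T' (ext T w) = ext (fun i => lincomb T' (T i)) w.
Proof.
have l : linear (fun w => ext T' (ext T w)) by move=> x y z; rewrite !linearP.
apply: (ext_unique (F := mklin l)) => [|i w'] /=; first by rewrite !ext_one.
by rewrite ext_mulx ext_ew.
Qed.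

Lemma ext_scale a (f : R) p (w : forms a R) : pform p w ->
  ext (fun i => f *: unitv R i) w = f ^+ p *: w.
Proof.
apply: (@pform_ind a (fun p w => ext _ w = f ^+ p *: w)) => {p w} [p|p c x y hx hy||p i w h].
- by rewrite linear0 scaler0.
- by rewrite linearP /= hx hy scalerDr !scalerA mulrC.
- by rewrite ext_one scale1r.
- by rewrite ext_mulx h ewZl ew_unitv linearZ scalerA exprS.
Qed.

Lemma ext_id a (w : forms a R) : ext (unitv R (J := 'I_a)) w = w.
Proof.
have l : linear (fun w : forms a R => w) by [].
by rewrite -(ext_unique (F := mklin l)) // => i w'; rewrite ew_unitv.
Qed.

Lemma eq_ext a b (T T' : 'I_a -> vec b R) w : T =1 T' -> ext T w = ext T' w.
Proof. by move=> /funext ->. Qed.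

(* The exterior power of the projection along [v] onto the kernel of [v]. *)
Lemma ext_proj a (u v : vec a R) (w : forms a R) : dot u v = 1 ->
  ext (fun i => unitv R i - (v i : R) *: u) w = iv v (ew u w).
Proof.
move=> uv; have l : linear (fun w : forms a R => iv v (ew u w)).
  by move=> x y z; rewrite !linearP.
rewrite -(ext_unique (F := mklin l)) //= => [|i w'].
  by rewrite iv_ew uv scale1r iv_one linear0 subr0.
rewrite -ew_unitv ewC linearN /= iv_ew dot_unitv opprB.
rewrite ewD ew_unitv ewN ewZl; congr (_ - _ *: _).
by rewrite iv_ew uv scale1r linearB /= ewK subr0.
Qed.

End Ext.

Section MapForms.
Variables (R R' : comNzRingType) (f : {rmorphism R -> R'}).

Definition mapf (J : finType) (w : {ffun J -> R^o}) : {ffun J -> R'^o} :=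
  [ffun j => f (w j)].

Lemma mapfL (J : finType) a (x y : {ffun J -> R^o}) : mapf (a *: x + y) = f a *: mapf x + mapf y.
Proof. by apply/ffunP => j; rewrite !ffunE rmorphD rmorphM. Qed.

Lemma mapf0 (J : finType) : mapf (0 : {ffun J -> R^o}) = 0.
Proof. by apply/ffunP => j; rewrite !ffunE rmorph0. Qed.

Lemma mapfD (J : finType) (x y : {ffun J -> R^o}) : mapf (x + y) = mapf x + mapf y.
Proof. by apply/ffunP => j; rewrite !ffunE rmorphD. Qed.

Lemma mapfB (J : finType) (x y : {ffun J -> R^o}) : mapf (x - y) = mapf x - mapf y.
Proof. by apply/ffunP => j; rewrite !ffunE rmorphB. Qed.

Lemma mapfZ (J : finType) a (x : {ffun J -> R^o}) : mapf (a *: x) = f a *: mapf x.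
Proof. by rewrite -[a *: x]addr0 mapfL mapf0 addr0. Qed.

Lemma mapf_sum (J : finType) I (s : seq I) (P : pred I) (F : I -> {ffun J -> R^o}) :
  mapf (\sum_(i <- s | P i) F i) = \sum_(i <- s | P i) mapf (F i).
Proof. by apply: (big_morph _ (@mapfD J) (@mapf0 J)). Qed.

Lemma mapf_lincomb (I J : finType) (E : I -> {ffun J -> R^o}) v :
  mapf (lincomb E v) = lincomb (fun i => mapf (E i)) (mapf v).
Proof. by rewrite mapf_sum; apply: eq_bigr => i _; rewrite mapfZ ffunE. Qed.

Lemma mapf_unitv (J : finType) (j : J) : mapf (unitv R j) = unitv R' j.
Proof. by apply/ffunP => i; rewrite !ffunE rmorph_nat. Qed.

Lemma mapf_one n : mapf (one R n) = one R' n.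
Proof. by apply/ffunP => i; rewrite !ffunE rmorph_nat. Qed.

Lemma mapf_mulx n i (w : forms n R) : mapf (mulx i w) = mulx i (mapf w).
Proof.
apply/ffunP => K; rewrite !ffunE; case: ifP => _; last by rewrite rmorph0.
by rewrite rmorphM rmorphXn rmorphN1.
Qed.

Lemma mapf_ew n u (w : forms n R) : mapf (ew u w) = ew (mapf u) (mapf w).
Proof.
by rewrite mapf_sum; apply: eq_bigr => i _; rewrite mapfZ mapf_mulx ffunE.
Qed.

Lemma mapf_ext a b (T : 'I_a -> vec b R) w :
  mapf (ext T w) = ext (fun i => mapf (T i)) (mapf w).
Proof.
move: w; apply: form_ind => [|c x y hx hy||i w h].
- by rewrite !(mapf0, linear0).
- by rewrite linearP !mapfL linearP /= hx hy.
- by rewrite ext_one !mapf_one ext_one.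
- by rewrite ext_mulx mapf_ew h mapf_mulx ext_mulx.
Qed.

Lemma mapf_pform n p (w : forms n R) : pform p w -> pform p (mapf w).
Proof. by move=> h K pK; rewrite ffunE h // rmorph0. Qed.

Lemma mapf_dot n (u v : vec n R) : f (dot u v) = dot (mapf u) (mapf v).
Proof. by rewrite rmorph_sum; apply: eq_bigr => i _; rewrite rmorphM !ffunE. Qed.

End MapForms.

(** * Homogeneous components *)

Section Homogeneous.
Variables (K : fieldType) (n : nat).
Local Notation S := {mpoly K[n]}.
Implicit Types (p q a : S).

Definition hc (d : nat) : {linear S -> S} := pihomog mdeg d.
Definition hmg (d : nat) p := p \is d.-homog for mdeg.

Lemma hc_homog d p : hmg d (hc d p). Proof. exact: pihomogP. Qed.

Lemma hc_id d e p : hmg e p -> hc d p = if d == e then p else 0.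
Proof.
have [->|de] := eqVneq d e; first exact: pihomog_dE.
by move=> h; apply: pihomog_ne0 h; rewrite eq_sym.
Qed.

Lemma hc_sum p : exists N, forall N', (N <= N')%N -> p = \sum_(i < N') hc i p.
Proof. by exists (msize p) => N'; exact: pihomog_partitionE. Qed.

Lemma hc_ext p q : (forall d, hc d p = hc d q) -> p = q.
Proof.
move=> h; have [N hN] := hc_sum p; have [N' hN'] := hc_sum q.
rewrite (hN (maxn N N')) ?leq_maxl // (hN' (maxn N N')) ?leq_maxr //.
by apply: eq_bigr => i _.
Qed.

Lemma homogM d e p q : hmg d p -> hmg e q -> hmg (d + e) (p * q).
Proof. exact: dhomogM. Qed.

Lemma hc_mul d e a p : hmg e a ->
  hc d (a * p) = if (e <= d)%N then a * hc (d - e) p else 0.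
Proof.
move=> ha; have [N hN] := hc_sum p.
rewrite [in LHS](hN (maxn N d.+1)) ?leq_maxl // mulr_sumr linear_sum /=.
have hi (i : 'I_(maxn N d.+1)) :
    pihomog mdeg d (a * hc i p) = if d == (e + i)%N then a * hc i p else 0.
  by rewrite -hc_id; last exact: homogM (hc_homog _ _).
under eq_bigr => i _ do rewrite hi.
case: leqP => ed; last first.
  by rewrite big1 // => i _; case: eqP => // h; exfalso; lia.
have dN : (d - e < maxn N d.+1)%N by rewrite leq_max ltnS leq_subr orbT.
rewrite (bigD1 (Ordinal dN)) //= subnKC // eqxx big1 ?addr0 // => i ie.
by case: eqP => // h; case/eqP: ie; apply: val_inj => /=; lia.
Qed.

(** Membership in the [k]-th power of the irrelevant ideal. [ordge_inf] is the Krull intersection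
    theorem, which turns Nakayama arguments into inductions on [k]. *)
Definition ordge (k : nat) p := forall d, (d < k)%N -> hc d p = 0.

Lemma ordge_mul i j p q : ordge i p -> ordge j q -> ordge (i + j) (p * q).
Proof.
move=> hp hq d dij; have [N hN] := hc_sum p.
rewrite (hN N) // mulr_suml linear_sum big1 // => k _ /=.
rewrite [LHS](hc_mul d q (hc_homog k p)); case: leqP => // kd.
have [ki|ik] := ltnP k i; first by rewrite hp ?mul0r.
by rewrite hq ?mulr0 //; lia.
Qed.

Lemma ordge_sum k (I : Type) (s : seq I) (P : pred I) (F : I -> S) :
  (forall i, P i -> ordge k (F i)) -> ordge k (\sum_(i <- s | P i) F i).
Proof. by move=> h d dk; rewrite linear_sum big1 // => i /h/(_ d dk). Qed.

Lemma ordge_inf p : (forall k, ordge k p) -> p = 0.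
Proof. by move=> h; apply: hc_ext => d; rewrite (h d.+1) ?linear0. Qed.

Lemma homog_ordge k p : hmg k p -> ordge k p.
Proof. by move=> h d dk; rewrite (hc_id _ h) ltn_eqF. Qed.

Lemma homogX k p : hmg 1 p -> hmg k (p ^+ k).
Proof. by move=> h; rewrite /hmg -[X in X.-homog]mul1n; apply: dhomogMn. Qed.

(* Component of total degree [d] in a summand generated in degree [e]. *)
Definition hcs d e p : S := if (e <= d)%N then hc (d - e) p else 0.

Lemma hcs_lin d e : linear (hcs d e : S -> S).
Proof.
move=> a p q; rewrite /hcs; case: ifP => _; last by rewrite scaler0 addr0.
by rewrite linearP.
Qed.

Lemma hcs_mul d e t a p : hmg t a -> hcs d e (a * p) = a * hcs d (e + t) p.
Proof.
move=> ha; rewrite /hcs; case: leqP => ed; last first.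
  by rewrite ifF ?mulr0 //; apply/negbTE; rewrite -ltnNge; lia.
rewrite (hc_mul _ _ ha) leq_subRL //; case: ifP => _; last by rewrite mulr0.
by rewrite subnDA.
Qed.

Section Weights.
Variables (J : finType) (w : J -> nat).
Implicit Types v : {ffun J -> S^o}.

Definition wc d v : {ffun J -> S^o} := [ffun j => hcs d (w j) (v j)].

Lemma wcD d v v' : wc d (v + v') = wc d v + wc d v'.
Proof.
apply/ffunP => j; rewrite !ffunE.
by have := hcs_lin d (w j) 1 (v j) (v' j); rewrite !scale1r.
Qed.

Lemma wc0 d : wc d 0 = 0.
Proof.
by apply/ffunP => j; rewrite !ffunE /hcs linear0; case: ifP.
Qed.

Lemma wc_sum_lin d I (s : seq I) (P : pred I) (F : I -> {ffun J -> S^o}) :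
  wc d (\sum_(i <- s | P i) F i) = \sum_(i <- s | P i) wc d (F i).
Proof. exact: (big_morph _ (wcD d) (wc0 d)). Qed.

Lemma wc_sum v : exists N, v = \sum_(d < N) wc d v.
Proof.
have /choice[N hN] : forall j, exists N, forall N', (N <= N')%N -> v j = \sum_(i < N') hc i (v j).
  by move=> j; apply: hc_sum.
exists (\max_j (w j + N j))%N; apply/ffunP => j; rewrite sum_ffunE.
set M := (\max_j _)%N; have wM : (w j + N j <= M)%N by apply: (leq_bigmax (F := fun j => w j + N j)%N).
rewrite (eq_bigr (fun i : 'I_M => hcs i (w j) (v j))); last by move=> i _; rewrite ffunE.
rewrite -(big_mkord xpredT (fun i => hcs i (w j) (v j))).
rewrite (big_cat_nat (n := w j)) //=; last by lia.
rewrite big_nat big1 ?add0r => [|i /andP[_ iw]]; last by rewrite /hcs leqNgt iw.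
rewrite -{1}[w j]add0n big_addn big_mkord [LHS](hN j (M - w j)%N); last by lia.
by apply: eq_bigr => i _; rewrite /hcs leq_addl addnK.
Qed.

Definition graded (M : submodule {ffun J -> S^o}) := forall d v, M v -> M (wc d v).
Definition whomog d v := wc d v = v.

Lemma wc_whomog d v : whomog d (wc d v).
Proof.
apply/ffunP => j; rewrite !ffunE /hcs; case wd: (w j <= d)%N => //.
exact: pihomog_id.
Qed.

Lemma wc_scale d e (u : S) v : whomog e v -> wc d (u *: v) = hcs d e u *: v.
Proof.
move=> hv; rewrite -hv; apply/ffunP => j; rewrite !ffunE.
rewrite -[_ *: _]/(_ * _) -[RHS]/(_ * _) mulrC [RHS]mulrC {2 3}/hcs.
case: leqP => we; last by rewrite !mul0r /hcs linear0; case: ifP.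
by rewrite (hcs_mul _ _ _ (hc_homog _ _)) subnKC.
Qed.

Lemma wc_lincomb (I : finType) (E : I -> {ffun J -> S^o}) (e : I -> nat) d
    (u : {ffun I -> S^o}) : (forall i, whomog (e i) (E i)) ->
  wc d (lincomb E u) = lincomb E [ffun i => hcs d (e i) (u i)].
Proof.
by move=> hE; rewrite wc_sum_lin; apply: eq_bigr => i _; rewrite (wc_scale _ _ (hE i)) ffunE.
Qed.

End Weights.

Lemma graded_ker (J I : finType) (w : J -> nat) (e : I -> nat)
    (E : I -> {ffun J -> S^o}) : (forall i, whomog w (e i) (E i)) ->
  graded e (kersm (lincomb E)).
Proof.
move=> hE d u uE; have := wc_lincomb d u hE.
by rewrite (uE : lincomb E u = 0) wc0 => /esym.
Qed.

End Homogeneous.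

Arguments hc {K n} d.

(** * Noetherianity *)

Section Noetherian.
Import Order.TTheory.

(** Each new index minimises [u] on the tail after the previous one, so later values are no
    smaller. *)
Lemma mono_subseq (u : nat -> nat) : exists phi : nat -> nat,
  forall i j, (i < j)%N -> (phi i < phi j)%N /\ (u (phi i) <= u (phi j))%N.
Proof.
have /choice[f fP] : forall N, exists i, (N <= i)%N /\ forall j, (N <= j)%N -> (u i <= u j)%N.
  move=> N; have ex : exists a, `[< exists2 i, (N <= i)%N & u i = a >].
    by exists (u N); apply/asboolP; exists N.
  case: (ex_minnP ex) => a /asboolP[i Ni <-] min_a; exists i; split=> // j Nj.
  by apply: min_a; apply/asboolP; exists j.
pose phi := fix phi k := if k is k'.+1 then f (phi k').+1 else f 0.
exists phi; suff H i j : (phi i < phi (i + j.+1))%N /\ (u (phi i) <= u (phi (i + j.+1)))%N.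
  by move=> i j ij; have := H i (j - i.+1)%N; rewrite addnS -addSn subnKC.
have st k : (phi k < phi k.+1)%N by have [] := fP (phi k).+1.
have lt k d : (phi k <= phi (k + d))%N.
  elim: d => [|d IH]; rewrite ?addn0 // addnS.
  by apply: leq_trans IH (ltnW (st _)).
split; first by apply: leq_trans (st i) _; rewrite addnS -addSn.
case: i => [|i] /=; first by have [_] := fP 0%N; apply.
have [_] := fP (phi i).+1; apply; apply: leq_trans (st i) _.
by have := lt i.+1 j.+1.
Qed.

Lemma dickson_seq n (s : seq 'I_n) (m : nat -> 'X_{1..n}) : exists phi : nat -> nat,
  forall i j, (i < j)%N -> (phi i < phi j)%N /\ forall x, x \in s -> (m (phi i) x <= m (phi j) x)%N.
Proof.
elim: s => [|x s [phi IH]]; first by exists id.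
have [psi psiP] := mono_subseq (fun k => m (phi k) x).
exists (phi \o psi) => i j ij /=; have [lt le] := psiP i j ij.
have [lt' le'] := IH _ _ lt; split=> // y.
by rewrite inE => /orP[/eqP -> //|]; apply: le'.
Qed.

Lemma dickson n (m : nat -> 'X_{1..n}) : exists i j, (i < j)%N /\ (m i <= m j)%MM.
Proof.
have [phi h] := dickson_seq (enum 'I_n) m.
have [lt le] := h 0%N 1%N isT; exists (phi 0%N), (phi 1%N); split=> //.
by apply/mnm_lepP => x; apply: le; rewrite mem_enum.
Qed.

Definition fg (R : nzRingType) (V : lmodType R) (M : submodule V) : Prop :=
  exists (I : finType) (E : I -> V),
    (forall i, M (E i)) /\ forall v, M v -> exists u, v = lincomb E u.

Variables (K : fieldType) (n : nat).
Local Notation S := {mpoly K[n]}.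

Lemma mlead_reduce (f g : S) : f != 0 -> g != 0 -> (mlead g <= mlead f)%MM ->
  exists c : S, f - c * g = 0 \/ (mlead (f - c * g) < mlead f)%O.
Proof.
move=> f0 g0 le; pose m := (mlead f - mlead g)%MM.
pose c : S := (mleadc f / mleadc g) *: 'X_[m].
have cg0 : mleadc g != 0 by rewrite mleadc_eq0.
have c0 : c != 0.
  rewrite /c scaler_eq0 mulf_eq0 invr_eq0 mleadc_eq0 (negPf f0) (negPf cg0) /=.
  by rewrite -msize_poly_eq0 msizeX.
have lcg : mlead (c * g) = mlead f.
  rewrite mleadM // mleadZ ?mleadXm ?submK // mulf_eq0 invr_eq0.
  by rewrite mleadc_eq0 (negPf f0) (negPf cg0).
have cf : (f - c * g)@_(mlead f) = 0.
  rewrite mcoeffB /c -scalerAl mcoeffZ -[X in ('X_[_] * g)@_X](submK le) -/m.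
  by rewrite ['X_[m] * g]mulrC mcoeffMX divfK // subrr.
exists c; have [|h] := eqVneq (f - c * g) 0; [by left|right].
rewrite lt_neqAle; apply/andP; split; last first.
  by apply: le_trans (mleadB_le _ _) _; rewrite lcg joinxx.
by apply: contraNneq h => e; rewrite -mleadc_eq0 e cf.
Qed.

(** Hilbert's basis theorem by leading monomials: a finite list in [I] whose leading monomials
    divide all others generates [I] by division. If there were none, adding a counterexample again
    and again would contradict [dickson]. *)
Lemma ideal_fg (I : submodule (S^o)) : fg I.
Proof.
suff [l [lI lP]] : exists l : seq S, (forall g, g \in l -> I g /\ g != 0) /\
    forall f : S, I f -> f != 0 -> exists2 g, g \in l & (mlead g <= mlead f)%MM.
  exists 'I_(size l), (fun i : 'I_(size l) => l`_i : S^o); split=> [i|].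
    by have [] := lI l`_i (mem_nth _ (ltn_ord i)).
  elim/mleadrect => f IH If.
  have [->|f0] := eqVneq f 0; first by exists 0; rewrite linear0.
  have [g gl gf] := lP f If f0; have [Ig g0] := lI g gl.
  have [c cP] := mlead_reduce f0 g0 gf.
  have Ifg : I (f - c * g) by apply: smB => //; apply: (smZ c Ig).
  have [u uE] : exists u, (f - c * g : S^o) = lincomb (fun i : 'I_(size l) => l`_i : S^o) u.
    case: cP => [->|lt]; last exact: IH.
    by exists 0; rewrite linear0.
  move: gl; rewrite -index_mem => gi.
  exists (c *: unitv S (Ordinal gi) + u).
  rewrite linearP lincomb_unitv -uE /= nth_index -?index_mem //.
  by rewrite -[c *: _]/(c * g) addrC subrK.
apply: contrapT => H.
have /choice[F FP] : forall l : seq S, exists f : S, (forall g, g \in l -> I g /\ g != 0) ->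
    [/\ I f, f != 0 & forall g, g \in l -> ~ (mlead g <= mlead f)%MM].
  move=> l; apply: contrapT => nF; apply: H; exists l.
  have lI : forall g, g \in l -> I g /\ g != 0.
    by apply: contrapT => h; apply: nF; exists 0.
  split=> // f If f0; apply: contrapT => h; apply: nF; exists f => _; split=> //.
  by move=> g gl gf; apply: h; exists g.
pose L := fix L k := if k is k'.+1 then F (L k') :: L k' else [::].
have LI k : forall g, g \in L k -> I g /\ g != 0.
  elim: k => //= k IH g; rewrite inE => /orP[/eqP ->|]; last exact: IH.
  by have [] := FP _ IH.
have inL i d : F (L i) \in L (i + d.+1)%N.
  elim: d => [|d IH]; first by rewrite addn1 /= mem_head.
  by rewrite addnS /= inE IH orbT.
have [i [j [ij le]]] := dickson (fun k => mlead (F (L k))).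
have [_ _ /(_ (F (L i)))] := FP _ (LI j); apply=> //.
by rewrite -(subnKC ij) addSnnS inL.
Qed.

(** Induction on the coordinates allowed to be nonzero: the values at one coordinate form an ideal,
    and the elements vanishing there have smaller support. *)
Lemma ffun_fg (J : finType) (M : submodule {ffun J -> S^o}) : fg M.
Proof.
suff H (s : seq J) (N : submodule {ffun J -> S^o}) :
    (forall v, N v -> forall j, j \notin s -> v j = 0) -> fg N.
  by apply: (H (enum J)) => v _ j; rewrite mem_enum.
elim: s N => [|x s IH] N Ns.
  exists void, (fun i : void => match i with end); split=> [[]|v /Ns v0].
  exists 0; rewrite linear0; apply/ffunP => j; rewrite v0 // ffunE //.
have lx : linear (fun v : {ffun J -> S^o} => v x) by move=> a u v; rewrite !ffunE.
have lN : linear (fun v : subT N => inc N v x) by move=> a u v; rewrite linearP !ffunE.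
have [I1 [E1 [E1N E1P]]] := ideal_fg (imsm (mklin lN)).
have /choice[y yE] := E1N.
have N'0 : N 0 /\ (0 : {ffun J -> S^o}) x = 0 by split; [exact: sm0 | rewrite ffunE].
pose N' : submodule {ffun J -> S^o} := @Submodule _ _ (fun v => N v /\ v x = 0) N'0
  (fun a u v hu hv => conj (smL a hu.1 hv.1)
     (etrans (lx a u v) (eq_trans (f_equal2 (fun p q => a *: p + q) hu.2 hv.2) (etrans (addr0 _) (scaler0 _ a))))).
have [|I2 [E2 [E2N E2P]]] := IH N'.
  move=> v [Nv vx] j js; have [->//|jx] := eqVneq j x.
  by apply: (Ns v Nv); rewrite inE negb_or jx.
exists (I1 + I2)%type, (fun i => match i with inl i => inc N (y i) | inr i => E2 i end).
split=> [[i|i]|v Nv]; [exact: incP | by have [] := E2N i |].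
have [|u1 u1E] := E1P (v x); first by exists (toS Nv).
pose v1 := \sum_i (u1 i : S) *: inc N (y i).
have Nv1 : N v1 by apply: sm_sum => i _; apply: smZ; apply: incP.
have [|u2 u2E] := E2P (v - v1).
  split; first exact: smB.
  rewrite !ffunE u1E sum_ffunE /= -sumrB big1 // => i _.
  by rewrite ffunE -[E1 i]yE subrr.
exists (ffun_sum u1 u2); rewrite lincomb_sum.
have -> : lincomb (fun i => inc N (y i)) u1 = v1 by [].
by rewrite -u2E addrC subrK.
Qed.

End Noetherian.

(** * Minimal generators of graded submodules *)

Section Generators.
Variable R : nzRingType.

Lemma sub_iso (V : lmodType R) (U U' : submodule V) : (forall v, U v <-> U' v) ->
  exists f : {linear subT U -> subT U'}, injective f /\ forall y, exists x, f x = y.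
Proof.
move=> UU'; have h x : U' (inc U x) by exact: (UU' _).1 (incP x).
exists (corestr h); split=> [x y e|y].
  by apply: inc_inj; exact: (congr1 (inc U') e).
have Uy : U (inc _ y) by apply/UU'; exact: incP.
by exists (toS Uy); apply: inc_inj.
Qed.

Lemma res_eq cls n (V : lmodType R) (U U' : submodule V) : (forall v, U v <-> U' v) ->
  res cls n (subT U) -> res cls n (subT U').
Proof. by move=> /sub_iso[f [fi fs]]; apply: res_iso fi fs. Qed.

Definition gens (V : lmodType R) (M : submodule V) (I : finType) (E : I -> V) :=
  (forall i, M (E i)) /\ (forall v, M v -> exists u, v = lincomb E u).

Lemma gens_lincomb (V : lmodType R) (M : submodule V) (I : finType) (E : I -> V) u :
  gens M E -> M (lincomb E u).
Proof. by move=> [ME _]; apply: sm_sum => i _; apply: smZ. Qed.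

Lemma ses_gens (V : lmodType R) (M : submodule V) (I : finType) (E : I -> V) :
  gens M E -> exists q : {linear {ffun I -> R^o} -> subT M},
    (forall u, inc M (q u) = lincomb E u) /\ ses (inc (kersm (lincomb E))) q.
Proof.
move=> gE; have h u := gens_lincomb u gE.
exists (corestr h); split=> //; split=> [|c|b]; first exact: inc_inj.
  by have [u uE] := gE.2 _ (incP c); exists u; apply: inc_inj.
split=> [/(congr1 (inc _)) b0|[a <-]]; last by apply: inc_inj; exact: (incP a).
by exists (toS (b0 : kersm (lincomb E) b)).
Qed.

Lemma res_gens (cls : lmodType R -> Prop) n (V : lmodType R) (M : submodule V)
    (I : finType) (E : I -> V) : cls {ffun I -> R^o} ->
  gens M E -> res cls n (subT (kersm (lincomb E))) -> res cls n.+1 (subT M).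
Proof.
move=> cI /ses_gens[q [_ s]] r.
by exists (subT (kersm (lincomb E))), {ffun I -> R^o}, (inc _), q; split.
Qed.

Lemma fres_gens n (V : lmodType R) (M : submodule V) : fres n.+1 (subT M) ->
  exists b (E : 'I_b -> V), gens M E /\ fres n (subT (kersm (lincomb E))).
Proof.
move=> [A [P [i [q [[b [f [fi fs]]] [ii qs iq] rA]]]]].
pose E j := inc M (q (f (unitv R j))).
have EE u : lincomb E u = inc M (q (f u)).
  have l : linear (fun u => inc M (q (f u))) by move=> a x y; rewrite !linearP.
  exact: esym (linear_lincomb (mklin l) u).
exists b, E; split.
  split=> [j|v Mv]; first exact: incP.
  have [p pE] := qs (toS Mv); have [u uE] := fs p; exists u.
  by rewrite EE uE pE.
have [g [fg gf]] := bij_inv_lin fi fs.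
have h a : kersm (lincomb E) (g (i a)).
  rewrite -[kersm _ _]/(lincomb E (g (i a)) = 0) EE gf.
  by rewrite (_ : q (i a) = 0) ?linear0 //; apply/iq; exists a.
have l : linear (fun a => g (i a)) by move=> a x y; rewrite !linearP.
apply: (@res_iso _ _ _ _ _ (@corestr _ _ _ (kersm (lincomb E)) (mklin l) h)) rA.
  by move=> x y e; apply: ii; apply: (can_inj gf); exact: (congr1 (inc (kersm (lincomb E))) e).
move=> y; have : q (f (inc _ y)) = 0 by apply: inc_inj; rewrite -EE; exact: (incP y).
move=> /iq[a aE]; exists a; apply: inc_inj.
by rewrite -[LHS]/(g (i a)) aE fg.
Qed.

Lemma pres_fres n (M : lmodType R) : fres n M -> pres n M.
Proof. by apply: sub_res => P; apply: finfree_proj. Qed.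

End Generators.

Section MinimalGenerators.
Variables (K : fieldType) (n : nat).
Local Notation S := {mpoly K[n]}.

Definition no_const (I : finType) (u : {ffun I -> S^o}) := forall i, hc 0 (u i : S) = 0.

(** Take a smallest generating subset of a finite homogeneous one. If the coefficient at [i] in a
    relation had a nonzero constant term, the component of the relation in degree [e i] would have a
    unit at [i], and [E i] could be dropped. *)
Lemma mingens (J : finType) (w : J -> nat) (M : submodule {ffun J -> S^o}) :
  graded w M -> exists b (E : 'I_b -> {ffun J -> S^o}) (e : 'I_b -> nat),
    [/\ gens M E, forall i, whomog w (e i) (E i)
      & forall u, lincomb E u = 0 -> no_const u].
Proof.
move=> gM.
have [I [E [e [gE hE]]]] : exists (I : finType) (E : I -> {ffun J -> S^o})
    (e : I -> nat), gens M E /\ forall i, whomog w (e i) (E i).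
  have [I [E [ME gE]]] := ffun_fg M.
  have /choice[N hN] := fun i => wc_sum w (E i).
  pose L := (\max_i N i)%N.
  exists (I * 'I_L)%type, (fun p : I * 'I_L => wc w p.2 (E p.1)),
    (fun p : I * 'I_L => p.2 : nat).
  split=> [|p]; last exact: wc_whomog.
  split=> [p|v /gE[u ->]]; first exact: gM.
  (* All generators are cut into [L] components, but [hN i] sums only [N i] of them, so the
     coefficient is set to 0 beyond. *)
  pose u' (i : I) (j : 'I_L) : S := if (j < N i)%N then u i else 0.
  exists [ffun p => u' p.1 p.2].
  transitivity (\sum_i \sum_j u' i j *: wc w j (E i)); last first.
    by rewrite pair_bigA /=; apply: eq_bigr => p _; rewrite ffunE.
  apply: eq_bigr => i _; rewrite {1}(hN i) scaler_sumr.
  rewrite (big_ord_widen L (fun j => (u i : S) *: wc w j (E i))); last exact: (leq_bigmax (F := N)).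
  rewrite big_mkcond; apply: eq_bigr => j _.
  by rewrite /u'; case: ifP => _ //; rewrite scale0r.
pose P (A : {set I}) := forall v, M v -> exists u : {ffun I -> S^o}, v = \sum_(j in A) (u j : S) *: E j.
have ex : exists b, `[< exists2 A, P A & #|A| = b >].
  exists #|[set: I]|; apply/asboolP; exists setT => // v /gE.2[u ->].
  by exists u; apply: eq_bigl => j; rewrite inE.
have [b /asboolP[A PA cA] bmin] := ex_minnP ex.
have relA (u : {ffun I -> S^o}) : \sum_(j in A) (u j : S) *: E j = 0 ->
    forall i, i \in A -> hc 0 (u i : S) = 0.
  move=> uE i iA; apply/eqP/negP => /negP ui0.
  pose c := hc 0 (u i : S).
  have [a ac] : exists a : S, a * c = 1.
    have h : c = (c@_0)%:MP.
      apply/mpolyP => m; rewrite mcoeffC; have [->|m0] := eqVneq m 0%MM; first by rewrite mulr1.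
      rewrite mulr0; apply: (dhomog_nemf_coeff (hc_homog 0 (u i : S))).
      by rewrite mdeg_eq0.
    exists (c@_0)^-1%:MP; rewrite {2}h -mpolyCM mulVf //.
    by apply: contraNneq ui0 => c0; rewrite -/c h c0.
  pose u' j : S := hcs (e i) (e j) (u j).
  have u'E : \sum_(j in A) u' j *: E j = 0.
    transitivity (wc w (e i) (\sum_(j in A) (u j : S) *: E j)); last by rewrite uE wc0.
    rewrite wc_sum_lin; apply: eq_bigr => j _.
    by rewrite (wc_scale _ _ (hE j)).
  have u'i : u' i = c by rewrite /u' /hcs leqnn subnn.
  have Ei : E i = \sum_(j in A :\ i) (- a * u' j) *: E j.
    have : a *: (\sum_(j in A) u' j *: E j) = 0 by rewrite u'E scaler0.
    rewrite (big_setD1 i iA) u'i scalerDr scalerA ac scale1r => /eqP.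
    rewrite addr_eq0 => /eqP ->; rewrite scaler_sumr -sumrN; apply: eq_bigr => j _.
    by rewrite mulNr scaleNr scalerA.
  have : P (A :\ i).
    move=> v /PA[x ->]; exists [ffun j => x j + (x i : S) * (- a * u' j)].
    rewrite (big_setD1 i iA) {1}Ei scaler_sumr -big_split /=.
    by apply: eq_bigr => j _; rewrite ffunE scalerA -scalerDl addrC.
  move=> PAi; have : (b <= #|A :\ i|)%N by apply: bmin; apply/asboolP; exists (A :\ i).
  by rewrite -cA (cardsD1 i A) iA ltnn.
exists #|A|, (fun i => E (enum_val i)), (fun i => e (enum_val i)); split=> //.
  split=> [i|v /PA[u ->]]; first exact: gE.1.
  exists [ffun i => u (enum_val i)]; rewrite (big_enum_val (fun j => (u j : S) *: E j)) /=.
  by apply: eq_bigr => i _; rewrite ffunE.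
move=> u uE i.
pose U : {ffun I -> S^o} := [ffun j => \sum_(k | enum_val k == j) (u k : S)].
have UE k : U (enum_val k) = u k.
  rewrite ffunE (eq_bigl (pred1 k)) ?big_pred1_eq // => k' /=.
  by rewrite (inj_eq enum_val_inj).
rewrite -UE; apply: relA; last exact: enum_valP.
rewrite (big_enum_val (fun j => (U j : S) *: E j)) /= -[RHS]uE.
by apply: eq_bigr => k _; rewrite UE.
Qed.

(* With a section s of q, the idempotent 1 - s q maps into the kernel of q, so
   its matrix has entries in the irrelevant ideal, hence in all its powers. *)
Lemma min_proj_inj (b : nat) (M : lmodType S) (q : {linear {ffun 'I_b -> S^o} -> M}) :
  (forall y, exists x, q x = y) -> (forall u, q u = 0 -> no_const u) ->
  projective M -> forall u, q u = 0 -> u = 0.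
Proof.
move=> qs qc pM; have [s sE] := proj_section pM qs.
have lP : linear (fun u => u - s (q u)).
  by move=> a x y; rewrite (linearP q) (linearP s) scalerBr opprD addrACA.
pose P := mklin lP.
have qP u : q (P u) = 0 by rewrite /= linearB sE subrr.
have PK u : q u = 0 -> P u = u by move=> qu; rewrite /= qu linear0 subr0.
have H k : forall u, q u = 0 -> forall i, ordge k (u i : S).
  elim: k => [|k IH] u qu i; first by move=> d; rewrite ltn0.
  rewrite -(PK u qu) (linear_lincomb P) /= sum_ffunE.
  apply: ordge_sum => j _; rewrite ffunE -addn1 -[_ *: _]/(_ * _).
  apply: ordge_mul; first exact: IH.
  by move=> d; rewrite ltnS leqn0 => /eqP ->; apply: (qc _ (qP _)).
move=> u qu; apply/ffunP => i; rewrite ffunE; apply: ordge_inf => k; exact: H.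
Qed.

Lemma syz_min m (b : nat) (M : lmodType S) (q : {linear {ffun 'I_b -> S^o} -> M}) :
  (forall y, exists x, q x = y) -> (forall u, q u = 0 -> no_const u) ->
  pres m.+1 M -> pres m (subT (kersm q)).
Proof.
move=> qs qc; case: m => [/res_projP pM x|m].
  by apply: inc_inj; rewrite linear0; apply: (min_proj_inj qs qc pM); exact: (incP x).
by apply: (schanuel (ses_ker qs)); apply: proj_ffun.
Qed.

(** Minimal homogeneous covers are finite free with graded kernels, and by [syz_min] each step uses
    up one term of the projective resolution. *)
Lemma graded_fres m (J : finType) (w : J -> nat) (M : submodule {ffun J -> S^o}) :
  graded w M -> pres m (subT M) -> fres m (subT M).
Proof.
elim: m J w M => [//|m IH] J w M gM rM.
have [b [E [e [gE hE Ec]]]] := mingens gM.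
have [q [qE s]] := ses_gens gE.
have kq u : kersm q u <-> kersm (lincomb E) u.
  split=> [/(congr1 (inc _))|h]; first by rewrite qE linear0.
  by apply: inc_inj; rewrite qE linear0.
apply: (res_gens _ gE); first exact: finfree_ffun.
apply: (IH _ e); first exact: graded_ker hE.
apply: (res_eq kq); apply: syz_min => //; first by have [] := s.
by move=> u qu; apply: Ec; apply/kq.
Qed.

End MinimalGenerators.

(** * Hyperplane sections *)

Section HyperplaneSection.
Variables (K : fieldType) (n n' : nat).
Local Notation S := {mpoly K[n]}.
Local Notation S' := {mpoly K[n']}.
Variables (pi : {rmorphism S -> S'}) (al : S).

(** [S'] is the graded quotient of [S] by one linear form. It is applied to [H] and, for the syzygy
    theorem, to an arbitrary hyperplane. *)
Definition hyperplane_section : Prop :=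
  [/\ forall g, exists f, pi f = g, forall f, pi f = 0 <-> exists g, f = al * g,
      al != 0, hmg 1 al & forall d f, hc d (pi f) = pi (hc d f)].

Hypothesis hs : hyperplane_section.

Lemma hs_surj g : exists f, pi f = g. Proof. by have [] := hs. Qed.
Lemma hs_ker f : pi f = 0 <-> exists g, f = al * g. Proof. by have [] := hs. Qed.
Lemma hs_hc d f : hc d (pi f) = pi (hc d f). Proof. by have [] := hs. Qed.
Lemma hs_al : pi al = 0. Proof. by apply/hs_ker; exists 1; rewrite mulr1. Qed.

Lemma al_inj (J : finType) : injective ( *:%R al : {ffun J -> S^o} -> {ffun J -> S^o}).
Proof.
move=> x y /ffunP xy; apply/ffunP => j; have := xy j; rewrite !ffunE.
by apply: mulfI; have [] := hs.
Qed.

Lemma mapf_surj (J : finType) (v' : {ffun J -> S'^o}) : exists v, mapf pi v = v'.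
Proof.
have /choice[f fE] := hs_surj; exists [ffun j => f (v' j)].
by apply/ffunP => j; rewrite !ffunE fE.
Qed.

Lemma mapf_ker (J : finType) (v : {ffun J -> S^o}) :
  mapf pi v = 0 <-> exists u, v = al *: u.
Proof.
split=> [/ffunP h|[u ->]]; last by rewrite mapfZ hs_al scale0r.
have /choice[g gE] : forall j, exists g, v j = al * g :> S.
  by move=> j; apply/hs_ker; have := h j; rewrite !ffunE.
by exists [ffun j => g j]; apply/ffunP => j; rewrite !ffunE gE.
Qed.

Lemma hs_wc (J : finType) (w : J -> nat) d v : wc w d (mapf pi v) = mapf pi (wc w d v).
Proof.
apply/ffunP => j; rewrite !ffunE /hcs; case: ifP => _; last by rewrite rmorph0.
exact: hs_hc.
Qed.

Section Image.
Variables (J : finType) (M : submodule {ffun J -> S^o}).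

(** Equivalently, [al] is a nonzerodivisor on the free module modulo [M]; then [imp M] is
    [M / al M]. *)
Definition saturated := forall v, M (al *: v) -> M v.

Definition imp : submodule {ffun J -> S'^o}.
Proof.
exists (fun v' => exists2 v, M v & mapf pi v = v').
  by exists 0; [exact: sm0 | rewrite mapf0].
move=> a x y [x' Mx <-] [y' My <-]; have [b <-] := hs_surj a.
by exists (b *: x' + y'); [exact: smL | rewrite mapfL].
Defined.

Lemma imp_graded w : graded w M -> graded w imp.
Proof. by move=> gM d _ [v Mv <-]; exists (wc w d v); [apply: gM | rewrite hs_wc]. Qed.

Lemma imp_gens (I : finType) (E : I -> {ffun J -> S^o}) :
  gens M E -> gens imp (fun i => mapf pi (E i)).
Proof.
move=> [ME gE]; split=> [i|_ [v /gE[u ->] <-]]; first by exists (E i).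
by exists (mapf pi u); rewrite mapf_lincomb.
Qed.

End Image.

Lemma ker_saturated (J : finType) (I : finType) (E : I -> {ffun J -> S^o}) :
  saturated (kersm (lincomb E)).
Proof.
move=> v; rewrite -[kersm _ _]/(lincomb E _ = 0) linearZ => h.
by apply: (@al_inj J); rewrite scaler0.
Qed.

(** Syzygies commute with restriction: if a combination of the [E i] is [al *: u], saturation puts
    [u] in [M], so [u] is a combination too, and subtracting [al] times its coefficients yields a
    true relation. *)
Lemma imp_ker (J I : finType) (M : submodule {ffun J -> S^o}) (E : I -> {ffun J -> S^o}) :
  saturated M -> gens M E ->
  forall v', imp (kersm (lincomb E)) v' <-> kersm (lincomb (fun i => mapf pi (E i))) v'.
Proof.
move=> sM gE v'; split=> [[v Ev <-]|].
  by rewrite -[kersm _ _]/(lincomb _ _ = 0) -mapf_lincomb (Ev : lincomb E v = 0) mapf0.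
have [v <-] := mapf_surj v'; rewrite -[kersm _ _]/(lincomb _ _ = 0) -mapf_lincomb.
move=> /mapf_ker[u uE].
have Mu : M u by apply: sM; rewrite -uE; apply: gens_lincomb.
have [x xE] := gE.2 u Mu; exists (v - al *: x).
  by rewrite -[kersm _ _]/(lincomb _ _ = 0) linearB linearZ /= -[X in _ *: X]xE -uE subrr.
by rewrite mapfB mapfZ hs_al scale0r subr0.
Qed.

(** Here every element of [M] is [al] times another one, hence divisible by all powers of [al]. *)
Lemma imp_eq0 (J : finType) (M : submodule {ffun J -> S^o}) : saturated M ->
  (forall v', imp M v' -> v' = 0) -> forall v, M v -> v = 0.
Proof.
move=> sM M0.
have H k : forall v, M v -> forall j, ordge k (v j : S).
  elim: k => [|k IH] v Mv j; first by move=> d; rewrite ltn0.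
  have /mapf_ker[u uE] : mapf pi v = 0 by apply: M0; exists v.
  have Mu : M u by apply: sM; rewrite -uE.
  rewrite uE ffunE -[_ *: _]/(_ * _) -add1n; apply: ordge_mul; last exact: IH.
  by apply: homog_ordge; have [] := hs.
by move=> v Mv; apply/ffunP => j; rewrite ffunE; apply: ordge_inf => k; apply: H.
Qed.

Lemma no_const_mapf (I : finType) (u : {ffun I -> S^o}) : no_const u -> no_const (mapf pi u).
Proof. by move=> h i; rewrite ffunE [LHS]hs_hc h rmorph0. Qed.

(** A minimal cover of [M] restricts to a cover of [imp M] that is still minimal, and by [imp_ker]
    its kernel restricts to the kernel. So the given resolution shortens at each step until
    [imp_eq0] applies. *)
Lemma pres_lift m (J : finType) (w : J -> nat) (M : submodule {ffun J -> S^o}) :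
  graded w M -> saturated M -> pres m (subT (imp M)) -> pres m (subT M).
Proof.
elim: m J w M => [|m IH] J w M gM sM rM.
  move=> x; apply: inc_inj; rewrite linear0.
  apply: (imp_eq0 sM _ (incP x)) => v' Mv'.
  by have := congr1 (inc _) (rM (toS Mv')); rewrite linear0.
have [b [E [e [gE hE Ec]]]] := mingens gM.
apply: (res_gens _ gE); first exact: proj_ffun.
apply: (IH _ e); [exact: graded_ker hE | exact: ker_saturated |].
have [q [qE s]] := ses_gens (imp_gens gE).
have kq u : kersm q u <-> imp (kersm (lincomb E)) u.
  rewrite (imp_ker sM gE); split=> [/(congr1 (inc _))|h]; first by rewrite qE linear0.
  by apply: inc_inj; rewrite qE linear0.
apply: (res_eq kq); apply: syz_min rM; first by have [] := s.
by move=> u /kq[v Ev <-]; apply: no_const_mapf; apply: Ec.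
Qed.

Lemma fres_section m (J : finType) (M : submodule {ffun J -> S^o}) :
  saturated M -> fres m (subT M) -> fres m (subT (imp M)).
Proof.
elim: m J M => [|m IH] J M sM rM.
  move=> x; apply: inc_inj; rewrite linear0; have [v Mv <-] := incP x.
  by have := congr1 (inc _) (rM (toS Mv)); rewrite linear0 /= => ->; rewrite mapf0.
have [b [E [gE rE]]] := fres_gens rM.
apply: (res_gens _ (imp_gens gE)); first exact: finfree_ffun.
apply: (res_eq (imp_ker sM gE)).
exact: (IH _ _ (@ker_saturated _ _ E) rE).
Qed.

End HyperplaneSection.

(** * Hilbert's syzygy theorem for graded submodules *)

Section Hilbert.
Variable K : fieldType.
Hypothesis ex_hs : forall n, exists (pi : {rmorphism {mpoly K[n.+1]} -> {mpoly K[n]}})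
  (al : {mpoly K[n.+1]}), hyperplane_section pi al.

(** In [n.+1] variables a general module needs [n.+2] terms; one is saved because [M] lies in a free
    module. The syzygies of a cover are saturated, so [pres_lift] removes one variable. *)
Lemma hilbert_syzygy n (J : finType) (w : J -> nat)
    (M : submodule {ffun J -> {mpoly K[n.+1]}^o}) :
  graded w M -> pres n.+1 (subT M).
Proof.
elim: n J w M => [|n IH] J w M gM.
  have [pi [al hs]] := ex_hs 0%N; have [b [E [e [gE hE Ec]]]] := mingens gM.
  apply: (res_gens (@proj_ffun _ _) gE).
  apply: (@pres_lift _ _ _ _ _ hs 0 _ e _ (graded_ker hE) (ker_saturated hs (E := E))).
  move=> x; apply: inc_inj; rewrite linear0; have [v Ev <-] := incP x.
  (* Over [{mpoly K[0]}] everything is constant, while minimal relations have no constant terms;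
     hence there are none. *)
  have h := no_const_mapf hs (Ec v Ev).
  apply/ffunP => i; rewrite [RHS]ffunE; apply: hc_ext => d; rewrite linear0.
  case: d => [|d]; first exact: h.
  have h0 : hmg 0 (mapf pi v i : {mpoly K[0]}).
    by apply/dhomogP => m _; rewrite (nvar0_mnmE m) mf0.
  exact: pihomog_ne0 h0.
have [pi [al hs]] := ex_hs n.+1; have [b [E [e [gE hE Ec]]]] := mingens gM.
apply: (res_gens (@proj_ffun _ _) gE).
apply: (@pres_lift _ _ _ _ _ hs n.+1 _ e _ (graded_ker hE) (ker_saturated hs (E := E))).
by apply: (IH _ e); apply: imp_graded; exact: graded_ker hE.
Qed.

Lemma hilbert_syzygy_sat n pi al (J : finType) (w : J -> nat)
    (M : submodule {ffun J -> {mpoly K[n.+2]}^o}) :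
  @hyperplane_section K n.+2 n.+1 pi al -> graded w M -> saturated al M ->
  pres n.+1 (subT M).
Proof.
move=> hs gM sM; apply: (@pres_lift _ _ _ _ _ hs n.+1 _ w _ gM sM).
by apply: (hilbert_syzygy (w := w)); apply: imp_graded.
Qed.

End Hilbert.

(** * Modules of logarithmic forms *)

Section Divisibility.
Variable R : idomainType.

Definition dvs (a x : R) : Prop := exists y, x = a * y.
Definition dvf (J : finType) (a : R) (w : {ffun J -> R^o}) : Prop := exists d, w = a *: d.

Lemma dvfP (J : finType) a (w : {ffun J -> R^o}) : dvf a w <-> forall j, dvs a (w j).
Proof.
split=> [[d ->] j|/choice[d dE]]; first by exists (d j); rewrite ffunE.
by exists [ffun j => d j]; apply/ffunP => j; rewrite !ffunE dE.
Qed.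

Lemma dvs0 a : dvs a 0. Proof. by exists 0; rewrite mulr0. Qed.
Lemma dvsL a b x y : dvs a x -> dvs a y -> dvs a (b * x + y).
Proof. by move=> [x' ->] [y' ->]; exists (b * x' + y'); rewrite mulrDr mulrCA. Qed.
Lemma dvsM a b x : dvs a x -> dvs a (b * x).
Proof. by move=> h; rewrite -[_ * _]addr0; apply: dvsL (dvs0 _). Qed.
Lemma dvs_sum a (I : Type) (s : seq I) (P : pred I) (F : I -> R) :
  (forall i, P i -> dvs a (F i)) -> dvs a (\sum_(i <- s | P i) F i).
Proof.
move=> h; apply: (big_ind (dvs a)) => //; first exact: dvs0.
by move=> x y hx hy; rewrite -[x]mul1r; apply: dvsL.
Qed.

Lemma dvf0 (J : finType) a : dvf a (0 : {ffun J -> R^o}).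
Proof. by exists 0; rewrite scaler0. Qed.
Lemma dvfL (J : finType) a b (x y : {ffun J -> R^o}) : dvf a x -> dvf a y -> dvf a (b *: x + y).
Proof.
move=> [x' ->] [y' ->]; exists (b *: x' + y').
by rewrite scalerDr !scalerA mulrC.
Qed.
Lemma dvfZ (J : finType) a b (x : {ffun J -> R^o}) : dvf a x -> dvf a (b *: x).
Proof. by move=> h; rewrite -[_ *: _]addr0; apply: dvfL (dvf0 _ _). Qed.
Lemma dvfD (J : finType) a (x y : {ffun J -> R^o}) : dvf a x -> dvf a y -> dvf a (x + y).
Proof. by move=> h h'; rewrite -[x]scale1r; apply: dvfL. Qed.
Lemma dvfN (J : finType) a (x : {ffun J -> R^o}) : dvf a x -> dvf a (- x).
Proof. by move=> h; rewrite -scaleN1r; apply: dvfZ. Qed.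
Lemma dvfB (J : finType) a (x y : {ffun J -> R^o}) : dvf a x -> dvf a y -> dvf a (x - y).
Proof. by move=> h h'; apply: dvfD => //; apply: dvfN. Qed.
Lemma dvf_self (J : finType) a (x : {ffun J -> R^o}) : dvf a (a *: x).
Proof. by exists x. Qed.

Lemma dvf_lin (J J' : finType) a (f : {linear {ffun J -> R^o} -> {ffun J' -> R^o}}) x :
  dvf a x -> dvf a (f x).
Proof. by move=> [y ->]; exists (f y); rewrite linearZ. Qed.

Definition dreg (a b : R) := forall x, dvs a (b * x) -> dvs a x.

Lemma dregf (J : finType) a b (x : {ffun J -> R^o}) : dreg a b -> dvf a (b *: x) -> dvf a x.
Proof.
by move=> ab /dvfP h; apply/dvfP => j; apply: ab; have := h j; rewrite ffunE.
Qed.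

Lemma dreg_prod (T : eqType) (s : seq T) (P : pred T) a (b : T -> R) :
  (forall t, t \in s -> P t -> dreg a (b t)) -> dreg a (\prod_(t <- s | P t) b t).
Proof.
elim: s => [|t s IH] h x; first by rewrite big_nil mul1r.
have IH' : dreg a (\prod_(t <- s | P t) b t).
  by apply: IH => t' ts; apply: h; rewrite inE ts orbT.
rewrite big_cons; case: ifP => [Pt|_]; last exact: IH'.
by rewrite -mulrA => /(h t (mem_head _ _) Pt)/IH'.
Qed.

Lemma dreg_exp a b m : dreg a b -> dreg a (b ^+ m).
Proof.
move=> ab; elim: m => [|m IH] x; first by rewrite mul1r.
by rewrite exprS -mulrA => /ab/IH.
Qed.

Lemma dreg_expl a b m : a != 0 -> dreg a b -> dreg (a ^+ m) b.
Proof.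
move=> a0 ab; elim: m => [|m IH] x; first by exists x; rewrite mul1r.
rewrite exprSr => -[y yE].
have [|z xE] := IH x; first by exists (a * y); rewrite yE mulrA.
have : dvs a (b * z).
  exists y; apply: (mulfI (expf_neq0 m a0)).
  by rewrite mulrCA -xE yE mulrA.
by move=> /ab[z' z'E]; exists z'; rewrite xE z'E mulrA.
Qed.

Lemma dvs_prod (T : eqType) (s : seq T) (a : T -> R) x : uniq s ->
  (forall t t', t \in s -> t' \in s -> t != t' -> dreg (a t) (a t')) ->
  (forall t, t \in s -> dvs (a t) x) -> dvs (\prod_(t <- s) a t) x.
Proof.
elim: s x => [|t s IH] x; first by exists x; rewrite big_nil mul1r.
move=> /= /andP[ts us] cop ax.
have [||y yE] := IH x us.
- by move=> t1 t2 h1 h2; apply: cop; rewrite inE ?h1 ?h2 orbT.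
- by move=> t' h; apply: ax; rewrite inE h orbT.
have [z zE] : dvs (a t) y.
  have h : dreg (a t) (\prod_(t <- s) a t).
    apply: dreg_prod => t' t's _; apply: cop; rewrite ?mem_head ?inE ?t's ?orbT //.
    by apply: contraNneq ts => ->.
  by apply: h; rewrite -yE; apply: ax; rewrite mem_head.
by exists z; rewrite big_cons yE zE mulrCA mulrA.
Qed.

End Divisibility.

Section Logs.
Variables (R : idomainType) (k : nat) (T : eqType) (s : seq T).
Variables (c : T -> vec k R) (a : T -> R).

(** Numerators of logarithmic forms. With [c] and [a] abstract, the same module serves the
    arrangement, the forms on [H] over [S], and the Ziegler restriction. *)
Definition logs (p : nat) : submodule (forms k R).
Proof.
exists (fun w => pform p w /\ forall t, t \in s -> dvf (a t) (ew (c t) w)).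
  by split=> [|t _]; [exact: pform0 | rewrite linear0; exact: dvf0].
move=> b x y [px hx] [py hy]; split=> [|t ts]; first exact: pformL.
by rewrite linearP; apply: dvfL; [apply: hx | apply: hy].
Defined.

(** The hypothesis says that [th] is a logarithmic vector field; the claim is the Clifford relation
    read modulo each [a t]. *)
Lemma iv_logs p (th : vec k R) w : (forall t, t \in s -> dvs (a t) (dot (c t) th)) ->
  logs p.+1 w -> logs p (iv th w).
Proof.
move=> hth [pw hw]; split=> [|t ts]; first exact: pform_iv.
have -> : ew (c t) (iv th w) = dot (c t) th *: w - iv th (ew (c t) w).
  by rewrite -(ew_iv (c t) th w) addrK.
apply: dvfB; last exact: dvf_lin (hw t ts).
by have [y ->] := hth t ts; rewrite -scalerA; apply: dvf_self.
Qed.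

Hypothesis us : uniq s.
Hypothesis cop : forall t t', t \in s -> t' \in s -> t != t' -> dreg (a t) (a t').
Hypothesis cunit : forall t, t \in s -> exists v, dot (c t) v = 1.
Hypothesis a0 : forall t, t \in s -> a t != 0.
Let D := \prod_(t <- s) a t.

Lemma logs_prod_neq0 : D != 0.
Proof. by rewrite prodf_seq_neq0; apply/allP => t /a0. Qed.

Lemma logs0_dvs w : logs 0 w -> dvs D (w set0).
Proof.
move=> [_ hw]; apply: dvs_prod => // t ts.
have [v cv] := cunit ts; rewrite -[w set0]mul1r -cv mulr_suml.
apply: dvs_sum => i _; rewrite mulrAC mulrC; apply: dvsM.
by have /dvfP/(_ [set i]) := hw t ts; rewrite ew_set1.
Qed.

Lemma logs0_gens : gens (logs 0) (fun _ : 'I_1 => D *: one R k).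
Proof.
split=> [_|w lw].
  split=> [|t ts]; first by apply: pformZ; apply: pform_one.
  rewrite linearZ /= /D (big_rem t) //= -scalerA; exact: dvf_self.
have [y yE] := logs0_dvs lw; exists [ffun=> y].
rewrite /= big_ord1 ffunE scalerA mulrC -yE; exact: form0_one lw.1.
Qed.

Lemma logs0_fres : fres 1 (subT (logs 0)).
Proof.
apply: (res_gens _ logs0_gens) => [|u]; first exact: finfree_ffun.
apply: inc_inj; rewrite linear0; apply/ffunP => i; rewrite ord1 [RHS]ffunE.
have := incP u; rewrite -[kersm _ _]/(lincomb _ _ = 0) /= big_ord1 => /ffunP/(_ set0).
rewrite !ffunE eqxx [D *: 1]mulr1 => /eqP; rewrite [_ == _]mulf_eq0.
by rewrite (negPf logs_prod_neq0) orbF => /eqP.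
Qed.

Lemma dvf_prod (w : forms k R) : (forall t, t \in s -> dvf (a t) w) -> dvf D w.
Proof.
move=> h; apply/dvfP => K; apply: dvs_prod => // t ts.
by have /dvfP := h t ts.
Qed.

Lemma logs1_split t g : t \in s -> logs 1 (ew g (one R k)) ->
  exists mu h, g = mu *: c t + a t *: h.
Proof.
move=> ts [_ /(_ t ts)[d dE]]; have [v cv] := cunit ts.
exists (dot g v), [ffun i => iv v d [set i]]; apply/ffunP => i.
have : (ew g (one R k)) [set i] = g i by rewrite ew_set1 ffunE eqxx [_ *: _]mulr1.
have := ew_iv (c t) v (ew g (one R k)); rewrite cv scale1r => <-.
rewrite dE !linearZ /= iv_ew iv_one linear0 subr0 linearZ !ffunE.
by rewrite ew_set1 ffunE eqxx => <-; rewrite [c t i *: 1]mulr1.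
Qed.

(** Logarithmic forms are closed under the wedge product. The product of two numerators belongs to
    the denominator [D ^+ 2], so one factor [D] must split off. *)
Lemma ew_logs p g w : logs 1 (ew g (one R k)) -> logs p w ->
  exists2 w', logs p.+1 w' & ew g w = D *: w'.
Proof.
move=> lg [pw hw].
have [w' w'E] : dvf D (ew g w).
  apply: dvf_prod => t ts; have [mu [h ->]] := logs1_split ts lg.
  rewrite ewDl ewZl; apply: dvfL; [exact: hw | exact: dvf_self].
exists w' => //; split=> [K pK|t ts].
  have := pform_ew g pw pK; rewrite w'E ffunE => /eqP.
  by rewrite [_ == _]mulf_eq0 (negPf logs_prod_neq0) => /eqP.
have [mu [h gE]] := logs1_split ts lg; have [d dE] := hw t ts.
have e : D *: ew (c t) w' = (a t * a t) *: - ew h d.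
  rewrite -linearZ -w'E gE ewDl ewZl linearD !linearZ_LR /= ewK scaler0 add0r.
  by rewrite ewC dE linearZ_LR !scalerN scalerA.
(* One [a t] cancels against the factor in [D]; the other factors are regular modulo [a t] and drop
   out of the divisibility. *)
move: e; rewrite /D (big_rem t) //= -!scalerA => e.
have {}e : (\prod_(y <- rem t s) a y) *: ew (c t) w' = a t *: - ew h d.
  apply/ffunP => K; have := congr1 (fun z : forms k R => z K) e; rewrite !ffunE.
  by apply: mulfI; apply: a0.
apply: (@dregf _ _ _ (\prod_(y <- rem t s) a y)); last by rewrite e; apply: dvf_self.
apply: dreg_prod => t' t's _; apply: cop => //; first exact: mem_rem t's.
by apply: contraTneq t's => <-; rewrite mem_rem_uniqF.
Qed.

(** Each wedge after the first vector gains a factor [D] by [ew_logs], hence the exponent [p] in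
    degree [p.+1]. *)
Lemma ext_logs m (G : 'I_m -> vec k R) p w :
  (forall i, logs 1 (ew (G i) (one R k))) -> pform p.+1 w ->
  exists2 g, logs p.+1 g & ext G w = D ^+ p *: g.
Proof.
move=> hG; pose P q (w : forms m R) :=
  if q is p.+1 then exists2 g, logs p.+1 g & ext G w = D ^+ p *: g else pform 0 w.
apply: (@pform_ind R m P _ _ _ _ p.+1) => [[|q]|[|q] b x y||[|q] i x] /=.
- exact: pform0.
- by exists 0; [exact: (sm0 (logs q.+1)) | rewrite linear0 scaler0].
- exact: pformL.
- move=> [g lg gE] [h lh hE]; exists (b *: g + h); first exact: (@smL _ _ (logs q.+1)).
  by rewrite linearP /= gE hE scalerDr !scalerA mulrC.
- exact: pform_one.
- move=> /form0_one ->; exists ((x set0 : R) *: ew (G i) (one R k)); first exact: (@smZ _ _ (logs 1)).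
  by rewrite !linearZ /= ext_mulx ext_one scale1r.
move=> [g lg gE]; have [g' lg' g'E] := ew_logs (hG i) lg.
exists g' => //; rewrite ext_mulx gE linearZ /= g'E scalerA exprSr //.
Qed.

(** The columns of [Th] are logarithmic vector fields. A coefficient of [ext Th w] is [w] contracted
    with [p] of them, so it is a logarithmic 0-form and [D] divides it. *)
Lemma ext_dvf m (Th : 'I_k -> vec m R) p w :
  (forall i t, t \in s -> dvs (a t) (dot (c t) [ffun j => Th j i])) ->
  logs p w -> dvf D (ext Th w).
Proof.
move=> hTh; elim: p w => [|p IH] w lw; apply/dvfP => K.
  rewrite (form0_one lw.1) linearZ /= ext_one ffunE -[_ *: _]/(_ * _) mulrC; apply: dvsM.
  exact: logs0_dvs.
have [cK|cK] := boolP (#|K| == p.+1); last by rewrite (pform_ext _ lw.1) //; apply: dvs0.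
have [i iK] : exists i, i \in K by apply/set0Pn; rewrite -cards_eq0 (eqP cK).
have := iv_ext Th (unitv R i) w; rewrite iv_unitv => e.
have := IH _ (iv_logs (hTh i) lw).
have -> : [ffun j => Th j i] = [ffun j => dot (Th j) (unitv R i)].
  by apply/ffunP => j; rewrite !ffunE dotC dot_unitv.
rewrite -e => /dvfP/(_ (K :\ i)); rewrite ffunE setD11 setD1K // => h.
rewrite -[ext Th w K]mul1r -(sgn_sqr R i (K :\ i)) -mulrA.
exact: dvsM.
Qed.

End Logs.

Lemma logs_sub (R : idomainType) k (T : eqType) (s s' : seq T) (c : T -> vec k R) a p w :
  {subset s' <= s} -> logs s c a p w -> logs s' c a p w.
Proof. by move=> ss [pw hw]; split=> // t /ss; apply: hw. Qed.

(** * Splitting off the hyperplane *)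

Lemma zmod_cancel (V : zmodType) (p q e c : V) : p - (e - (q - p - c)) = q - c - e.
Proof. by rewrite [- (e - _)]opprB !addrA [p + q]addrC addrK. Qed.

Section Split.
Variables (R : idomainType) (l k : nat) (T : eqType) (h : T) (s : seq T).
Variables (u : T -> vec l R) (al : T -> R) (X v : vec l R).
Variables (Phi : 'I_l -> vec k R) (Psi : 'I_k -> vec l R).
Let c t := lincomb Phi (u t).
Hypotheses (uX : forall t, dot (u t) X = al t) (hv : dot (u h) v = 1).
Hypotheses (Phih : c h = 0) (PhiPsi : forall j, lincomb Phi (Psi j) = unitv R j).
Hypothesis PsiPhi : forall i, lincomb Psi (Phi i) = unitv R i - (v i : R) *: u h.
Hypothesis Psiv : forall j, dot (Psi j) v = 0.
Hypothesis hreg : forall t, t \in s -> dreg (al t) (al h).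
Hypothesis al0 : al h != 0.

Let O := logs (h :: s) u al.
Let M := logs s c al.
Let y : vec k R := [ffun j => dot (Psi j) X].

Lemma ext_PhiPsi w : ext Phi (ext Psi w) = w.
Proof. by rewrite ext_comp -[RHS]ext_id; apply: eq_ext => j. Qed.

Lemma ext_PsiPhi w : ext Psi (ext Phi w) = iv v (ew (u h) w).
Proof. by rewrite ext_comp -ext_proj //; apply: eq_ext => i. Qed.

Lemma lincomb_PsiPhi t : lincomb Psi (c t) = u t - dot (u t) v *: u h.
Proof.
rewrite /c; move: (u t); apply: linear_eq => [b x z|b x z|i].
- by rewrite !linearP.
- by rewrite dotDl scalerDl -scalerA scalerBr opprD addrACA.
- by rewrite lincomb_unitv PsiPhi dot_unitv.
Qed.

Lemma dot_lincomb m n (E : 'I_m -> vec n R) (x : vec m R) z :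
  dot (lincomb E x) z = dot x [ffun j => dot (E j) z].
Proof.
rewrite /dot; under [RHS]eq_bigr => j _ do rewrite ffunE big_distrr.
rewrite exchange_big; apply: eq_bigr => i _ /=.
rewrite sum_ffunE mulr_suml; apply: eq_bigr => j _.
by rewrite ffunE mulrA.
Qed.

Lemma dot_cy t : dot (c t) y = al t - dot (u t) v * al h.
Proof.
rewrite -dot_lincomb lincomb_PsiPhi -!uX addrC -scaleNr dotDl mulNr.
by rewrite addrC.
Qed.

Lemma ew_Psi t w : ew (u t) (ext Psi w) = ext Psi (ew (c t) w) + dot (u t) v *: ew (u h) (ext Psi w).
Proof. by rewrite ext_ew lincomb_PsiPhi -scaleNr ewD ewZl scaleNr subrK. Qed.

(** Read [u t] as the differential of [al t], [X] as the Euler field, [v] as a vector transverse to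
    [H], [Phi] as restriction of forms to [H] and [Psi] as extension along [v]. By [iv_ew] and
    [iv_ext], the part coming from [x.1] is the contraction with [X] of [u h] wedge [ext Psi x.1],
    and contraction with the Euler field keeps forms logarithmic. *)
Definition glue (x : forms k R * forms k R) : forms l R :=
  al h *: ext Psi x.1 + ew (u h) (ext Psi (x.2 - iv y x.1)).

Lemma glue_lin : linear glue.
Proof.
have l1 : linear (fun x : forms k R * forms k R => ext Psi x.1).
  by move=> b x z; rewrite /= linearP.
have l2 : linear (fun x : forms k R * forms k R => ew (u h) (ext Psi (x.2 - iv y x.1))).
  move=> b x z; rewrite -(linearP (ew (u h))) -(linearP (ext Psi)).
  by rewrite (linearP (iv y)) scalerBr opprD addrACA.
move=> b x z; rewrite /glue (l1 b) (l2 b) !scalerDr !scalerA [b * _]mulrC.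
by rewrite addrACA.
Qed.

Lemma ew_Phi t w : ew (c t) (ext Phi w) = ext Phi (ew (u t) w).
Proof. by rewrite ext_ew. Qed.

Lemma ext_Phi_u w : ext Phi (ew (u h) w) = 0.
Proof. by rewrite ext_ew -/(c h) Phih ew0l. Qed.

Lemma iv_Psi w : iv v (ext Psi w) = 0.
Proof.
rewrite iv_ext (_ : [ffun i => _] = 0); last by apply/ffunP => j; rewrite !ffunE.
by rewrite /iv big1 ?linear0 // => i _; rewrite ffunE scale0r.
Qed.

Lemma glue_O p b w : M p.+1 b -> M p w -> O p.+1 (glue (b, w)).
Proof.
move=> [pb hb] [pw hw]; split=> [|t].
  rewrite /glue; apply: pformL; first exact: pform_ext.
  apply/pform_ew/pform_ext; rewrite addrC -scaleN1r; apply: pformL => //; exact: pform_iv.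
have e1 z : ew (u t) (ew (u h) (ext Psi z)) = - ew (u h) (ext Psi (ew (c t) z)).
  by rewrite ewC ew_Psi linearD linearZ /= ewK scaler0 addr0.
rewrite inE => /orP[/eqP -> | ts].
  by rewrite /glue linearD linearZ /= ewK addr0; apply: dvf_self.
have -> : ew (u t) (glue (b, w)) = al h *: ext Psi (ew (c t) b) +
    ew (u h) (ext Psi (al t *: b - iv y (ew (c t) b) - ew (c t) w)).
  have lF : linear (fun z => ew (u h) (ext Psi z)) by move=> r x z; rewrite !linearP.
  (* By [dot_cy], pairing [c t] with [y] yields [al t] minus [dot (u t) v * al h]; the second term
     cancels the error term of [ew_Psi]. *)
  have e2 : (al h * dot (u t) v) *: b - ew (c t) (w - iv y b) =
      al t *: b - iv y (ew (c t) b) - ew (c t) w.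
    rewrite (linearB (ew (c t))) /= -[ew (c t) (iv y b)](addrK (iv y (ew (c t) b))).
    rewrite ew_iv dot_cy scalerBl [_ * al h]mulrC.
    exact: zmod_cancel.
  rewrite -e2 -[ew (u h) (ext Psi _)]/(mklin lF _) (linearB (mklin lF)).
  rewrite (linearZ_LR (mklin lF)) /glue linearD linearZ_LR /= e1 ew_Psi scalerDr scalerA.
  by rewrite -addrA.
apply: dvfD; first by apply/dvfZ/(dvf_lin (ext Psi))/hb.
apply: (dvf_lin (ew (u h))); apply: (dvf_lin (ext Psi)).
apply: dvfB; last exact: hw.
by apply: dvfB; [apply: dvf_self | apply: (dvf_lin (iv y)); apply: hb].
Qed.

Lemma glue_inj b w : glue (b, w) = 0 -> b = 0 /\ w = 0.
Proof.
move=> e; have b0 : b = 0.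
  have := congr1 (ext Phi) e; rewrite /glue linearD linearZ /= ext_Phi_u addr0.
  rewrite ext_PhiPsi linear0 => /ffunP hb; apply/ffunP => K; have := hb K.
  by rewrite !ffunE => /eqP; rewrite [_ == _]mulf_eq0 (negPf al0) => /eqP.
split=> //; move: e; rewrite b0 /glue /= !linear0 ?scaler0 add0r ?subr0 ?addr0 => e.
have := congr1 (fun z => ext Phi (iv v z)) e; rewrite /= iv_ew hv scale1r iv_Psi.
by rewrite linear0 subr0 ext_PhiPsi !linear0.
Qed.

(** As [al h] divides [u h] wedge [e], the restriction of [e] to [H] is [al h *: b], with [b]
    logarithmic. Subtracting [glue (b, 0)] leaves a form vanishing on [H], that is, a multiple of
    [u h]. *)
Lemma glue_surj p e : O p.+1 e -> exists b w, [/\ M p.+1 b, M p w & e = glue (b, w)].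
Proof.
move=> Oe; have [pe he] := Oe.
have [d dE] := he h (mem_head _ _).
have hs t : t \in s -> dvf (al t) (ew (u t) e) by move=> ts; apply: he; rewrite inE ts orbT.
pose b := ext Phi (iv v d).
have bE : ext Phi e = al h *: b.
  have := ew_iv (u h) v e; rewrite hv scale1r => <-.
  by rewrite linearD /= ext_Phi_u add0r dE !linearZ.
have Mb : M p.+1 b.
  split=> [K pK|t ts].
    have := pform_ext Phi pe pK; rewrite bE ffunE => /eqP.
    by rewrite [_ == _]mulf_eq0 (negPf al0) => /eqP.
  apply: (dregf (hreg ts)); have -> : al h *: ew (c t) b = ext Phi (ew (u t) e).
    by rewrite -ew_Phi bE linearZ_LR.
  exact: (dvf_lin (ext Phi)) (hs t ts).
have M0 q : M q 0 by apply: sm0.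
have Ob : O p.+1 (glue (b, 0)) by exact: glue_O Mb (M0 p).
pose e' := e - glue (b, 0).
have [pe' he'] : O p.+1 e' by apply: smB.
have Phie' : ext Phi e' = 0.
  by rewrite linearB /= bE /glue linearD linearZ /= ext_Phi_u addr0 ext_PhiPsi subrr.
pose w := ext Phi (iv v e').
have e'E : e' = ew (u h) (iv v e').
  by have := ew_iv (u h) v e'; rewrite hv scale1r -ext_PsiPhi Phie' linear0 addr0.
have Mw : M p w.
  split=> [|t ts]; first exact/pform_ext/pform_iv.
  rewrite /w ew_Phi.
  have -> : ew (u t) (iv v e') = dot (u t) v *: e' - iv v (ew (u t) e').
    by rewrite -(ew_iv (u t) v e') addrK.
  rewrite linearB linearZ /= Phie' scaler0 sub0r; apply: dvfN.
  by apply: (dvf_lin (ext Phi)); apply: (dvf_lin (iv v)); apply: he'; rewrite inE ts orbT.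
exists b, w; split=> //.
have -> : glue (b, w) = glue (b, 0) + glue (0, w).
  have := glue_lin 1 (b, 0) (0, w); rewrite !scale1r => <-; congr glue.
  by apply: pair_ext; rewrite /= ?addr0 ?add0r.
rewrite {2}/glue /= !linear0 ?scaler0 add0r ?subr0 ?addr0 /w ext_PsiPhi iv_ew hv scale1r.
by rewrite linearB /= ewK subr0 -e'E /e' addrC subrK.
Qed.

Lemma split_logs p : exists f : {linear (subT (M p.+1) * subT (M p))%type -> subT (O p.+1)},
  injective f /\ forall z, exists x, f x = z.
Proof.
have hO x : O p.+1 (glue (inc (M p.+1) x.1, inc (M p) x.2)).
  by apply: glue_O; apply: incP.
have lf : linear (fun x : subT (M p.+1) * subT (M p) => glue (inc (M p.+1) x.1, inc (M p) x.2)).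
  by move=> b x z; rewrite -glue_lin; congr glue; apply: pair_ext; rewrite /= linearP.
exists (@corestr _ _ _ (O p.+1) (mklin lf) hO); split.
  apply: lin_inj => x /(congr1 (inc (O p.+1))); rewrite linear0 => /glue_inj[e1 e2].
  by apply: pair_ext; apply: inc_inj; rewrite linear0.
move=> z; have [b [w [Mb Mw zE]]] := glue_surj (incP z).
by exists (toS Mb, toS Mw); apply: inc_inj; rewrite zE.
Qed.

End Split.

(** * Linear forms and hyperplane restriction *)

Local Notation "x %:F" := (@FracField.tofrac _ x) : ring_scope.

Section LinearForms.
Variables (K : fieldType).

Definition kvec n m (f : 'Hom('rV[K]_n, K^o)) : vec n {mpoly K[m]} :=
  [ffun i => (f (delta_mx 0 i) : K)%:MP].

(** The Euler vector field: pairing with it turns the differential of a linear form back into the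
    form. *)
Definition xvec n : vec n {mpoly K[n]} := [ffun i => 'X_i].

Lemma dot_kvec n (f : 'Hom('rV[K]_n, K^o)) : dot (kvec n f) (xvec n) = linpoly f.
Proof. by apply: eq_bigr => i _; rewrite !ffunE mul_mpolyC. Qed.

Lemma homog_linpoly n (f : 'Hom('rV[K]_n, K^o)) : hmg 1 (linpoly f).
Proof.
rewrite /hmg /linpoly; apply: rpred_sum => i _; apply: rpredZ.
by rewrite dhomogX /= mdeg1.
Qed.

Lemma lfun_expand n m (f : 'Hom('rV[K]_n, 'rV[K]_m)) x :
  f x = \sum_i x 0 i *: f (delta_mx 0 i).
Proof. by rewrite {1}[x]row_sum_delta linear_sum; apply: eq_bigr => i _; rewrite linearZ. Qed.

Lemma lform_expand n (f : 'Hom('rV[K]_n, K^o)) x :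
  f x = \sum_i x 0 i *: f (delta_mx 0 i).
Proof. by rewrite {1}[x]row_sum_delta linear_sum; apply: eq_bigr => i _; rewrite linearZ. Qed.

Lemma linpoly_eq0 n (f : 'Hom('rV[K]_n, K^o)) : linpoly f = 0 -> f = 0.
Proof.
move=> f0; apply/lfunP => x; rewrite zero_lfunE lform_expand big1 // => i _.
have := congr1 (mcoeff U_(i)) f0; rewrite mcoeff0 /linpoly raddf_sum /=.
rewrite (bigD1 i) //= big1 => [|j ji].
  by rewrite mcoeffZ mcoeffX eqxx mulr1 addr0 => ->; rewrite scaler0.
rewrite mcoeffZ mcoeffX (_ : (_ == _) = false) ?mulr0 //.
apply/eqP => /mnmP/(_ i); rewrite !mnm1E eqxx (negPf ji) //.
Qed.

Lemma defform_neq0 n (L : {vspace 'rV[K]_n}) : (\dim L).+1 = n -> defform L != 0.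
Proof.
move=> dL; apply: contra_eqN (dL) => /eqP f0.
rewrite -[in \dim L](lker_defform dL) f0 (_ : lker 0 = fullv).
  by rewrite dimvf /= /dim /= mul1n neq_ltn ltnSn orbT.
by apply/vspaceP => x; rewrite memv_ker zero_lfunE eqxx memvf.
Qed.

Lemma alpha_neq0 n (L : {vspace 'rV[K]_n}) : (\dim L).+1 = n -> alpha L != 0.
Proof. by move=> dL; apply: contraNneq (defform_neq0 dL) => /linpoly_eq0 ->. Qed.

Lemma homog_alpha n (L : {vspace 'rV[K]_n}) : hmg 1 (alpha L).
Proof. exact: homog_linpoly. Qed.

Lemma lform_unit n (f : 'Hom('rV[K]_n, K^o)) : f != 0 -> exists v, f v = 1.
Proof.
move=> f0; have [v fv] : exists v, f v != 0.
  apply/not_existsP => h; move/eqP: f0; apply; apply/lfunP => x.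
  by rewrite zero_lfunE; apply/eqP; apply: contra_notT (h x).
by exists ((f v : K)^-1 *: v); rewrite linearZ; apply: mulVf.
Qed.

Definition constv n m (v : 'rV[K]_n) : vec n {mpoly K[m]} := [ffun i => (v 0 i)%:MP].

Lemma dot_constv n m (f : 'Hom('rV[K]_n, K^o)) v : dot (kvec m f) (constv m v) = (f v : K)%:MP.
Proof.
rewrite lform_expand raddf_sum; apply: eq_bigr => i _.
by rewrite !ffunE -mpolyCM mulrC.
Qed.

Lemma kvec_unit n m (f : 'Hom('rV[K]_n, K^o)) : f != 0 -> exists v, dot (kvec m f) v = 1.
Proof. by move=> /lform_unit[v fv]; exists (constv m v); rewrite dot_constv fv mpolyC1. Qed.

Lemma hyperplane_param n (L : {vspace 'rV[K]_n}) : (\dim L).+1 = n ->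
  exists phi : 'Hom('rV[K]_n.-1, 'rV[K]_n), lker phi = 0%VS /\ limg phi = L.
Proof.
move=> dL; have -> : n.-1 = \dim L by move: (\dim L) dL => d <-.
pose F : 'rV[K]_(\dim L) -> 'rV[K]_n := fun v => \sum_i v 0 i *: (vbasis L)`_i.
have lF : linear F.
  move=> a x y; rewrite /F scaler_sumr -big_split; apply: eq_bigr => i _ /=.
  by rewrite !mxE scalerDl scalerA.
have /andP[/eqP sL fL] := vbasisP L.
exists (linfun (mklin lF)); split.
  apply/eqP/lker0P; move=> x y; rewrite !lfunE /= => xy.
  apply/rowP => i; apply/eqP; rewrite -subr_eq0; apply/eqP.
  have /freeP/(_ (fun i => x 0 i - y 0 i)) := fL; apply=> //.
  under eq_bigr => j _ do rewrite scalerBl.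
  by rewrite sumrB; apply/eqP; rewrite subr_eq0; apply/eqP.
apply/vspaceP => x; apply/memv_imgP/idP => [[v _ ->]|xL].
  rewrite lfunE /= /F; apply: memv_suml => i _; apply: memvZ; apply: vbasis_mem.
  by apply: mem_nth; rewrite size_tuple.
exists (\row_i coord (vbasis L) i x); first exact: memvf.
rewrite lfunE /= /F {1}(coord_vbasis xL); apply: eq_bigr => i _; by rewrite mxE.
Qed.

Lemma hc_pullback n k (phi : 'Hom('rV[K]_k, 'rV[K]_n)) d f :
  hc d (pullback phi f) = pullback phi (hc d f).
Proof.
have hX m : hmg (mdeg m) (pullback phi 'X_[m]).
  rewrite mpolyXE_id rmorph_prod mdegE /=.
  elim/big_ind2: _ => [|p i q j hp hq|i _]; first exact: dhomog1.
    exact: homogM.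
  rewrite rmorphXn /=; apply: homogX.
  by have [c _ <-] := coord_form K i; rewrite pullback_linpoly; apply: homog_linpoly.
elim/mpolyind: f => [|c m f _ _ IH]; first by rewrite !linear0.
rewrite !linearP /= IH; congr (_ *: _ + _).
rewrite [LHS](hc_id _ (hX m)).
have h : hmg (mdeg m) ('X_[m] : {mpoly K[n]}) by rewrite /hmg dhomogX.
by rewrite [in RHS](hc_id _ h); case: ifP => _ //; rewrite linear0.
Qed.

Lemma pullback_section n k (phi : 'Hom('rV[K]_k, 'rV[K]_n)) L :
  lker phi = 0%VS -> limg phi = L -> (\dim L).+1 = n ->
  hyperplane_section (pullback phi) (alpha L).
Proof.
move=> phi0 phiL dL; split.
- exact: pullback_surj.
- by move=> f; apply: pullback_eq0.
- exact: alpha_neq0.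
- exact: homog_alpha.
- exact: hc_pullback.
Qed.

Lemma ex_hyperplane_section n : exists (pi : {rmorphism {mpoly K[n.+1]} -> {mpoly K[n]}})
  (al : {mpoly K[n.+1]}), hyperplane_section pi al.
Proof.
pose phi : 'Hom('rV[K]_n, 'rV[K]_n.+1) := linfun (mulmxr (pid_mx n : 'M_(n, n.+1))).
have phi0 : lker phi = 0%VS.
  apply/eqP/lker0P; move=> x y; rewrite !lfunE /= => xy.
  have := congr1 (mulmxr (pid_mx n : 'M_(n.+1, n))) xy.
  by rewrite /= -!mulmxA mul_pid_mx minnn (minn_idPr (leqnSn n)) pid_mx_1 !mulmx1.
exists (pullback phi), (alpha (limg phi)); apply: pullback_section => //.
by rewrite limg_dim_eq ?phi0 ?capv0 // dimvf /dim /= mul1n.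
Qed.

Lemma dreg_alpha n (L L' : {vspace 'rV[K]_n}) : (\dim L).+1 = n -> (\dim L').+1 = n ->
  L != L' -> dreg (alpha L) (alpha L').
Proof.
move=> dL dL' LL' x; have [phi [phi0 phiL]] := hyperplane_param dL.
move=> /(pullback_eq0 _ phiL dL); rewrite rmorphM => /eqP; rewrite mulf_eq0.
case/orP => [/eqP h|/eqP h]; last by apply/(pullback_eq0 _ phiL dL).
have {}h : pullback phi (linpoly (defform L')) = 0 by [].
move: h; rewrite pullback_linpoly => /linpoly_eq0 h; case/negP: LL'.
rewrite eqEdim -ltnS dL dL' leqnn andbT -(lker_defform dL') -phiL.
apply/subvP => _ /memv_imgP[v _ ->]; rewrite memv_ker -comp_lfunE h.
by rewrite zero_lfunE.
Qed.

End LinearForms.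

(** Elements come with no canonical coefficients, so an expression is chosen for each; independence
    of the basis makes the lift independent of the choice and hence linear. *)
Lemma free_projective (R : nzRingType) (M : lmodType R) : free_module M -> projective M.
Proof.
move=> [I [e [gen ind]]] A B g f gs.
have /choice[y yE] : forall i, exists y, g y = f (e i) by move=> i; apply: gs.
pose val (V : lmodType R) (z : I -> V) (s : seq (R * I)) := \sum_(p <- s) p.1 *: z p.2.
have group (V : lmodType R) (z : I -> V) s : val V z s =
    \sum_(i <- undup [seq p.2 | p <- s]) (\sum_(p <- s | p.2 == i) p.1) *: z i.
  under eq_bigr => i _ do rewrite scaler_suml.
  rewrite (exchange_big_dep xpredT) //= /val big_seq [RHS]big_seq.
  apply: eq_bigr => p ps; rewrite -big_filter.
  have -> : [seq i <- undup [seq p.2 | p <- s] | p.2 == i] = [:: p.2].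
    rewrite (eq_filter (a2 := pred1 p.2)) => [|i]; last by rewrite /= eq_sym.
    by rewrite filter_pred1_uniq ?undup_uniq // mem_undup map_f.
  by rewrite big_seq1.
have val0 s : val M e s = 0 -> val A y s = 0.
  rewrite !group => h; rewrite big_seq big1 // => i si.
  by rewrite (ind _ _ (undup_uniq _) h) ?scale0r.
have /choice[r rE] : forall x, exists s, x = val M e s.
  move=> x; have [s [c ->]] := gen x; exists [seq (c i, i) | i <- s].
  by rewrite /val big_map.
have lin a x z : val A y (r (a *: x + z)) = a *: val A y (r x) + val A y (r z).
  (* The defect of linearity, written as a single combination that vanishes in [M]. *)
  pose s := [seq (- p.1, p.2) | p <- r (a *: x + z)] ++ [seq (a * p.1, p.2) | p <- r x] ++ r z.
  have sE (V : lmodType R) (w : I -> V) : val V w s = - val V w (r (a *: x + z)) + (a *: val V w (r x) + val V w (r z)).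
    rewrite /val /s !big_cat !big_map /= scaler_sumr -sumrN; congr (_ + (_ + _)).
      by apply: eq_bigr => p _; rewrite scaleNr.
    by apply: eq_bigr => p _; rewrite scalerA.
  have := val0 s; rewrite !sE -!rE addNr => /(_ erefl)/eqP.
  by rewrite addrC subr_eq0 => /eqP.
exists (mklin lin) => x /=; rewrite {2}(rE x) /val !linear_sum /=.
by apply: eq_bigr => p _; rewrite !linearZ yE.
Qed.

Section OmegaLogs.
Variables (K : fieldType) (n : nat) (A : {fset {vspace 'rV[K]_n}}).
Variables (m : {vspace 'rV[K]_n} -> nat) (p : nat).
Hypothesis arrA : arrangement A.
Local Notation S := {mpoly K[n]}.
Local Notation Q := (defpoly A m).

Definition alogs := logs (enum_fset A) (fun L => kvec n (defform L)) (fun L => alpha L ^+ m L).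

Lemma defpoly_neq0 : Q != 0.
Proof.
rewrite prodf_seq_neq0; apply/allP => L LA /=; apply: expf_neq0.
by apply: alpha_neq0; apply: arrA.
Qed.

Lemma differential_linpoly (f : 'Hom('rV[K]_n, K^o)) I :
  differential (linpoly f) I = \sum_(i < n | I == [set i]) kvec n f i.
Proof.
rewrite ffunE; apply: eq_bigr => i _; rewrite /linpoly raddf_sum /= ffunE.
rewrite (bigD1 i) //= big1 => [|j ji].
  rewrite mderivZ mderivX mnm1E eqxx addr0 scale1r (_ : (U_(i) - U_(i))%MM = 0%MM).
    by rewrite mpolyX0 -mul_mpolyC mulr1.
  by apply/mnmP => j; rewrite mnmBE subnn mnm0E.
by rewrite mderivZ mderivX mnm1E (negPf ji) scale0r scaler0.
Qed.

Lemma wedge_ew (f : 'Hom('rV[K]_n, K^o)) (w : forms n S) (q : {fraction S}) :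
  wedge (ratform_of (differential (linpoly f))) [ffun I => (w I)%:F * q] =
  [ffun I => (ew (kvec n f) w I : S)%:F * q].
Proof.
apply/ffunP => J; rewrite !ffunE.
under eq_bigr => I _ do rewrite ffunE differential_linpoly ffunE.
pose F (I : {set 'I_n}) (i : 'I_n) : {fraction S} :=
  (-1) ^+ inversions I (J :\: I) * (kvec n f i)%:F * ((w (J :\: I))%:F * q).
transitivity (\sum_(I : {set 'I_n} | I \subset J) \sum_(i < n | I == [set i]) F I i).
  apply: eq_bigr => I _; rewrite rmorph_sum /= mulr_sumr mulr_suml.
  by apply: eq_bigr.
rewrite (exchange_big_dep xpredT) //= sum_ffunE rmorph_sum /= mulr_suml.
apply: eq_bigr => i _; rewrite !ffunE.
rewrite (eq_bigl (fun I => (I == [set i]) && (i \in J))); last first.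
  move=> I /=; rewrite andbC; apply: andb_id2l => /eqP ->.
  by rewrite sub1set.
case: ifP => iJ; last first.
  by rewrite big_pred0 => [|I]; rewrite ?andbF // scaler0 rmorph0 mul0r.
rewrite (eq_bigl (pred1 [set i])) => [|I]; last by rewrite /= andbT.
rewrite big_pred1_eq /F -[_ *: (_ *: _)]/(_ * (_ * _)) !rmorphM rmorphXn rmorphN1.
rewrite [_ * (kvec n f i)%:F]mulrC !mulrA; congr (_ * _ ^+ _ * _ * _); first by rewrite ffunE.
rewrite /inversions /below -[RHS](card_imset _ (_ : injective (pair i))); last by move=> x y [].
apply: eq_card => -[x y]; rewrite !inE /=.
apply/and3P/imsetP => [[/eqP -> /andP[_ yJ] yi]|[z]].
  by exists y; rewrite // inE yJ yi.
rewrite inE => /andP[zJ zi] [-> ->]; split=> //.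
by rewrite zJ andbT; apply: contraTneq zi => ->; rewrite ltnn.
Qed.

(** The map divides numerators by [Q]. Thus statements on [Omega] become statements on graded
    submodules of a free module. *)
Lemma omega_logs : exists f : {linear subT (alogs p) -> Omega A m p},
  injective f /\ forall y, exists x, f x = y.
Proof.
have Q0 : Q%:F != 0 :> {fraction S} by rewrite tofrac_eq0 defpoly_neq0.
have HO (x : subT (alogs p)) :
    [ffun I => (inc _ x I : S)%:F / Q%:F] \in logforms A m p.
  have [px hx] := incP x; apply/asboolP; split; first by exists (inc _ x).
  move=> L LA; have [d dE] := hx L LA; exists d; split.
    move=> I pI; have := pform_ew (kvec n (defform L)) px pI; rewrite dE ffunE => /eqP.
    rewrite [_ == _]mulf_eq0 expf_eq0 (negPf (alpha_neq0 (arrA LA))) andbF.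
    by move=> /eqP.
  rewrite wedge_ew dE; apply/ffunP => I; rewrite !ffunE !frac_scaleE.
  by rewrite mulrC divfK // tofracM.
have lf : linear (fun x : subT (alogs p) => LogForm (HO x)).
  move=> b x z; apply: val_inj => /=; apply/ffunP => I.
  by rewrite !ffunE frac_scaleE tofracD tofracM mulrDl mulrA.
exists (mklin lf); split.
  move=> x z /(congr1 val) /= /ffunP e; apply: inc_inj; apply/ffunP => I.
  have := e I; rewrite !ffunE => /(mulIf (invr_neq0 Q0)).
  by move=> /eqP; rewrite tofrac_eq => /eqP.
move=> [w Hw]; have := Hw => /asboolP[[eta [peta wE]] hw].
have le : alogs p eta.
  split=> // L LA; have [d [pd dE]] := hw L LA; exists d; apply/ffunP => I.
  have := congr1 (fun z : ratform K n => z I) dE.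
  rewrite wE wedge_ew !ffunE !frac_scaleE mulrC divfK // -tofracM.
  by move=> /eqP; rewrite tofrac_eq => /eqP.
by exists (toS le); apply: val_inj; rewrite /= wE.
Qed.

End OmegaLogs.

(** * Torsion modulo submodules with short resolutions *)

Section KoszulSub.
Variables (R : comNzRingType) (r : nat) (g : {ffun 'I_r -> R^o}).
Hypothesis greg : regular_seq g.

Lemma ew_in (V : lmodType R) (M : submodule V) (w : {ffun {set 'I_r} -> V}) K :
  (forall L, M (w L)) -> M (ew g w K).
Proof.
move=> hw; rewrite sum_ffunE; apply: sm_sum => i _; rewrite !ffunE; apply: smZ.
by case: ifP => _; [apply: smZ | apply: sm0].
Qed.

Lemma koszul_sub n (J : finType) (M : submodule {ffun J -> R^o}) s
    (w : {ffun {set 'I_r} -> {ffun J -> R^o}}) :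
  fres n (subT M) -> (s + n < r)%N -> pform s w -> (forall K, M (ew g w K)) ->
  exists y : {ffun {set 'I_r} -> {ffun J -> R^o}}, forall K, M (w K - ew g y K).
Proof.
move=> rM snr pw hw.
have [|a [y ->]] := koszul_res (u := [ffun K => toS (hw K)]) greg rM
  (koszul_exact_ffun greg (J := J)) (@inc_inj _ _ M) snr pw.
  by apply/ffunP => K; rewrite !ffunE.
by exists y => K; rewrite ffunE addrK ffunE; apply: incP.
Qed.

(** Koszul cohomology in degree 0: a class modulo [M] killed by all [g j] is zero once the sequence
    is longer than the resolution of [M]. This is how multipliers are removed. *)
Lemma torsion_sub n (J : finType) (M : submodule {ffun J -> R^o}) v :
  fres n (subT M) -> (n < r)%N -> (forall j, M ((g j : R) *: v)) -> M v.
Proof.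
move=> rM nr hv.
pose w : {ffun {set 'I_r} -> {ffun J -> R^o}} := [ffun K => if K == set0 then v else 0].
have [||y /(_ set0)] := koszul_sub (s := 0) (w := w) rM nr.
- by move=> K; rewrite ffunE cards_eq0 => /negPf ->.
- move=> K; rewrite sum_ffunE; apply: sm_sum => i _; rewrite !ffunE.
  case: ifP => _; last by rewrite scaler0; apply: sm0.
  case: ifP => _; last by rewrite !scaler0; apply: sm0.
  by rewrite scalerA mulrC -scalerA; apply: smZ.
by rewrite ew_set0 subr0 ffunE eqxx.
Qed.

End KoszulSub.

(** * Regular sequences *)

Section RegularSequences.
Variables (K : fieldType) (k : nat).
Local Notation S' := {mpoly K[k]}.
Variable N : 'I_k -> nat.

Definition xpow : vec k S' := [ffun i => 'X_i ^+ N i].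

Lemma seqideal_xpow j (f : S') :
  seqideal xpow j f <-> forall m, f@_m != 0 -> exists i : 'I_k, (i < j)%N && (N i <= m i)%N.
Proof.
split=> [[c ->] m|h].
  rewrite raddf_sum /= => /eqP h.
  have [i /andP[ij ci]] : exists i : 'I_k, ((i < j)%N && ((c i * xpow i)@_m != 0)).
    apply: contrapT => nh; apply: h; rewrite big1 // => i ij; apply/eqP/negP => /negP ci.
    by apply: nh; exists i; rewrite ij.
  exists i; rewrite ij /= leqNgt; apply/negP => mi; case/negP: ci.
  rewrite ffunE mpolyXn mcoeff_eq0; apply/negP => /msuppM_le/allpairsP[[m1 m2] /= [_]].
  rewrite msuppX inE => /eqP -> me; move: mi; rewrite me mnmDE mulmnE mnm1E eqxx mul1n.
  by rewrite ltnNge leq_addl.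
rewrite (mpolyE f); apply: (big_ind (seqideal xpow j)) => [|x y hx hy|m _].
- exact: seqideal0.
- by rewrite -[x]mul1r; apply: seqidealL.
have [->|fm] := eqVneq f@_m 0; first by rewrite scale0r; apply: seqideal0.
have [i /andP[ij Nm]] := h m fm.
have -> : f@_m *: 'X_[m] = (f@_m *: 'X_[m - U_(i) *+ N i]) * xpow i.
  rewrite ffunE mpolyXn -scalerAl -mpolyXD submK //.
  apply/mnm_lepP => x; rewrite mulmnE mnm1E.
  by have [<-|_] := eqVneq i x; rewrite ?mul1n ?mul0n.
exists (fun x => if x == i then f@_m *: 'X_[m - U_(i) *+ N i] else 0).
rewrite (bigD1 i) //= eqxx big1 ?addr0 // => x /andP[_ /negPf ->].
by rewrite mul0r.
Qed.

Lemma xpow_regular : regular_seq xpow.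
Proof.
move=> j x /seqideal_xpow h; apply/seqideal_xpow => m xm.
have [|i /andP[ij]] := h (U_(j) *+ N j + m)%MM.
  by rewrite ffunE mpolyXn mulrC mcoeffMX.
rewrite mnmDE mulmnE mnm1E -val_eqE /= gtn_eqF // mul0n add0n => Nm.
by exists i; rewrite ij.
Qed.

Variables (n : nat) (pi : {rmorphism {mpoly K[n]} -> S'}) (al : {mpoly K[n]}).
Local Notation S := {mpoly K[n]}.
Hypothesis hs : hyperplane_section pi al.
Variable h : vec k S.
Hypothesis hh : forall j, hmg (N j) (h j).
Hypothesis pih : forall j, pi (h j) = 'X_j ^+ N j.

Lemma pih_xpow j : pi (h j) = xpow j. Proof. by rewrite pih ffunE. Qed.

Lemma seqideal_pi j x : seqideal h j x -> seqideal xpow j (pi x).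
Proof.
move=> [c ->]; exists (fun i => pi (c i)); rewrite rmorph_sum.
by apply: eq_bigr => i _; rewrite rmorphM pih_xpow.
Qed.

Lemma seqideal_lift j x : seqideal xpow j (pi x) ->
  exists i u, seqideal h j i /\ x = i + al * u.
Proof.
move=> [c cE]; have /choice[d dE] := fun i => hs_surj hs (c i).
pose i := \sum_(i < k | (i < j)%N) d i * h i.
have /(hs_ker hs)[u uE] : pi (x - i) = 0.
  rewrite rmorphB cE rmorph_sum /=; apply/eqP; rewrite subr_eq0; apply/eqP.
  by apply: eq_bigr => t _; rewrite rmorphM /= dE pih_xpow.
by exists i, u; split; [exists d | rewrite -uE addrC subrK].
Qed.

Lemma seqideal_hc j d x : seqideal h j x -> seqideal h j (hc d x).
Proof.
move=> [c ->]; rewrite linear_sum.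
apply: (big_ind (seqideal h j)) => [|y z hy hz|i ij].
- exact: seqideal0.
- by rewrite -[y]mul1r; apply: seqidealL.
rewrite mulrC [X in seqideal _ _ X](hc_mul d (c i) (hh i)); case: ifP => _; last exact: seqideal0.
exists (fun t => if t == i then hc (d - N i) (c i) else 0).
rewrite (bigD1 i) //= eqxx big1 ?addr0 1?mulrC // => t /andP[_ /negPf ->].
by rewrite mul0r.
Qed.

Lemma al_exp_ord m : ordge m (al ^+ m).
Proof. by apply/homog_ordge/homogX; have [] := hs. Qed.

(** A homogeneous ideal is closed in the [al]-adic topology: the component of degree [d] does not
    see multiples of [al ^+ d.+1]. *)
Lemma seqideal_closed j x :
  (forall m, exists i u, seqideal h j i /\ x = i + al ^+ m * u) -> seqideal h j x.
Proof.
move=> hx; have hd d : seqideal h j (hc d x).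
  have [i [u [hi ->]]] := hx d.+1; rewrite linearD /=.
  have -> : pihomog mdeg d (al ^+ d.+1 * u) = 0.
    have u0 : ordge 0 u by move=> e; rewrite ltn0.
    have := ordge_mul (al_exp_ord (m := d.+1)) u0.
    by rewrite addn0 => /(_ d (ltnSn d)).
  by rewrite addr0; apply: seqideal_hc.
have [M hM] := hc_sum x; rewrite (hM M) //.
apply: (big_ind (seqideal h j)) => [|y z hy hz|i _]; last exact: hd.
- exact: seqideal0.
- by rewrite -[y]mul1r; apply: seqidealL.
Qed.

(* The sequence al, h_0, ..., h_(k-1) is regular and homogeneous, so al can be
   moved past each h_j. *)
Lemma seq_regular : regular_seq h.
Proof.
have al_reg j : (j <= k)%N -> forall u, seqideal h j (al * u) -> seqideal h j u.
  elim: j => [|j IH] jk u.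
    have i0 x : seqideal h 0 x <-> x = 0.
      by split=> [[c ->]|->]; [rewrite big_pred0 | exact: seqideal0].
    move/i0/eqP; rewrite mulf_eq0; have [_ _ /negPf -> _ _] := hs.
    by move=> /eqP ->; apply: seqideal0.
  move/(seqidealS h (Ordinal jk)) => [w wE].
  have := seqideal_pi wE; rewrite rmorphB !rmorphM /= (hs_al hs) mul0r sub0r.
  rewrite -mulN1r pih_xpow => /(seqidealL (-1)) /(_ (seqideal0 _ _)).
  rewrite addr0 mulrA mulrNN mulr1 mul1r => /(xpow_regular (j := Ordinal jk)).
  move=> /seqideal_lift[i [w' [hi wE']]].
  apply/(seqidealS h (Ordinal jk)); exists w'; apply: (IH (ltnW jk)).
  have -> : al * (u - h (Ordinal jk) * w') =
      h (Ordinal jk) * i + (al * u - h (Ordinal jk) * w) by rewrite wE'; ring.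
  exact: seqidealL.
move=> j u hu; apply: seqideal_closed => m.
suff [i [u' [hi [uE _]]]] : exists i u', seqideal h j i /\ (u = i + al ^+ m * u' /\ seqideal h j (h j * u')).
  by exists i, u'.
elim: m => [|m [i [u' [hi [uE hu']]]]].
  by exists 0, u; split; [exact: seqideal0 | rewrite mul1r add0r].
have := seqideal_pi hu'; rewrite rmorphM /= pih_xpow => /xpow_regular/seqideal_lift.
move=> [i' [u2 [hi' u'E]]]; exists (al ^+ m * i' + i), u2; split; first exact: seqidealL.
split; first by rewrite uE u'E exprSr; ring.
apply: (al_reg j (ltnW (ltn_ord j))).
have -> : al * (h j * u2) = - h j * i' + h j * u' by rewrite u'E; ring.
exact: seqidealL.
Qed.

End RegularSequences.

(** * The ideal of the flats other than the origin *)

Section Flats.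
Variables (K : fieldType) (l : nat).
Local Notation S := {mpoly K[l]}.

(** The forms in [s] embed the space into coordinates, and composing [b] with a left inverse of the
    embedding gives the coefficients. *)
Lemma span_forms (s : seq 'Hom('rV[K]_l, K^o)) (b : 'Hom('rV[K]_l, K^o)) :
  (forall x, (forall f, f \in s -> f x = 0) -> x = 0) ->
  exists c : 'I_(size s) -> K, linpoly b = \sum_i c i *: linpoly s`_i.
Proof.
move=> hs; have lF : linear (fun x => \row_i (s`_i x : K) : 'rV[K]_(size s)).
  by move=> a x y; apply/rowP => i; rewrite !mxE linearP.
pose F := linfun (mklin lF).
have F0 : lker F == 0%VS.
  apply/lker0P; apply: lin_inj => x Fx0; have : F x = 0 := Fx0.
  rewrite /F lfunE /= => /rowP Fx.
  apply: hs => f /(nthP 0)[i ls <-]; have := Fx (Ordinal ls).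
  by rewrite !mxE.
exists (fun i => b (F^-1%VF (delta_mx 0 i))).
have bE : b = \sum_i (b (F^-1%VF (delta_mx 0 i)) : K) *: s`_i.
  apply/lfunP => x; rewrite -{1}[x](lker0_lfunK F0) [F x]lfunE /=.
  rewrite -[LHS]comp_lfunE [LHS]lform_expand sum_lfunE; apply: eq_bigr => i _.
  rewrite comp_lfunE mxE scale_lfunE.
  by rewrite -[_ *: _]/(_ * _) -[RHS]/(_ * _) mulrC.
rewrite {1}bE; apply: (big_ind2 (fun x y => linpoly x = y)) => [|x1 x2 y1 y2 <- <-|i _].
- by rewrite /linpoly big1 // => i _; rewrite zero_lfunE scale0r.
- exact: linpolyD.
- exact: linpolyZ.
Qed.

Variables (A : {fset {vspace 'rV[K]_l}}) (arrA : arrangement A) (H : {vspace 'rV[K]_l}).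
Hypothesis HA : H \in A.

Definition offprod (x : 'rV[K]_l) : S := \prod_(L <- A | x \notin L) alpha L.

Definition flat_ideal (T : submodule (S^o)) :=
  forall x, x \in H -> x != 0 -> exists a, T (offprod x ^+ a).

Definition addI (T : submodule (S^o)) (a : S) : submodule (S^o).
Proof.
refine (@Submodule S (S^o) (fun t : S => exists b : S, T (t - b * a)) _ _).
  by exists 0; rewrite mul0r subr0; apply: sm0.
move=> c x y [b hb] [d hd]; exists (c * b + d).
rewrite (_ : _ - _ = c *: (x - b * a : S^o) + (y - d * a)); first exact: smL.
by rewrite -[c *: (_ : S^o)]/(c * _) -[c *: (_ : S^o)]/(c * _); ring.
Defined.

Lemma addI_sub (T : submodule (S^o)) a t : T t -> addI T a t.
Proof. by move=> Tt; exists 0; rewrite mul0r subr0. Qed.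

Lemma smM (T : submodule (S^o)) (a t : S) : T t -> T (a * t).
Proof. exact: (@smZ _ (S^o) T a t). Qed.

(* Otherwise choose x in the intersection of the hyperplanes whose forms lie in
   T: some power of y lies in T + (alpha L) for each L not containing x, and
   the product of these relations lies in T. *)
Lemma flat_ideal_power (T : submodule (S^o)) (b : 'Hom('rV[K]_l, K^o)) :
  T (alpha H) -> flat_ideal T -> exists N, T (linpoly b ^+ N).
Proof.
pose out (T : submodule (S^o)) := [fset L in A | ~~ `[< T (alpha L) >]]%fset.
have [n] := ubnP #|` out T|; elim: n T => // n IH T cT TH fT.
set y := linpoly b.
have [[x [x0 hx]]|nx] := pselect (exists x, x != 0 /\ forall L, L \in A -> T (alpha L) -> x \in L); last first.
  (* If only the origin lies on all hyperplanes whose forms belong to [T], these forms span and the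
     exponent 1 works. *)
  have [|c yE] := @span_forms [seq defform L | L <- [fset L in A | `[< T (alpha L) >]]%fset] b.
    move=> x hx; apply: contrapT => /eqP x0; apply: nx; exists x; split=> // L LA TL.
    rewrite -(lker_defform (arrA LA)) memv_ker; apply/eqP; apply: hx.
    by apply: map_f; rewrite !inE LA /=; apply/asboolP.
  exists 1%N; rewrite expr1 /y yE; apply: sm_sum => i _; rewrite -mul_mpolyC.
  apply: smM; have : (i < size [fset L in A | `[< T (alpha L) >]]%fset)%N.
    by rewrite -(size_map (@defform K l)).
  move=> il; rewrite (nth_map 0%VS) //.
  by have := mem_nth 0%VS il; rewrite !inE => /andP[_ /asboolP].
have xH : x \in H by apply: hx.
have [a Ta] := fT x xH x0.
pose P (q : S) := exists N c, T (y ^+ N - c * q).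
have P1 : P 1 by exists 0%N, 1; rewrite mulr1 subrr; apply: sm0.
have PM q q' : P q -> P q' -> P (q * q').
  move=> [N [c h]] [N' [c' h']]; exists (N + N')%N, (c * c').
  have -> : y ^+ (N + N') - c * c' * (q * q') =
      y ^+ N' * (y ^+ N - c * q) + c * q * (y ^+ N' - c' * q') by rewrite exprD; ring.
  by apply: smD; apply: smM.
have PL L : L \in A -> x \notin L -> P (alpha L).
  move=> LA xL; have nTL : ~ T (alpha L) by move=> /(hx L LA); rewrite (negPf xL).
  have [|||N [c hc]] := IH (addI T (alpha L)).
  (* Enlarging [T] by [alpha L] strictly decreases the number of hyperplanes whose forms lie
     outside. *)
  - rewrite ltnS in cT; apply: leq_trans _ cT.
    apply: fproper_ltn_card; rewrite fproperE; apply/andP; split.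
      apply/fsubsetP => L'; rewrite !inE => /andP[-> /asboolPn nT'].
      by apply/asboolPn => T'; apply: nT'; apply: addI_sub.
    apply/fsubsetPn; exists L; rewrite !inE LA /=; first exact/asboolPn.
    rewrite negbK; apply/asboolP; exists 1; rewrite mul1r subrr; exact: sm0.
  - exact: addI_sub.
  - by move=> z zH z0; have [e Te] := fT z zH z0; exists e; apply: addI_sub.
  by exists N, c.
have Pf : P (offprod x).
  rewrite /offprod big_seq_cond; apply: (big_ind P) => // L /andP[LA xL].
  exact: PL.
have [N [c hc]] : P (offprod x ^+ a).
  by elim: (a) => [|e IHe]; rewrite ?expr0 // exprS; apply: PM.
exists N; rewrite -[y ^+ N](subrK (c * offprod x ^+ a)); apply: smD => //.
exact: smM.
Qed.

(* The ideal generated by the p-th powers of the products [offprod x]. *)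
Definition flatI (p : nat) : submodule (S^o).
Proof.
refine (@Submodule S (S^o) (fun t : S => forall T : submodule (S^o),
  (forall x, x \in H -> x != 0 -> T (offprod x ^+ p)) -> T t) _ _).
  by move=> T _; apply: sm0.
by move=> a x y hx hy T hT; apply: smL; [apply: hx | apply: hy].
Defined.

Lemma homog_prod_alpha (s : seq {vspace 'rV[K]_l}) (P : pred {vspace 'rV[K]_l}) :
  exists d, hmg d (\prod_(L <- s | P L) (alpha L : S)).
Proof.
apply: (big_ind (fun q : S => exists d, hmg d q)) => [|q q' [d hd] [d' hd']|L _].
- by exists 0%N; apply: dhomog1.
- by exists (d + d')%N; apply: homogM.
- by exists 1%N; apply: homog_alpha.
Qed.

(** The ideal is the intersection of all ideals containing its generators, so it suffices that the
    polynomials with all components in it form one such ideal. *)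
Lemma flatI_hc p d t : flatI p t -> flatI p (hc d t).
Proof.
move=> ht.
have T0 : forall d, flatI p (hc d (0 : S)) by move=> e; rewrite linear0; exact: sm0.
have TL (a x y : S) : (forall d, flatI p (hc d x)) -> (forall d, flatI p (hc d y)) ->
    forall d, flatI p (hc d (a *: (x : S^o) + y)).
  move=> hx hy e; rewrite linearD /=; apply: (@smD _ _ (flatI p)); last exact: hy.
  have [N hN] := hc_sum a; rewrite -[_ *: _]/(a * x) [X in pihomog _ _ (X * _)](hN N) //.
  rewrite mulr_suml linear_sum; apply: (@sm_sum _ _ (flatI p)) => i _.
  rewrite [X in _ X](hc_mul e x (hc_homog i a)); case: ifP => _; last exact: sm0.
  by apply: smM; apply: hx.
pose T : submodule (S^o) := @Submodule S (S^o) (fun t : S => forall d, flatI p (hc d t)) T0 TL.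
apply: (ht T) => x xH x0 e.
have [f hf] : exists f, hmg f (offprod x ^+ p).
  by have [f hf] := homog_prod_alpha (enum_fset A) (fun L => x \notin L); exists (f * p)%N; apply: dhomogMn.
rewrite [X in _ X](hc_id e hf); case: ifP => _; last exact: sm0.
by move=> T' hT'; apply: hT'.
Qed.

Variables (k : nat) (phi : 'Hom('rV[K]_k, 'rV[K]_l)).
Hypotheses (phi0 : lker phi = 0%VS) (phiH : limg phi = H).

Lemma lift_var (j : 'I_k) : exists b, pullback phi (linpoly b) = 'X_j.
Proof.
have [c _ <-] := coord_form K j; exists (c \o phi^-1)%VF; rewrite pullback_linpoly.
by congr linpoly; apply/lfunP => x; rewrite !comp_lfunE lker0_lfunK //; apply/eqP.
Qed.

(** Once [alpha H] is added to the ideal, [flat_ideal_power] applies to a linear form restricting to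
    x_j. Its power minus a multiple of [alpha H] lies in the ideal, and the component of degree [N]
    is homogeneous with the same restriction. *)
Lemma flat_sequence p : exists (N : 'I_k -> nat) (h : vec k S),
  [/\ forall j, flatI p (h j), forall j, hmg (N j) (h j)
    & forall j, pullback phi (h j) = 'X_j ^+ N j].
Proof.
suff H1 j : exists N h, [/\ flatI p h, hmg N h & pullback phi h = 'X_j ^+ N].
  have /choice[N /choice[h hh]] := H1; exists N, [ffun j => h j].
  by split=> j; rewrite ffunE; have [] := hh j.
have [b bE] := lift_var j.
have fT : flat_ideal (addI (flatI p) (alpha H)).
  move=> x xH x0; exists p; apply: addI_sub => T; exact.
have TH : addI (flatI p) (alpha H) (alpha H).
  by exists 1; rewrite mul1r subrr; apply: sm0.
have [N [c Jc]] := flat_ideal_power b TH fT.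
exists N, (hc N (linpoly b ^+ N - c * alpha H)); split.
- exact: flatI_hc.
- exact: hc_homog.
- rewrite -hc_pullback rmorphB rmorphXn rmorphM /= bE.
  rewrite (_ : pullback phi (alpha H) = 0); last first.
    by apply/(pullback_eq0 _ phiH (arrA HA)); exists 1; rewrite mulr1.
  have hX : hmg N ('X_j ^+ N : {mpoly K[k]}).
    by apply: homogX; rewrite /hmg dhomogX /= mdeg1.
  by rewrite mulr0 subr0 [LHS](hc_id N hX) eqxx.
Qed.

End Flats.

(** * Logarithmic forms along a hyperplane of the arrangement *)

Definition iso (R : nzRingType) (M N : lmodType R) : Prop :=
  exists f : {linear M -> N}, injective f /\ forall y, exists x, f x = y.

Section Iso.
Variable R : nzRingType.
Implicit Types M N P Q : lmodType R.

Lemma iso_sym M N : iso M N -> iso N M.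
Proof.
move=> [f [fi fs]]; have [g [fg gf]] := bij_inv_lin fi fs.
by exists g; split=> [|y]; [exact: can_inj gf | exists (f y)].
Qed.

Lemma iso_trans N M P : iso M N -> iso N P -> iso M P.
Proof.
move=> [f [fi fs]] [g [gi gs]].
have l : linear (fun x => g (f x)) by move=> a x y; rewrite !linearP.
exists (mklin l); split=> [x y /gi/fi //|y].
by have [z <-] := gs y; have [x <-] := fs z; exists x.
Qed.

Lemma iso_prod M N P Q : iso M N -> iso P Q -> iso (M * P)%type (N * Q)%type.
Proof.
move=> [f [fi fs]] [g [gi gs]].
have l : linear (fun x : M * P => (f x.1, g x.2)).
  by move=> a x y; apply: pair_ext; rewrite /= linearP.
exists (mklin l); split=> [x y [] /fi e1 /gi e2|[y1 y2]]; first exact: pair_ext.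
by have [x1 <-] := fs y1; have [x2 <-] := gs y2; exists (x1, x2).
Qed.

Lemma iso_sub (V : lmodType R) (U U' : submodule V) :
  (forall v, U v <-> U' v) -> iso (subT U) (subT U').
Proof. exact: sub_iso. Qed.

Lemma iso_res cls n M N : iso M N -> res cls n M -> res cls n N.
Proof. by move=> [f [fi fs]]; apply: res_iso fi fs. Qed.

Lemma iso_proj M N : iso M N -> projective M -> projective N.
Proof.
by move=> i /res_projP p; apply/res_projP; apply: iso_res i p.
Qed.

Lemma proj_fst M N : projective (M * N)%type -> projective M.
Proof.
have l1 : linear (fun x : M => (x, 0) : M * N).
  by move=> a x y; apply: pair_ext; rewrite /= ?scaler0 ?addr0.
have l2 : linear (fun x : M * N => x.1) by [].
by apply: (@proj_retract _ _ _ (mklin l1) (mklin l2)).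
Qed.

End Iso.

Lemma logs_eq (R : idomainType) k (T : eqType) (s s' : seq T) (c c' : T -> vec k R) a a' p w :
  s =i s' -> (forall t, t \in s -> c t = c' t /\ a t = a' t) ->
  logs s c a p w <-> logs s' c' a' p w.
Proof.
move=> ss h; split=> -[pw hw]; split=> // t ts.
  by have [<- <-] := h t (etrans (ss t) ts); apply: hw; rewrite ss.
by have [-> ->] := h t ts; apply: hw; rewrite -ss.
Qed.

Lemma finfree_pform (R : comNzRingType) n p (U : submodule (forms n R)) :
  (forall w, U w <-> pform p w) -> finfree (subT U).
Proof.
move=> hU; pose J := {K : {set 'I_n} | #|K| == p}.
pose F (v : {ffun J -> R^o}) : forms n R := [ffun K => if insub K is Some t then v t else 0].
have lF : linear F.
  move=> a x y; apply/ffunP => K; rewrite !ffunE.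
  by case: insubP => [t _ _|_]; rewrite ?ffunE ?scaler0 ?addr0.
have hF v : U (F v).
  by apply/hU => K pK; rewrite ffunE insubN.
apply: (@finfree_iso _ _ _ (@corestr _ _ _ U (mklin lF) hF)); last exact: (finfree_ffun R J).
  move=> x y /(congr1 (inc U)) /ffunP e; apply/ffunP => t.
  by have := e (val t); rewrite !ffunE valK.
move=> y; exists [ffun t : J => inc U y (val t)]; apply: inc_inj.
apply/ffunP => K; rewrite -[LHS]/(F _ K) ffunE.
case: insubP => [t _ <-|pK]; first by rewrite ffunE.
by have /hU -> := incP y.
Qed.

Section GradedLogs.
Variables (K : fieldType) (l k : nat).
Local Notation S := {mpoly K[l]}.

Lemma hc_const d (x : K) (f : S) : hc d (x%:MP * f) = x%:MP * hc d f.
Proof. by rewrite !mul_mpolyC linearZ. Qed.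

Lemma ew_kvec_wc (f : 'Hom('rV[K]_k, K^o)) d (w : forms k S) :
  ew (kvec l f) (wc (fun=> 0%N) d w) = wc (fun=> 0%N) d (ew (kvec l f) w).
Proof.
have sgnC i (I : {set 'I_k}) : sgn S i I = ((-1) ^+ below i I)%:MP.
  by rewrite /sgn rmorphXn rmorphN1.
rewrite /ew wc_sum_lin; apply: eq_bigr => i _; apply/ffunP => I.
rewrite !ffunE /hcs leq0n subn0.
case: ifP => _; last by rewrite !scaler0 linear0.
by rewrite sgnC -![_ *: _]/(_ * _) !hc_const.
Qed.

Lemma logs_graded (T : eqType) (s : seq T) (f : T -> 'Hom('rV[K]_k, K^o))
    (a : T -> S) p : (forall t, t \in s -> exists e, hmg e (a t)) ->
  graded (fun=> 0%N) (logs s (fun t => kvec l (f t)) a p).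
Proof.
move=> ha d w [pw hw]; split=> [I pI|t ts].
  by rewrite ffunE pw // /hcs leq0n linear0.
have [x xE] := hw t ts; have [e he] := ha t ts.
rewrite ew_kvec_wc xE; exists [ffun I => hcs d e (x I)]; apply/ffunP => I.
by rewrite !ffunE; exact: (hcs_mul _ _ _ he).
Qed.

End GradedLogs.

Section LogArrangement.
Variables (K : fieldType) (k l : nat) (phi : 'Hom('rV[K]_k, 'rV[K]_l)).
Variable H : {vspace 'rV[K]_l}.
Hypotheses (phi0 : lker phi = 0%VS) (phiH : limg phi = H) (dH : (\dim H).+1 = l).
Local Notation S := {mpoly K[l]}.

Definition cL (L : {vspace 'rV[K]_l}) : vec k S := kvec l (defform L \o phi)%VF.

Definition Mlog (B : {fset {vspace 'rV[K]_l}}) (p : nat) : submodule (forms k S) :=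
  logs (enum_fset (B `\ H)%fset) cL (@alpha K l) p.

Lemma defform_phi_neq0 L : (\dim L).+1 = l -> L != H -> (defform L \o phi)%VF != 0.
Proof.
move=> dL LH; apply: contra LH => /eqP h; rewrite eq_sym eqEdim.
rewrite -ltnS dL dH leqnn andbT -(lker_defform dL) -phiH.
apply/subvP => _ /memv_imgP[v _ ->]; rewrite memv_ker -comp_lfunE h.
by rewrite zero_lfunE.
Qed.

Section Fixed.
Variables (B : {fset {vspace 'rV[K]_l}}) (arrB : arrangement B).

Lemma in_BH L : L \in enum_fset (B `\ H)%fset -> L != H /\ (\dim L).+1 = l.
Proof. by rewrite !inE => /andP[LH LB]; split=> //; apply: arrB. Qed.

Lemma Mlog_cop t t' : t \in enum_fset (B `\ H)%fset -> t' \in enum_fset (B `\ H)%fset ->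
  t != t' -> dreg (alpha t) (alpha t').
Proof. by move=> /in_BH[_ d] /in_BH[_ d']; apply: dreg_alpha. Qed.

Lemma Mlog_unit t : t \in enum_fset (B `\ H)%fset -> exists v, dot (cL t) v = 1.
Proof. by move=> /in_BH[tH d]; apply: kvec_unit; apply: defform_phi_neq0. Qed.

Lemma Mlog_neq0 t : t \in enum_fset (B `\ H)%fset -> alpha t != 0.
Proof. by move=> /in_BH[_ d]; apply: alpha_neq0. Qed.

Lemma Mlog_reg t : t \in enum_fset (B `\ H)%fset -> dreg (alpha t) (alpha H).
Proof. by move=> /in_BH[tH d]; apply: dreg_alpha. Qed.

Lemma split_omega p : H \in B ->
  iso (subT (Mlog B p.+1) * subT (Mlog B p))%type (subT (alogs B mult1 p.+1)).
Proof.
move=> HB; pose f := defform H.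
have [v0 fv] := lform_unit (defform_neq0 dH).
have lpr : linear (fun w : 'rV[K]_l => w - (f w : K) *: v0).
  by move=> a x y; rewrite linearP scalerDl -scalerA scalerBr opprD addrACA.
(* [be] projects onto [H] along [v0] and reads the result through [phi]. Pulling forms back along
   [phi] and along [be] gives [Phi] and [Psi]. *)
pose be : 'Hom('rV[K]_l, 'rV[K]_k) := (phi^-1 \o linfun (mklin lpr))%VF.
have phi0' : lker phi == 0%VS by apply/eqP.
have fphi y : f (phi y) = 0.
  by apply/eqP; rewrite -memv_ker lker_defform // -phiH memv_img ?memvf.
have be_phi y : be (phi y) = y.
  by rewrite comp_lfunE lfunE /= fphi scale0r subr0 lker0_lfunK.
have phi_be w : phi (be w) = w - (f w : K) *: v0.
  rewrite comp_lfunE lfunE /= limg_lfunVK // phiH -(lker_defform dH) memv_ker.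
  rewrite linearB linearZ /= [X in _ *: X]fv subr_eq0 -[_ *: _]/(_ * _).
  by rewrite mulr1.
have be_v : be v0 = 0 by rewrite comp_lfunE lfunE /= [f v0]fv scale1r subrr linear0.
move: be be_phi phi_be be_v => be be_phi phi_be be_v.
have /choice[cf cfE] : forall j : 'I_k, exists c : 'Hom('rV[K]_k, K^o), forall x, c x = x 0 j.
  by move=> j; have [c] := coord_form K j; exists c.
pose Phi (i : 'I_l) : vec k S := [ffun j => (phi (delta_mx 0 j) 0 i)%:MP].
pose Psi (j : 'I_k) : vec l S := kvec l (cf j \o be)%VF.
have PhiE (g : 'Hom('rV[K]_l, K^o)) : lincomb Phi (kvec l g) = kvec l (g \o phi)%VF.
  apply/ffunP => j; rewrite sum_ffunE ffunE comp_lfunE lform_expand raddf_sum.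
  apply: eq_bigr => i _; rewrite !ffunE -[_ *: _]/(_ * _) -mpolyCM.
  by rewrite mulrC.
have [||||||||F hF] := @split_logs S l k _ H (enum_fset (B `\ H)%fset)
  (fun L => kvec l (defform L)) (@alpha K l) (xvec K l) (constv l v0) Phi Psi
  _ _ _ _ _ _ _ _ p.
- by move=> t; rewrite dot_kvec.
- by rewrite dot_constv fv mpolyC1.
- rewrite PhiE; apply/ffunP => j; rewrite !ffunE comp_lfunE fphi mpolyC0 //.
- move=> j; rewrite PhiE; apply/ffunP => i; rewrite !ffunE !comp_lfunE be_phi cfE.
  by rewrite mxE eqxx /= eq_sym; case: eqP.
- move=> i; apply/ffunP => i'; rewrite sum_ffunE !ffunE.
  transitivity (((phi (be (delta_mx 0 i'))) 0 i)%:MP : S).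
    rewrite lfun_expand summxE raddf_sum; apply: eq_bigr => j _.
    by rewrite mxE !ffunE comp_lfunE cfE -[LHS]/(_ * _) -mpolyCM mulrC.
  rewrite phi_be !mxE eqxx /= mpolyCB mpolyCM -[_ *: _]/(_ * _) [(_ %:MP) * _]mulrC.
  by congr (_ - _); rewrite eq_sym; case: eqP.
- by move=> j; rewrite dot_constv comp_lfunE be_v linear0 mpolyC0.
- exact: Mlog_reg.
- exact: alpha_neq0.
have i1 q : iso (subT (Mlog B q)) (subT (logs (enum_fset (B `\ H)%fset)
    (fun L => lincomb Phi (kvec l (defform L))) (@alpha K l) q)).
  by apply: iso_sub => w; apply: logs_eq => t // _; split=> //; exact: esym (PhiE _).
have i2 : iso (subT (logs (H :: enum_fset (B `\ H)%fset) (fun L => kvec l (defform L))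
    (@alpha K l) p.+1)) (subT (alogs B mult1 p.+1)).
  apply: iso_sub => w; apply: logs_eq => [L|L _]; last by rewrite expr1.
  by rewrite !inE; case: eqP => // ->.
have i0 : iso _ _ := ex_intro _ F hF.
have y := iso_trans (iso_prod (i1 p.+1) (i1 p)) (iso_trans i0 i2).
exact y.
Qed.

Lemma Mlog_graded p : graded (fun=> 0%N) (Mlog B p).
Proof.
by apply: (@logs_graded K l k _ _ (fun L => defform L \o phi)%VF) => L _; exists 1%N; exact: homog_alpha.
Qed.

Lemma Mlog_saturated p : saturated (alpha H) (Mlog B p).
Proof.
move=> w [pw hw]; split=> [I pI|L LB].
  have := pw I pI; rewrite ffunE => /eqP; rewrite [_ == _]mulf_eq0.
  by rewrite (negPf (alpha_neq0 dH)) => /eqP.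
by apply: (dregf (Mlog_reg LB)); have := hw L LB; rewrite linearZ.
Qed.

End Fixed.
End LogArrangement.

(** * Logarithmic forms as exterior powers of logarithmic 1-forms *)

Lemma linZ (R : nzRingType) (U V : lmodType R) (f : {linear U -> V}) x u :
  f (x *: u) = x *: f u.
Proof. exact: linearZ_LR. Qed.

Lemma fres1_basis (R : nzRingType) (V : lmodType R) (U : submodule V) :
  fres 1 (subT U) -> exists m (Z : 'I_m -> V),
    (forall u, lincomb Z u = 0 -> u = 0) /\
    (forall v, U v <-> exists u, v = lincomb Z u).
Proof.
move=> [X [P [i [q [[m [f [fi fs]]] [ii qs iq] X0]]]]].
have qi : injective q.
  by apply: lin_inj => x /iq[y <-]; rewrite (X0 y) linear0.
have lg : linear (fun u => inc U (q (f u))) by move=> a x y; rewrite !linearP.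
exists m, (fun j => inc U (q (f (unitv R j)))).
have gE u : lincomb (fun j => inc U (q (f (unitv R j)))) u = inc U (q (f u)).
  exact: esym (linear_lincomb (mklin lg) u).
split=> [u|v]; first by rewrite gE => e; apply/fi/qi/inc_inj; rewrite e !linear0.
split=> [Uv|[u ->]]; last by rewrite gE; exact: incP.
have [x xE] := qs (toS Uv); have [u uE] := fs x.
by exists u; rewrite gE uE xE.
Qed.

Section VecOfForm.
Variables (R : comNzRingType) (k : nat).

Definition vec1 (w : forms k R) : vec k R := [ffun j => w [set j]].

Lemma vec1_lin : linear vec1.
Proof. by move=> x y z; apply/ffunP => j; rewrite !ffunE. Qed.
HB.instance Definition _ := GRing.isLinear.Build R _ _ _ vec1 vec1_lin.

Lemma vec1K g : vec1 (ew g (one R k)) = g.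
Proof. by apply/ffunP => i; rewrite ffunE ew_set1 ffunE eqxx [_ *: _]mulr1. Qed.

Lemma ew_vec1 w : pform 1 w -> w = ew (vec1 w) (one R k).
Proof.
move=> pw; apply/ffunP => I; have [/cards1P[i ->]|cI] := boolP (#|I| == 1%N).
  by rewrite ew_set1 !ffunE eqxx [_ *: _]mulr1.
by rewrite pw // (pform_ew (vec1 w) (pform_one R (n := k)) cI).
Qed.

Lemma hproj_ew p u (w : forms k R) : hproj p.+1 (ew u w) = ew u (hproj p w).
Proof.
apply/ffunP => I; rewrite ffunE; have [cI|cI] := boolP (#|I| == p.+1).
  rewrite /ew !sum_ffunE; apply: eq_bigr => i _; rewrite !ffunE.
  by case: ifP => // iI; move: cI; rewrite (cardsD1 i I) iI eqSS => ->.
rewrite (pform_ew u _ cI) // => L pL.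
by rewrite ffunE (negPf pL).
Qed.

Lemma pform_hproj p (w : forms k R) : pform p (hproj p w).
Proof. by move=> I cI; rewrite ffunE (negPf cI). Qed.

Lemma hproj_id p (w : forms k R) : pform p w -> hproj p w = w.
Proof. by move=> pw; apply/ffunP => I; rewrite ffunE; case: ifP => // /negbT/pw. Qed.

Lemma ext_scaleT b (T : 'I_k -> vec b R) (f : R) p (w : forms k R) : pform p w ->
  ext (fun i => f *: T i) w = f ^+ p *: ext T w.
Proof.
move=> pw; transitivity (ext T (ext (fun i => f *: unitv R i) w)).
  by rewrite ext_comp; apply: eq_ext => i; rewrite [RHS]linearZ lincomb_unitv.
by rewrite (ext_scale f pw) linearZ.
Qed.

End VecOfForm.

Section Pforms.
Variable R : comNzRingType.

Definition pforms (n p : nat) : submodule (forms n R).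
Proof. by exists (@pform n R^o p) => [|x y z]; [exact: pform0 | exact: pformL]. Defined.

Lemma pforms_finfree (n p : nat) : finfree (subT (pforms n p)).
Proof. by apply: (@finfree_pform _ _ p). Qed.

End Pforms.

Section ExteriorPowers.
Variables (R : idomainType) (k : nat) (T : eqType) (s : seq T).
Variables (c : T -> vec k R) (a : T -> R).
Hypothesis us : uniq s.
Hypothesis cop : forall t t', t \in s -> t' \in s -> t != t' -> dreg (a t) (a t').
Hypothesis cunit : forall t, t \in s -> exists v, dot (c t) v = 1.
Hypothesis a0 : forall t, t \in s -> a t != 0.
Local Notation D := (\prod_(t <- s) a t).
Local Notation M := (logs s c a).

Variables (b : nat) (E : 'I_b -> forms k R).
Hypothesis gE : gens (M 1) E.
Local Notation G := (fun i => vec1 (E i)).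

(** After inverting [f], the cover of [M 1] by the generators splits; stated this way, no localised
    ring is involved. *)
Definition factors_free (f : R) := exists sg : {linear subT (M 1) -> vec b R},
  forall w, lincomb E (sg w) = f *: inc (M 1) w.

(** Multiplication by [f] from [P] to [M 1] lifts to the cover because [P] is projective; [sg] is
    the restriction of this lift to [M 1]. *)
Lemma factors_free_proj (P : submodule (forms k R)) f : projective (subT P) ->
  (forall w, M 1 w -> P w) -> (forall w, P w -> M 1 (f *: w)) -> factors_free f.
Proof.
move=> pP MP PM; have [q [qE [_ qs _]]] := ses_gens gE.
have mP (w : subT P) : M 1 (f *: inc _ w) by apply/PM/incP.
have lm : linear (fun w => toS (mP w)).
  move=> x u v; apply: inc_inj; rewrite [RHS]linearP !toSK.
  by rewrite [inc _ (x *: u + v)]linearP scalerDr !scalerA mulrC.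
have [h hE] := pP _ _ q (mklin lm) qs.
have iP (w : subT (M 1)) : P (inc _ w) by apply/MP/incP.
have li : linear (fun w => h (corestr iP w)).
  by move=> x u v; rewrite (linearP (corestr iP)) (linearP h).
by exists (mklin li) => w; rewrite -qE [q _]hE.
Qed.

Lemma D_neq0 : D != 0. Proof. exact: logs_prod_neq0. Qed.

Lemma M1_vec w : M 1 w -> w = ew (vec1 w) (one R k).
Proof. by move=> [pw _]; apply: ew_vec1. Qed.

Lemma lincomb_G u : vec1 (lincomb E u) = lincomb G u.
Proof. by rewrite [LHS]linear_sum; apply: eq_bigr => i _; rewrite linZ /=. Qed.

Lemma M1_gen i : M 1 (ew (G i) (one R k)).
Proof. by rewrite -M1_vec; have [] := gE. Qed.

Lemma M1_top (j : 'I_k) : M 1 (D *: ew (unitv R j) (one R k)).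
Proof.
split=> [|t ts]; first by apply/pformZ/pform_ew/pform_one.
by rewrite linZ /= (big_rem t) //= -scalerA; apply: dvf_self.
Qed.

Lemma M1_form t : t \in s ->
  M 1 ((\prod_(t' <- rem t s) a t') *: ew (c t) (one R k)).
Proof.
move=> ts; split=> [|t' t's]; first by apply/pformZ/pform_ew/pform_one.
rewrite linZ /=; have [->|tt'] := eqVneq t' t; first by rewrite ewK scaler0; apply: dvf0.
rewrite (big_rem t') /= ?mem_rem_uniq ?inE ?tt' //.
by rewrite -scalerA; apply: dvf_self.
Qed.

(** * Duality with logarithmic vector fields *)

Section Local.
Variables (f : R) (sg : {linear subT (M 1) -> vec b R}).
Hypothesis sgE : forall w, lincomb E (sg w) = f *: inc (M 1) w.

(** The matrix of [sg], scaled by [D] so that it is defined on basis vectors. Its columns are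
    logarithmic vector fields ([dvs_Th]) because [sg] is also defined on [c t] times [D / a t]. *)
Definition Th (j : 'I_k) : vec b R := sg (toS (M1_top j)).

Lemma lincomb_Th w : D *: sg w = lincomb Th (vec1 (inc (M 1) w)).
Proof.
rewrite -linZ (_ : D *: w = \sum_j (vec1 (inc (M 1) w) j : R) *: toS (M1_top j)).
  by rewrite linear_sum; apply: eq_bigr => j _; rewrite linZ.
apply: inc_inj; rewrite linZ linear_sum {1}(M1_vec (incP w)) /ew scaler_sumr.
by apply: eq_bigr => j _; rewrite -[mulx j _]ew_unitv [RHS]linZ toSK !scalerA mulrC.
Qed.

Lemma lincomb_G_Th j : lincomb G (Th j) = (D * f) *: unitv R j.
Proof.
rewrite -lincomb_G sgE toSK scalerA [LHS]linZ mulrC.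
by congr (_ *: _); exact: vec1K.
Qed.

Lemma dvs_Th i t : t \in s -> dvs (a t) (dot (c t) [ffun j => Th j i]).
Proof.
move=> ts; have := lincomb_Th (toS (M1_form ts)).
rewrite toSK !linZ /= vec1K (big_rem t) //= => e.
exists (sg (toS (M1_form ts)) i); have /(mulfI (_ : _ != 0)) : 
  (\prod_(y <- rem t s) a y) * dot (c t) [ffun j => Th j i] =
  (\prod_(y <- rem t s) a y) * (a t * sg (toS (M1_form ts)) i); last first.
  by apply; rewrite prodf_seq_neq0; apply/allP => y /mem_rem/a0.
have := congr1 (fun v : vec b R => v i : R) e; rewrite !ffunE.
rewrite -![_ *: _]/(_ * _) mulrCA mulrA => ->; rewrite sum_ffunE.
by congr (_ * _); apply: eq_bigr => j _; rewrite !ffunE.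
Qed.

(** [Th] followed by [G] is [D * f] times the identity, so in degree [p.+1] the power
    [(D * f) ^+ p.+1] appears, and [ext_dvf] takes one [D] back out. *)
Lemma ext_G_Th p g : M p.+1 g -> exists2 w, pform p.+1 w &
  ext G w = D ^+ p *: (f ^+ p.+1 *: g).
Proof.
move=> Mg; have [w wE] := ext_dvf us cop cunit dvs_Th Mg; exists w.
  have [pg _] := Mg => I cI; have := pform_ext Th pg cI; rewrite wE ffunE => /eqP.
  by rewrite [_ == _]mulf_eq0 (negPf D_neq0) => /eqP.
have : ext G (ext Th g) = (D * f) ^+ p.+1 *: g.
  rewrite ext_comp -(ext_scale _ (proj1 Mg)); apply: eq_ext => j; exact: lincomb_G_Th.
rewrite wE linZ /= exprMn exprS -!scalerA => e.
by apply/ffunP => I; have /ffunP/(_ I) := e; rewrite !ffunE => /(mulfI D_neq0).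
Qed.

(** [D] times the matrix of [sg] on the generators is [G] followed by [Th], so its exterior power
    kills [w]; then [D] cancels. *)
Lemma ext_sg_eq0 p w : pform p w -> ext G w = 0 ->
  ext (fun i => sg (toS (proj1 gE i))) w = 0.
Proof.
move=> pw Gw; have : ext (fun i => D *: sg (toS (proj1 gE i))) w = 0.
  rewrite (_ : (fun i => _) = fun i => lincomb Th (G i)).
    by rewrite -ext_comp Gw linear0.
  by apply/funext => i; rewrite lincomb_Th.
rewrite (ext_scaleT _ _ pw) => e; apply/ffunP => I; rewrite [RHS]ffunE.
have /ffunP/(_ I) := e; rewrite !ffunE => /eqP.
by rewrite [_ == _]mulf_eq0 expf_eq0 (negPf D_neq0) andbF => /eqP.
Qed.

End Local.


(** * The ideal of syzygies in the exterior algebra of the cover *)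

Variables (m : nat) (Z : 'I_m -> vec b R).
Hypothesis Z_inj : forall u, lincomb Z u = 0 -> u = 0.
Hypothesis Z_ker : forall v, lincomb E v = 0 <-> exists u, v = lincomb Z u.

(** The degree [p] part of the exterior ideal generated by the first [j] syzygies; adding them one
    at a time permits induction on [j]. *)
Definition syzforms (j p : nat) : submodule (forms b R).
Proof.
exists (fun w => pform p w /\ exists y : 'I_m -> forms b R,
    w = \sum_(i < m | (i < j)%N) ew (Z i) (y i)).
  split; first exact: pform0.
  by exists (fun=> 0); rewrite big1 // => i _; rewrite linear0.
move=> x w w' [pw [y e]] [pw' [y' e']]; split; first exact: pformL.
exists (fun i => x *: y i + y' i); rewrite e e' scaler_sumr -big_split.
by apply: eq_bigr => i _; rewrite linearP.
Defined.

Lemma syzforms0 p w : syzforms 0 p w -> w = 0.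
Proof. by move=> [_ [y ->]]; rewrite big_pred0. Qed.

Lemma syzforms_deg0 j w : syzforms j 0 w -> w = 0.
Proof.
move=> [/form0_one e [y wE]]; rewrite e (_ : w set0 = 0) ?scale0r //.
by rewrite wE sum_ffunE big1 // => i _; exact: ew_set0.
Qed.

Lemma syzforms_ew j p u w : syzforms j p w -> syzforms j p.+1 (ew u w).
Proof.
move=> [pw [y e]]; split; first exact: pform_ew.
exists (fun i => - ew u (y i)); rewrite e linear_sum; apply: eq_bigr => i _.
by rewrite [LHS]ewC [RHS]linearN.
Qed.

Lemma syzforms_Z j (i : 'I_m) p w : (i < j)%N -> pform p w -> syzforms j p.+1 (ew (Z i) w).
Proof.
move=> ij pw; split; first exact: pform_ew.
exists (fun i' => if i' == i then w else 0).
rewrite (bigD1 i) //= eqxx big1 ?addr0 // => i' /andP[_ /negPf ->].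
by rewrite linear0.
Qed.

Lemma syzforms_span p u w : pform p w -> syzforms m p.+1 (ew (lincomb Z u) w).
Proof.
move=> pw; rewrite (_ : ew _ _ = \sum_i (u i : R) *: ew (Z i) w).
  by apply: sm_sum => i _; apply: smZ; apply: syzforms_Z.
move: u; apply: linear_eq => [x y z|x y z|i].
- by rewrite linearP ewDl.
- exact: (lincomb_lin (fun i => ew (Z i) w)).
- by rewrite lincomb_unitv; have := lincomb_unitv (fun i => ew (Z i) w) i => /= ->.
Qed.

Lemma syzformsS (j : 'I_m) p w : syzforms j.+1 p.+1 w <->
  exists y w', [/\ pform p y, syzforms j p.+1 w' & w = ew (Z j) y + w'].
Proof.
have split_j y : \sum_(i < m | (i < j.+1)%N) ew (Z i) (y i) =
    ew (Z j) (y j) + \sum_(i < m | (i < j)%N) ew (Z i) (y i) :> forms b R.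
  rewrite (bigD1 j) //=; congr (_ + _); apply: eq_bigl => i.
  by rewrite ltnS [RHS]ltn_neqAle andbC.
split=> [[pw [y wE]]|[y [w' [py [pw' [y' e']] ->]]]].
  exists (hproj p (y j)), (\sum_(i < m | (i < j)%N) ew (Z i) (hproj p (y i))).
  split; first exact: pform_hproj.
    split; last by exists (fun i => hproj p (y i)).
    apply: (big_ind (@pform b R^o p.+1)) => [|x z px pz|i _]; first exact: pform0.
      by rewrite -[x]scale1r; apply: pformL.
    by apply/pform_ew/pform_hproj.
  rewrite -(split_j (fun i => hproj p (y i))) -(hproj_id pw) wE.
  have hs (x z : forms b R) : hproj p.+1 (x + z) = hproj p.+1 x + hproj p.+1 z.
    by apply/ffunP => I; rewrite !ffunE; case: ifP => // _; rewrite addr0.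
  have h0 : hproj p.+1 (0 : forms b R) = 0.
    by apply/ffunP => I; rewrite !ffunE; case: ifP.
  rewrite (big_morph _ hs h0); apply: eq_bigr => i _; exact: hproj_ew.
split.
  by rewrite -[ew _ y]scale1r; apply: pformL => //; apply: pform_ew.
exists (fun i => if i == j then y else y' i); rewrite split_j eqxx e'; congr (_ + _).
by apply: eq_bigr => i ij; rewrite -val_eqE /= ltn_eqF.
Qed.

Section Annihilate.
Variables (f : R) (sg : {linear subT (M 1) -> vec b R}).
Hypothesis sgE : forall w, lincomb E (sg w) = f *: inc (M 1) w.

Lemma lincomb_sg u : lincomb (fun i => sg (toS (proj1 gE i))) u =
  sg (lincomb (fun i => toS (proj1 gE i)) u).
Proof. by rewrite [RHS]linear_sum; apply: eq_bigr => i _; rewrite linZ. Qed.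

Lemma inc_lincomb u : inc (M 1) (lincomb (fun i => toS (proj1 gE i)) u) = lincomb E u.
Proof. by rewrite linear_sum; apply: eq_bigr => i _; exact: linZ. Qed.

(** [f] times the identity equals the composite of [E] and [sg] plus a matrix with values in the
    syzygies. On exterior powers, modulo the ideal of syzygies, multiplication by [f ^+ p] is then
    the power of that composite, which kills [w]. *)
Lemma syzforms_ker p w : pform p w -> ext G w = 0 -> syzforms m p (f ^+ p *: w).
Proof.
move=> pw Gw; pose T0 i := sg (toS (proj1 gE i)).
have /choice[r rE] i : exists u, f *: unitv R i = T0 i + lincomb Z u.
  have /Z_ker[u uE] : lincomb E (f *: unitv R i - T0 i) = 0.
    by rewrite linearB linZ lincomb_unitv sgE subrr.
  by exists u; rewrite -uE addrC subrK.
rewrite -(ext_scale f pw) -[X in syzforms _ _ X]subr0 -(ext_sg_eq0 sg pw Gw) -/T0.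
rewrite (eq_ext _ rE).
pose P p w := pform p w /\
  syzforms m p (ext (fun i => T0 i + lincomb Z (r i)) w - ext T0 w).
suff [] : P p w by [].
apply: (pform_ind (P := P)) pw => {p w Gw} [p|p x y z [py hy] [pz hz]||p i w [pw hw]].
- by split; [exact: pform0 | rewrite !linear0 addr0; exact: sm0].
- split; first exact: pformL.
  rewrite [ext (fun _ => _) _]linearP [ext T0 (_ + z)]linearP opprD addrACA -scalerBr.
  exact: smL.
- by split; [exact: pform_one | rewrite !ext_one subrr; exact: sm0].
split; first exact: pform_mulx.
rewrite !ext_mulx ewD addrAC -linearB; apply: smD; first exact: syzforms_ew.
exact/syzforms_span/pform_ext.
Qed.

(** [rho] expresses the difference of [f] and the composite of [E] and [sg] in the syzygies;
    [rho (Z i) = f *: unitv R i] says that locally the [Z i] are part of a basis. Contracting with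
    coordinate [j] of [rho] isolates [f *: y]. *)
Lemma syzforms_contract (j : 'I_m) p y : pform p y -> syzforms j p.+1 (ew (Z j) y) ->
  syzforms j.+1 p (f *: y).
Proof.
move=> py [_ [y' yE]].
have /choice[rho rhoE] u : exists v, f *: u - lincomb (fun i => sg (toS (proj1 gE i))) u = lincomb Z v.
  apply/Z_ker; rewrite linearB linZ.
  by rewrite lincomb_sg sgE inc_lincomb subrr.
have lrho : linear rho.
  move=> x u v; apply/eqP; rewrite -subr_eq0; apply/eqP/Z_inj.
  rewrite linearB linearP -!rhoE [lincomb _ (x *: u + v)]linearP.
  by rewrite !scalerDr !scalerN !scalerA [f * x]mulrC opprD addrACA subrr.
have rhoZ i : rho (Z i) = f *: unitv R i.
  apply/eqP; rewrite -subr_eq0; apply/eqP/Z_inj.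
  rewrite linearB linZ lincomb_unitv -rhoE.
  have e : lincomb E (Z i) = 0 by apply/Z_ker; exists (unitv R i); rewrite lincomb_unitv.
  have e' : lincomb (fun i => toS (proj1 gE i)) (Z i) = 0.
    by apply: (@inc_inj _ _ (M 1)); rewrite inc_lincomb e linear0.
  by rewrite lincomb_sg e' linear0 subr0 subrr.
pose rv : vec b R := [ffun u => rho (unitv R u) j].
have dotZ i : dot (Z i) rv = f * (i == j)%:R.
  have := linear_lincomb (mklin lrho) (Z i) => /= e.
  have /ffunP/(_ j) := rhoZ i; rewrite e sum_ffunE !ffunE eq_sym -[RHS]/(_ * _) => <-.
  by apply: eq_bigr => u _; rewrite !ffunE.
split; first exact: pformZ.
exists (fun i => if i == j then iv rv y else - iv rv (y' i)).
have := iv_ew (Z j) rv y; rewrite yE dotZ eqxx mulr1 => /eqP.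
rewrite eq_sym subr_eq => /eqP ->; rewrite [RHS](bigD1 j) //= eqxx addrC; congr (_ + _).
rewrite linear_sum; apply: eq_big => [i|i ij]; first by rewrite ltnS [LHS]ltn_neqAle andbC.
by rewrite [LHS]iv_ew dotZ -val_eqE ltn_eqF // mulr0 scale0r sub0r linearN.
Qed.

End Annihilate.

Variable F : R -> Prop.
Hypothesis F_free : forall f, F f -> factors_free f.
Hypothesis F_seq : forall q, exists h : vec k R, regular_seq h /\
  forall U : submodule (R^o), (forall f, F f -> U (f ^+ q)) -> forall j, U (h j).

Lemma torsion_F n q (J : finType) (N : submodule {ffun J -> R^o}) v :
  fres n (subT N) -> (n < k)%N -> (forall f, F f -> N (f ^+ q *: v)) -> N v.
Proof.
move=> rN nk Nf; have [h [hr hF]] := F_seq q.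
apply: (torsion_sub hr rN nk) => j.
have U0 : N ((0 : R) *: v) by rewrite scale0r; apply: sm0.
have UL (x y z : R) : N (y *: v) -> N (z *: v) -> N ((x * y + z) *: v).
  by move=> Ny Nz; rewrite scalerDl -scalerA; apply: smL.
exact: (hF (@Submodule R (R^o) (fun t : R => N (t *: v)) U0 UL)).
Qed.

Lemma ew_syzforms (j : 'I_m) p w : syzforms j.+1 p w -> syzforms j p.+1 (ew (Z j) w).
Proof.
case: p => [/syzforms_deg0 -> |p /syzformsS[y [w' [py Bw' ->]]]].
  by rewrite linear0; apply: sm0.
by rewrite linearD /= ewK add0r; apply: syzforms_ew.
Qed.

Lemma syzforms_torsion (j : 'I_m) p y : (p < k)%N -> fres p (subT (syzforms j.+1 p)) ->
  pform p y -> syzforms j p.+1 (ew (Z j) y) -> syzforms j.+1 p y.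
Proof.
move=> pk r py By; apply: (torsion_F (q := 1) r pk) => f /F_free[sg sgE].
by rewrite expr1; apply: syzforms_contract.
Qed.

(* By induction along
   0 -> syzforms j.+1 p -> pforms p (+) syzforms j p.+1 -> syzforms j.+1 p.+1 -> 0,
   where the second map wedges with [Z j]. *)
Lemma syzforms_res p j : (p <= k)%N -> fres p (subT (syzforms j p)).
Proof.
elim: p j => [|p IHp] j pk.
  by move=> x; apply: inc_inj; rewrite linear0; apply: syzforms_deg0 (incP x).
elim: j => [|j IHj].
  apply: (res_le (finfree_zero R) (n := 0)) => // x.
  by apply: inc_inj; rewrite linear0; apply: syzforms0 (incP x).
have [jm|mj] := ltnP j m; last first.
  have jE y : \sum_(i < m | (i < j)%N) ew (Z i) (y i) =
      \sum_(i < m | (i < j.+1)%N) ew (Z i) (y i) :> forms b R.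
    apply: eq_bigl => i; have ij := leq_trans (ltn_ord i) mj.
    by rewrite ij ltnS ltnW.
  by apply: res_eq IHj => w; split=> -[pw [y e]]; split=> //; exists y; rewrite e jE.
pose jo := Ordinal jm.
have P1 (x : subT (syzforms j.+1 p)) : pforms R b p (inc _ x) by have [] := incP x.
have le : linear (fun x : subT (syzforms j.+1 p) => ew (Z jo) (inc _ x)).
  by move=> x y z; rewrite !linearP.
have P2 (x : subT (syzforms j.+1 p)) : syzforms j p.+1 (mklin le x) by apply: (@ew_syzforms jo); exact: incP.
have lI : linear (fun x => (corestr P1 x, corestr P2 x)).
  by move=> x y z; apply: pair_ext; exact: linearP.
have qP (x : subT (pforms R b p) * subT (syzforms j p.+1)) :
    syzforms j.+1 p.+1 (ew (Z jo) (inc _ x.1) - inc _ x.2).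
  apply/(syzformsS jo); exists (inc _ x.1), (- inc _ x.2).
  by split=> //; [exact: (incP x.1) | apply/smN/incP].
have lQ : linear (fun x => toS (qP x)).
  move=> x y z; apply: inc_inj; rewrite [RHS]linearP !toSK.
  have -> : inc _ (x *: y + z).1 = x *: inc _ y.1 + inc _ z.1 by exact: linearP.
  have -> : inc _ (x *: y + z).2 = x *: inc _ y.2 + inc _ z.2 by exact: linearP.
  by rewrite linearP scalerBr opprD addrACA.
apply: (@res_cone _ _ (@finfree_prod R) (@finfree_proj R) _ _ _ _ (mklin lI) (mklin lQ)).
- split.
  + by move=> x y /(congr1 (fun z => inc _ z.1)) e; apply: inc_inj.
  + move=> z; have /(syzformsS jo)[y [w' [py Bw' e]]] := incP z.
    exists (toS (py : pforms R b p y), toS (smN Bw')).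
    by apply: inc_inj; rewrite [LHS]/= opprK e.
  + move=> [y w']; split=> [/(congr1 (inc _))|[x <-]]; last first.
      by apply: inc_inj; rewrite linear0 [LHS]/= subrr.
    rewrite linear0 [LHS]/= => /eqP; rewrite subr_eq0 => /eqP e.
    have By : syzforms j.+1 p (inc _ y).
      apply: (syzforms_torsion (j := jo)) => //; [exact: (IHp) (ltnW pk) | exact: (incP y)|].
      by rewrite e; apply: incP.
    by exists (toS By); apply: pair_ext; apply: inc_inj.
- exact: IHp (ltnW pk).
apply: res_prod IHj; [exact: finfree_prod | exact: finfree_proj|].
by apply: (res_le (finfree_zero R) (n := 1)) => //; apply: (res_cls (finfree_zero R)); exact: pforms_finfree.
Qed.

(** * Resolutions of the modules of logarithmic forms *)

Definition ext_image (p : nat) : submodule (forms k R).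
Proof.
exists (fun g => exists2 w, pform p w & ext G w = g).
  by exists 0; [exact: pform0 | rewrite linear0].
by move=> x _ _ [w pw <-] [w' pw' <-]; exists (x *: w + w'); [exact: pformL | rewrite linearP].
Defined.

(** The kernel of the exterior power of the cover is [syzforms m p] up to multipliers, and the [p]
    terms resolving the latter are few enough to remove them. *)
Lemma ext_image_res p : (p < k)%N -> fres p.+1 (subT (ext_image p)).
Proof.
move=> pk; have rB := syzforms_res m (ltnW pk).
have iP (x : subT (syzforms m p)) : pforms R b p (inc _ x) by have [] := incP x.
have qP (x : subT (pforms R b p)) : ext_image p (ext G (inc _ x)) by exists (inc _ x); first exact: (incP x).
have lQ : linear (fun x => toS (qP x)).
  by move=> x y z; apply: inc_inj; rewrite /= !linearP.
exists (subT (syzforms m p)), (subT (pforms R b p)), (corestr iP), (mklin lQ).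
split=> //; first exact: pforms_finfree.
split=> [x y /(congr1 (inc _)) e|z|x]; first exact: inc_inj.
  by have [w pw e] := incP z; exists (toS (pw : pforms R b p w)); apply: inc_inj.
split=> [/(congr1 (inc _)) e|[y <-]].
  have Bx : syzforms m p (inc _ x).
    apply: (torsion_F (q := p) rB pk) => f /F_free[sg sgE].
    by apply: (syzforms_ker sgE (incP x)); rewrite linear0 in e.
  by exists (toS Bx); apply: inc_inj.
apply: inc_inj; rewrite linear0; transitivity (ext G (inc _ y)) => //.
have [_ [w ->]] := incP y; rewrite linear_sum big1 // => i _; rewrite /= ext_ew -lincomb_G.
have -> : lincomb E (Z i) = 0 by apply/Z_ker; exists (unitv R i); rewrite lincomb_unitv.
by rewrite linear0 ew0l.
Qed.

(** Multiplication by [D ^+ p] is an isomorphism of [M p.+1] onto the image of the exterior power: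
    it lands there by [ext_G_Th] and removal of multipliers, which takes [p.+2 < k], and it is onto
    by [ext_logs]. *)
Lemma logs_res p : (p.+2 < k)%N -> fres p.+2 (subT (M p.+1)).
Proof.
move=> pk; have rI := ext_image_res (ltnW pk).
have DI (x : subT (M p.+1)) : ext_image p.+1 (D ^+ p *: inc _ x).
  apply: (torsion_F (q := p.+1) rI pk) => f /F_free[sg sgE].
  have [w pw e] := ext_G_Th sgE (incP x); exists w => //.
  by rewrite e !scalerA mulrC.
have lD : linear (fun x => toS (DI x)).
  move=> x y z; apply: inc_inj; rewrite [RHS]linearP !toSK.
  by rewrite [inc _ (x *: y + z)]linearP scalerDr !scalerA mulrC.
apply: (res_iso' (f := mklin lD)) rI => [x y /(congr1 (inc _)) /= /ffunP e|y].
  apply: inc_inj; apply/ffunP => I; have := e I; rewrite !ffunE.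
  by apply: mulfI; rewrite expf_neq0 ?D_neq0.
have [w pw wE] := incP y.
have [g Mg gE'] := ext_logs us cop cunit a0 M1_gen pw.
by exists (toS Mg); apply: inc_inj; rewrite -wE gE'.
Qed.

End ExteriorPowers.

(** * Comparison with the restriction *)

Lemma scale_inj (R : idomainType) (J : finType) (x : R) : x != 0 ->
  injective ( *:%R x : {ffun J -> R^o} -> {ffun J -> R^o}).
Proof.
move=> x0 u v /ffunP e; apply/ffunP => j; have := e j; rewrite !ffunE.
exact: mulfI.
Qed.

Section Comparison.
Variables (K : fieldType) (l k : nat).
Local Notation S := {mpoly K[l]}.
Local Notation S' := {mpoly K[k]}.
Variables (pi : {rmorphism S -> S'}) (al : S).
Hypothesis hs : hyperplane_section pi al.
Variables (T : eqType) (s : seq T) (c : T -> vec k S) (a : T -> S).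
Hypothesis us : uniq s.
Hypothesis cop : forall t t', t \in s -> t' \in s -> t != t' -> dreg (a t) (a t').
Hypothesis cunit : forall t, t \in s -> exists v, dot (c t) v = 1.
Hypothesis a0 : forall t, t \in s -> a t != 0.
Local Notation D := (\prod_(t <- s) a t).
Local Notation M := (logs s c a).

Variables (T' : eqType) (s' : seq T') (c' : T' -> vec k S') (a' : T' -> S').
Hypothesis us' : uniq s'.
Hypothesis cop' : forall t t', t \in s' -> t' \in s' -> t != t' -> dreg (a' t) (a' t').
Hypothesis cunit' : forall t, t \in s' -> exists v, dot (c' t) v = 1.
Local Notation N := (logs s' c' a').

(* The hyperplanes [r] containing a given flat of the restriction; their
   defining forms restrict to proportional linear forms. *)
Hypothesis fiber : forall t', t' \in s' -> exists (r : seq T) (t0 : T) (v : S'),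
  [/\ uniq r, {subset r <= s}, forall t, t \in r -> exists u, c t0 = u *: c t,
      c' t' = v *: mapf pi (c t0) & dvs (a' t') (pi (\prod_(t <- r) a t))].
Hypothesis below : forall t, t \in s -> exists t' v,
  [/\ t' \in s', mapf pi (c t) = v *: c' t' & dvs (pi (a t)) (a' t')].
Hypothesis piD0 : pi D != 0.
Hypothesis piD : dvs (pi D) (\prod_(t <- s') a' t).

Lemma dvs_pi x y : dvs x y -> dvs (pi x) (pi y).
Proof. by move=> [z ->]; exists (pi z); rewrite rmorphM. Qed.

Lemma dvs_trans (R : idomainType) (x y z : R) : dvs x y -> dvs y z -> dvs x z.
Proof. by move=> [u ->] [v ->]; exists (u * v); rewrite mulrA. Qed.

Lemma dvf_trans (R : idomainType) (J : finType) (x y : R) (z : {ffun J -> R^o}) :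
  dvs x y -> dvf y z -> dvf x z.
Proof. by move=> [u ->] [v ->]; exists (u *: v); rewrite scalerA. Qed.

Lemma dot_fiber t' (th : vec k S) : t' \in s' ->
  (forall t, t \in s -> dvs (a t) (dot (c t) th)) ->
  dvs (a' t') (dot (c' t') (mapf pi th)).
Proof.
move=> /fiber[r [t0 [v [ur rs cr -> ar]]]] h.
have dZ (x : S') (y z : vec k S') : dot (x *: y) z = x * dot y z.
  by rewrite -[x *: y]addr0 dotDl /dot [X in _ + X]big1 ?addr0 // => i _; rewrite ffunE mul0r.
have dZ' (x : S) (y z : vec k S) : dot (x *: y) z = x * dot y z.
  by rewrite -[x *: y]addr0 dotDl /dot [X in _ + X]big1 ?addr0 // => i _; rewrite ffunE mul0r.
rewrite dZ -mapf_dot; apply/dvsM/(dvs_trans ar)/dvs_pi; apply: dvs_prod => //.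
  by move=> t1 t2 /rs h1 /rs h2; apply: cop.
by move=> t tr; have [u ->] := cr t tr; rewrite dZ'; apply/dvsM/h/rs.
Qed.

(** Hyperplanes through one flat have proportional forms on [H], so their pairwise coprime
    divisibility conditions multiply up to the multiplicity of the flat. *)
Lemma imp_logs p v : imp hs (M p) v -> N p v.
Proof.
move=> [w [pw hw] <-]; split=> [|t']; first exact: mapf_pform.
move=> /fiber[r [t0 [v' [ur rs cr -> ar]]]].
rewrite ewZl -mapf_ew; apply/dvfZ/(dvf_trans ar).
have [x ->] : dvf (\prod_(t <- r) a t) (ew (c t0) w).
  apply: dvf_prod => // [t1 t2 /rs h1 /rs h2|t tr]; first exact: cop.
  by have [u ->] := cr t tr; rewrite ewZl; apply/dvfZ/hw/rs.
by rewrite mapfZ; apply: dvf_self.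
Qed.

Lemma logs_below p v t : t \in s -> N p v -> dvf (pi (a t)) (ew (mapf pi (c t)) v).
Proof.
move=> /below[t' [x [t's' -> at']]] [_ hv]; rewrite ewZl.
exact/dvfZ/(dvf_trans at')/hv.
Qed.

Variables (b : nat) (E : 'I_b -> forms k S).
Hypothesis gE : gens (M 1) E.
Local Notation G := (fun i => vec1 (E i)).

Lemma mapf_hproj n p (w : forms n S) : mapf pi (hproj p w) = hproj p (mapf pi w).
Proof. by apply/ffunP => I; rewrite !ffunE; case: ifP => // _; rewrite rmorph0. Qed.

Lemma lift_pform n p (v : forms n S') : pform p v -> exists2 w : forms n S, pform p w & mapf pi w = v.
Proof.
move=> pv; have [w wE] := mapf_surj hs v; exists (hproj p w); first exact: pform_hproj.
by rewrite mapf_hproj wE hproj_id.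
Qed.

(** The argument of [ext_G_Th] over [S']: the restricted columns of [Th] are logarithmic for the
    Ziegler multiplicity, so [ext Th' g] is divisible by [pi D]. The quotient lifts to [S], and [G]
    sends the lift to a power of [D] times the required logarithmic form. *)
Lemma lift_local f p g : factors_free s c a E f -> N p.+1 g ->
  imp hs (M p.+1) (pi f ^+ p.+1 *: g).
Proof.
move=> [sg sgE] Ng; pose Th' j := mapf pi (Th sg j).
have h i t' : t' \in s' -> dvs (a' t') (dot (c' t') [ffun j => Th' j i]).
  move=> t's'; have e : [ffun j => Th' j i] = mapf pi [ffun j => Th sg j i].
    by apply/ffunP => j; rewrite !ffunE.
  rewrite e; apply: (dot_fiber t's') => t ts; exact: (dvs_Th us a0 sg i ts).
have [w wE] := dvf_trans piD (ext_dvf us' cop' cunit' h Ng).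
have pw : pform p.+1 w.
  have [pg _] := Ng => I cI; have := pform_ext Th' pg cI; rewrite wE ffunE => /eqP.
  by rewrite [_ == _]mulf_eq0 (negPf piD0) => /eqP.
have [w0 pw0 w0E] := lift_pform pw.
have [e Me eE] := ext_logs us cop cunit a0 (M1_gen gE) pw0.
exists e => //.
have eG : ext (fun i => mapf pi (G i)) w = pi D ^+ p *: mapf pi e.
  by rewrite -w0E -mapf_ext eE mapfZ rmorphXn.
have : ext (fun i => mapf pi (G i)) (ext Th' g) = (pi D * pi f) ^+ p.+1 *: g.
  rewrite ext_comp -(ext_scale _ (proj1 Ng)); apply: eq_ext => j.
  by rewrite -mapf_lincomb (lincomb_G_Th sgE) mapfZ mapf_unitv rmorphM.
rewrite wE linearZ /= eG scalerA -exprS exprMn -scalerA => eq_e.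
by apply: (scale_inj (expf_neq0 p.+1 piD0) eq_e).
Qed.

Variable F : S -> Prop.
Hypothesis F_free : forall f, F f -> factors_free s c a E f.
Hypothesis F_seq : forall q, exists (d : 'I_k -> nat) (h : vec k S),
  [/\ forall j, hmg (d j) (h j), forall j, pi (h j) = 'X_j ^+ d j
    & forall U : submodule (S^o), (forall f, F f -> U (f ^+ q)) -> forall j, U (h j)].

Lemma lift_seq p g (U : S -> Prop) :
  N p.+1 g -> (forall x, imp hs (M p.+1) (pi x *: g) -> U x) ->
  forall h : S, (forall V : submodule (S^o), (forall f, F f -> V (f ^+ p.+1)) -> V h) -> U h.
Proof.
move=> Ng hU h hh; apply: hU.
have V0 : imp hs (M p.+1) (pi 0 *: g) by rewrite (rmorph0 pi) scale0r; exact: (sm0 (imp hs (M p.+1))).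
have VL (x y z : S) : imp hs (M p.+1) (pi y *: g) -> imp hs (M p.+1) (pi z *: g) ->
    imp hs (M p.+1) (pi (x * y + z) *: g).
  by move=> hy hz; rewrite (rmorphD pi) (rmorphM pi) scalerDl -scalerA; exact: (smL (pi x) hy hz).
apply: (hh (@Submodule S (S^o) (fun t : S => imp hs (M p.+1) (pi t *: g)) V0 VL)) => f Ff /=.
by rewrite rmorphXn; apply: lift_local => //; apply: F_free.
Qed.

(** Restriction preserves the number of terms of the resolution, so the multipliers, which restrict
    to powers of the variables, are removed over [S'] by [torsion_sub]. *)
Lemma restriction_logs p : (p.+2 < k)%N -> saturated al (M p.+1) ->
  fres p.+2 (subT (M p.+1)) -> forall g, N p.+1 g <-> imp hs (M p.+1) g.
Proof.
move=> pk sM rM g; split=> [Ng|]; last exact: imp_logs.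
have [d [h [hd pih hF]]] := F_seq p.+1.
refine (@torsion_sub _ _ _ (@xpow_regular K k d) _ _ (imp hs (M p.+1)) g (fres_section hs sM rM) pk _) => j.
rewrite ffunE -pih; apply: (lift_seq (U := fun x => imp hs (M p.+1) (pi x *: g)) Ng) => //.
by move=> V hV; apply: hF.
Qed.

End Comparison.

(** * Lifting logarithmic 1-forms from the restriction *)

Lemma ew_mapf (R R' : comNzRingType) (f : {rmorphism R -> R'}) r (J : finType)
    (g : vec r R) (w : {ffun {set 'I_r} -> {ffun J -> R^o}}) I :
  ew (mapf f g) [ffun L => mapf f (w L)] I = mapf f (ew g w I).
Proof.
rewrite !sum_ffunE mapf_sum; apply: eq_bigr => i _; rewrite !ffunE mapfZ.
case: ifP => _; last by rewrite mapf0.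
by rewrite mapfZ /sgn rmorphXn rmorphN1.
Qed.

Definition multiples (R : idomainType) (J : finType) (x : R) :
  submodule {ffun J -> R^o}.
Proof. by exists (dvf x); [exact: dvf0 | exact: dvfL]. Defined.

Lemma multiples_fres (R : idomainType) (J : finType) (x : R) : x != 0 ->
  fres 1 (subT (multiples J x)).
Proof.
move=> x0; apply: (res_cls (finfree_zero _)).
have BP y : multiples J x (x *: y) by apply: dvf_self.
have lB : linear (fun y : {ffun J -> R^o} => x *: y).
  by move=> u y z; rewrite scalerDr !scalerA mulrC.
apply: (finfree_iso (f := corestr (BP : forall y, multiples J x (mklin lB y)))).
- by move=> y z /(congr1 (inc _)); exact: scale_inj.
- by move=> y; have [z zE] := incP y; exists z; apply: inc_inj.
- exact: finfree_ffun.
Qed.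

Section LiftOne.
Variables (K : fieldType) (l k : nat).
Local Notation S := {mpoly K[l]}.
Local Notation S' := {mpoly K[k]}.
Variables (pi : {rmorphism S -> S'}) (al : S).
Hypothesis hs : hyperplane_section pi al.
Variables (T : eqType) (s : seq T) (c : T -> vec k S) (a : T -> S).
Hypothesis a_homog : forall t, t \in s -> hmg 1 (a t).
Hypothesis c_const : forall t d w, ew (c t) (wc (fun=> 0%N) d w) = wc (fun=> 0%N) d (ew (c t) w).
Hypothesis a_reg : forall t, t \in s -> dreg (a t) al.
Hypothesis pia0 : forall t, t \in s -> pi (a t) != 0.

Definition M1 : submodule {ffun {set 'I_k} -> S^o} := logs s c a 1.

Variable N1 : submodule {ffun {set 'I_k} -> S'^o}.
Hypothesis N1_pform : forall v, N1 v -> pform 1 v.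
Hypothesis N1_below : forall t v, t \in s -> N1 v -> dvf (pi (a t)) (ew (mapf pi (c t)) v).
Hypothesis imp_N1 : forall v, imp hs M1 v -> N1 v.

Variables (d : 'I_k -> nat) (h : vec k S).
Hypothesis pih : forall j, pi (h j) = 'X_j ^+ d j.
Hypothesis lift_h : forall v j, N1 v -> imp hs M1 (pi (h j) *: v).
Hypothesis k_gt3 : (3 < k)%N.
Hypothesis N1_res : fres 2 (subT N1).

Definition cg t (x y : forms k S) := dvf (a t) (x - y).

Lemma cg_sym t x y : cg t x y -> cg t y x.
Proof. by move=> h1; rewrite /cg -opprB; apply: dvfN. Qed.

Lemma cg_trans t y x z : cg t x y -> cg t y z -> cg t x z.
Proof. by move=> h1 h2; rewrite /cg -(subrK y x) -addrA; apply: dvfD. Qed.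

Lemma cgZ t f x y : cg t x y -> cg t (f *: x) (f *: y).
Proof. by move=> h1; rewrite /cg -scalerBr; apply: dvfZ. Qed.

Lemma cgB t x y x' y' : cg t x y -> cg t x' y' -> cg t (x - x') (y - y').
Proof. by move=> h1 h2; rewrite /cg opprD addrACA -opprD; apply: dvfB. Qed.

(* A family [u] of 2-forms, each taken modulo [a t], is a coboundary when it is
   given by the products [c t /\ g] for a common 1-form [g]. *)
Definition cob (u : T -> forms k S) :=
  exists2 g, pform 1 g & forall t, t \in s -> cg t (u t) (ew (c t) g).
Definition cobs e (u : T -> forms k S) := forall j, cob (fun t => h j ^+ e *: u t).

Lemma al_pform p (x : forms k S) : pform p (al *: x) -> pform p x.
Proof.
have [_ _ al0 _ _] := hs.
move=> px I cI; have /eqP := px I cI; rewrite ffunE [_ == _]mulf_eq0 (negPf al0).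
by move/eqP.
Qed.

Lemma cob_lift nu u j : pform 1 nu -> N1 (mapf pi nu) ->
  (forall t, t \in s -> cg t (al *: u t) (ew (c t) nu)) ->
  cob (fun t => h j *: u t).
Proof.
move=> pnu Nnu hu; have [mu [pmu hmu] muE] := lift_h j Nnu.
have /(mapf_ker hs)[ep epE] : mapf pi (h j *: nu - mu) = 0.
  by rewrite mapfB mapfZ muE subrr.
have pep : pform 1 ep.
  apply: al_pform; rewrite -epE -scaleN1r addrC.
  apply: pformL; first exact: pmu.
  exact: pformZ.
exists ep; first exact: pep.
move=> t ts; rewrite /cg.
apply: (dregf (a_reg ts)).
have e1 : al *: ew (c t) ep = h j *: ew (c t) nu - ew (c t) mu.
  by rewrite -(linZ (ew (c t))) -epE linearB (linZ (ew (c t))).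
have -> : al *: (h j *: u t - ew (c t) ep) =
    h j *: (al *: u t - ew (c t) nu) + ew (c t) mu.
  by rewrite !scalerBr e1 !scalerA (mulrC al) opprD opprK addrA.
by apply: dvfD; [apply/dvfZ/hu | apply: hmu].
Qed.

(** The family [u] is the obstruction to making [nu] logarithmic: once it is a coboundary,
    [lift_one] corrects [nu] by a multiple of [al]. *)
Lemma N1_split nu : pform 1 nu -> N1 (mapf pi nu) ->
  exists u : T -> forms k S, forall t, t \in s -> cg t (al *: u t) (ew (c t) nu).
Proof.
move=> pnu Nnu; suff /choice[u uE] : forall t, exists u, t \in s -> cg t (al *: u) (ew (c t) nu).
  by exists u.
move=> t.
have [ts|tNs] := boolP (t \in s); last by exists 0.
have [z' zE] := N1_below ts Nnu; have [z zz] := mapf_surj hs z'.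
have /(mapf_ker hs)[u uE] : mapf pi (ew (c t) nu - a t *: z) = 0.
  by rewrite mapfB mapfZ mapf_ew zE zz subrr.
by exists u => _; apply: cg_sym; rewrite /cg -uE opprB addrC subrK; exists z.
Qed.

Lemma dvf_torsion t e (v : forms k S') : t \in s ->
  (forall j, dvf (pi (a t)) (pi (h j ^+ e) *: v)) -> dvf (pi (a t)) v.
Proof.
move=> ts hv; pose B := multiples {set 'I_k} (pi (a t)).
rewrite -[dvf _ _]/(B v).
refine (@torsion_sub _ _ _ (@xpow_regular K k (fun j => d j * e)%N) _ _ B v (multiples_fres _ (pia0 ts)) _ _).
  by apply: leq_trans k_gt3.
by move=> j; have := hv j; rewrite ffunE rmorphXn pih -exprM.
Qed.

Lemma cobs_step e u : cobs e u -> exists y u', [/\ pform 1 y, cobs e.+1 u' &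
  forall t, t \in s -> cg t (u t) (ew (c t) y + al *: u' t)].
Proof.
move=> hu; have /choice[de deP] : forall j, exists g, pform 1 g /\
    forall t, t \in s -> cg t (h j ^+ e *: u t) (ew (c t) g).
  by move=> j; have [g pg gE] := hu j; exists g.
pose gS : vec k S := [ffun j => h j ^+ e].
(* The Koszul 1-cochain with values [de j]. Modulo [a t], its wedge with [c t] is the Koszul
   coboundary of [u t], so the coboundary of [De] is logarithmic. *)
pose De : {ffun {set 'I_k} -> forms k S} := [ffun I => \sum_(j | I == [set j]) de j].
have De1 j : De [set j] = de j.
  rewrite ffunE (big_pred1 j) // => i; rewrite eq_sym.
  by apply/eqP/eqP => [/set1_inj|->].
have De0 (I : {set 'I_k}) : #|I| != 1%N -> De I = 0.
  move=> cI; rewrite ffunE big_pred0 // => i.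
  by apply: contraNF cI => /eqP ->; rewrite cards1.
have MD (I : {set 'I_k}) : M1 (ew gS De I).
  split=> [|t ts].
    rewrite -[pform _ _]/(pforms S k 1 _); apply: ew_in => L; rewrite ffunE.
    by apply: sm_sum => j _; have [] := deP j.
  pose ut : {ffun {set 'I_k} -> forms k S} := [ffun I => if I == set0 then u t else 0].
  have -> : ew (c t) (ew gS De I) = ew gS ([ffun L => ew (c t) (De L)] - ew gS ut) I.
    by rewrite linearB /= ewK subr0 (ew_map (ew (c t))) ffunE.
  pose B := multiples {set 'I_k} (a t).
  rewrite -[dvf _ _]/(B _); apply: ew_in => L.
  rewrite [X in B X](_ : _ = ew (c t) (De L) - ew gS ut L); last by rewrite !ffunE.
  rewrite -[B _]/(dvf _ _).
  have [/cards1P[j ->]|cL] := boolP (#|L| == 1%N).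
    rewrite ew_set1 De1 [gS j]ffunE [ut set0]ffunE eqxx; apply: cg_sym.
    by have [_ hj] := deP j; apply: hj.
  rewrite De0 // linear0 (_ : ew gS ut L = 0) ?subr0; first exact: dvf0.
  have put : pform 0 ut by move=> I'; rewrite ffunE cards_eq0 => /negPf ->.
  exact: (pform_ew gS put cL).
pose De' : {ffun {set 'I_k} -> forms k S'} := [ffun I => mapf pi (De I)].
have gE : mapf pi gS = xpow K (fun j => d j * e)%N.
  by apply/ffunP => j; rewrite !ffunE rmorphXn pih -exprM.
(* Degree 1 and a resolution of [N1] with 2 terms require [1 + 2 < k], that is, [l >= 5]. Up to
   [N1], the restricted [de j] become multiples of a common [y']. *)
have [|||y' yE] := koszul_sub (@xpow_regular K k (fun j => d j * e)%N) (s := 1) (w := De') N1_res.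
- by [].
- by move=> I cI; rewrite ffunE De0 // mapf0.
- by move=> I; rewrite -gE ew_mapf; apply: imp_N1; exists (ew gS De I).
have [y py yE'] := lift_pform hs (@pform_hproj _ _ 1 (y' set0)).
pose nu j := de j - h j ^+ e *: y.
have pnu j : pform 1 (nu j).
  rewrite /nu -scaleN1r addrC; apply: pformL; last by have [] := deP j.
  exact: pformZ.
have Nnu j : N1 (mapf pi (nu j)).
  have := yE [set j]; rewrite ew_set1 ffunE De1 ffunE exprM -pih -rmorphXn => Nj.
  rewrite mapfB mapfZ yE'; suff -> : mapf pi (de j) - pi (h j ^+ e) *: hproj 1 (y' set0) =
    mapf pi (de j) - pi (h j ^+ e) *: y' set0 by [].
  rewrite -[RHS](hproj_id (N1_pform Nj)); apply/ffunP => I; rewrite !ffunE.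
  case: ifP => // /negbT cI; rewrite scaler0 subr0.
  by have [pde _] := deP j; rewrite pde // rmorph0.
have eq_nu j t : t \in s -> cg t (h j ^+ e *: (u t - ew (c t) y)) (ew (c t) (nu j)).
  move=> ts; rewrite scalerBr /nu linearB (linZ (ew (c t))); apply: cgB.
    by have [_ hj] := deP j; apply: hj.
  by rewrite /cg subrr; apply: dvf0.
(* On [H] and modulo [a t], every [h j ^+ e] kills [u t] minus [c t] wedge [y]. As there is no
   torsion modulo [pi (a t)], this difference is a multiple of [al] modulo [a t]. *)
have /choice[u' u'E] : forall t, exists u', t \in s -> cg t (u t - ew (c t) y) (al *: u').
  move=> t; have [ts|tNs] := boolP (t \in s); last by exists 0.
  have [z' zE] : dvf (pi (a t)) (mapf pi (u t - ew (c t) y)).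
    apply: (dvf_torsion (e := e) ts) => j; rewrite -mapfZ.
    have [z] := eq_nu j t ts; move=> /eqP; rewrite subr_eq => /eqP ->.
    rewrite mapfD mapfZ mapf_ew; apply: dvfD; [exact: dvf_self | exact: N1_below].
  have [z zz] := mapf_surj hs z'.
  have /(mapf_ker hs)[u' uE] : mapf pi (u t - ew (c t) y - a t *: z) = 0.
    by rewrite mapfB mapfZ zE zz subrr.
  by exists u' => _; rewrite /cg -uE opprB addrC subrK; exists z.
exists y, u'; split=> // [j|t ts]; last first.
  by have := u'E t ts; rewrite /cg opprD addrA.
have [|g pg gP] := @cob_lift (nu j) (fun t => h j ^+ e *: u' t) j (pnu j) (Nnu j).
  move=> t ts; apply: cg_trans (eq_nu j t ts).
  rewrite scalerA mulrC -scalerA; apply: cgZ.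
  by apply: cg_sym; apply: u'E.
by exists g => // t ts; rewrite exprS -scalerA; apply: gP.
Qed.

Lemma cobs_approx n e u : cobs e u -> exists y u', pform 1 y /\
  forall t, t \in s -> cg t (u t) (ew (c t) y + al ^+ n *: u' t).
Proof.
elim: n e u => [|n IH] e u hu.
  exists 0, u; split=> [|t ts]; first exact: pform0.
  by rewrite linear0 add0r scale1r /cg subrr; apply: dvf0.
have [y [u' [py hu' uE]]] := cobs_step hu; have [y2 [u2 [py2 u2E]]] := IH _ _ hu'.
exists (al *: y2 + y), u2; split=> [|t ts]; first exact: pformL.
apply: cg_trans (uE t ts) _; rewrite (linearP (ew (c t))) exprS -scalerA.
have ab (Y U Y2 U2 : forms k S) : (Y + U) - (Y2 + Y + U2) = U - (Y2 + U2).
  by rewrite [Y2 + Y]addrC -[Y + Y2 + U2]addrA opprD addrACA subrr add0r.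
by rewrite /cg ab -scalerDr -scalerBr; apply/dvfZ/u2E.
Qed.

Lemma wc0B i (u v : forms k S) :
  wc (fun=> 0%N) i (u - v) = wc (fun=> 0%N) i u - wc (fun=> 0%N) i v.
Proof. by apply/eqP; rewrite eq_sym subr_eq -wcD subrK. Qed.

Lemma wc0Z i (f : S) n (v : forms k S) : hmg n f -> wc (fun=> 0%N) i (f *: v) =
  if (n <= i)%N then f *: wc (fun=> 0%N) (i - n) v else 0.
Proof.
move=> hf; apply/ffunP => I; rewrite ffunE /hcs leq0n subn0 ffunE.
rewrite [LHS](hc_mul _ _ hf); case: ifP => _; last by rewrite ffunE.
by rewrite !ffunE /hcs leq0n subn0.
Qed.

Lemma wc0_sum (v : forms k S) : exists n, forall n', (n <= n')%N ->
  v = \sum_(i < n') wc (fun=> 0%N) i v.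
Proof.
have /choice[n nE] : forall I, exists n, forall n', (n <= n')%N -> v I = \sum_(i < n') hc i (v I).
  by move=> I; apply: hc_sum.
exists (\max_I n I)%N => n' nn'; apply/ffunP => I; rewrite sum_ffunE.
rewrite [LHS](nE I n'); last by apply: leq_trans nn'; apply: (leq_bigmax (F := n)).
by apply: eq_bigr => i _; rewrite ffunE /hcs leq0n subn0.
Qed.

(** [m] bounds the degrees of all [u t], so the remainder with factor [al ^+ m] does not reach the
    components that matter; truncating [y] below degree [m] solves the congruences exactly. *)
Lemma cobs_cob e u : cobs e u -> cob u.
Proof.
move=> hu; have /choice[n nE] := fun t => wc0_sum (u t).
pose m := (\max_(t <- s) n t)%N.
have [y [u' [py uE]]] := cobs_approx m hu.
exists (\sum_(i < m) wc (fun=> 0%N) i y).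
  apply: (big_ind (@pform k S^o 1)) => [|x z px pz|i _]; first exact: pform0.
    by rewrite -[x]scale1r; apply: pformL.
  by move=> I cI; rewrite ffunE py // /hcs leq0n linear0.
move=> t ts; rewrite /cg [X in X - _](nE t m); last by apply: leq_bigmax_seq.
rewrite (linear_sum (ew (c t))) -sumrB; apply: (big_ind (dvf (a t))) => [|x z|i _].
- exact: dvf0.
- exact: dvfD.
have [x xE] := uE t ts.
rewrite -[X in _ - X]/(ew (c t) (wc (fun=> 0%N) i y)) c_const.
have := congr1 (wc (fun=> 0%N) i) xE; rewrite wc0B wcD.
have [_ _ _ al1 _] := hs.
rewrite (wc0Z _ _ (homogX m al1)) leqNgt ltn_ord addr0 => ->.
rewrite (wc0Z _ _ (a_homog ts)); case: ifP => _; [exact: dvf_self | exact: dvf0].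
Qed.

Lemma lift_one v : N1 v -> imp hs M1 v.
Proof.
move=> Nv; have [g pg gE] := lift_pform hs (N1_pform Nv).
rewrite -gE in Nv; have [u uE] := N1_split pg Nv.
have [|y py yE] := @cobs_cob 1 u.
  move=> j; have [x px xE] := @cob_lift g u j pg Nv uE.
  by exists x => // t ts; rewrite expr1; apply: xE.
exists (g - al *: y); last by rewrite mapfB mapfZ hs_al // scale0r subr0.
split=> [|t ts]; first by rewrite -scaleN1r scalerA addrC; apply: pformL.
have -> : ew (c t) (g - al *: y) =
    (ew (c t) g - al *: u t) + al *: (u t - ew (c t) y).
  by rewrite (linearB (ew (c t))) (linZ (ew (c t))) scalerBr addrA subrK.
apply: dvfD; [exact: cg_sym (uE t ts) | exact/dvfZ/yE].
Qed.

End LiftOne.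

(** * The restriction of an arrangement *)

Lemma prod_fiber (R : comNzRingType) (T T' : eqType) (s : seq T) (s' : seq T')
    (X : T -> T') (F : T' -> R) : uniq s' -> (forall t, t \in s -> X t \in s') ->
  \prod_(t <- s) F (X t) = \prod_(x <- s') F x ^+ count (fun t => X t == x) s.
Proof.
move=> us'; elim: s => [|t s IH] Xs.
  by rewrite big_nil big1 // => x _; rewrite expr0.
rewrite big_cons IH => [|t' t's]; last by apply: Xs; rewrite inE t's orbT.
under [RHS]eq_bigr => x _ do rewrite /= exprD.
rewrite big_split /=; congr (_ * _).
rewrite (bigD1_seq (X t)) ?Xs ?mem_head //= eqxx expr1 big1 ?mulr1 // => x /negPf.
by rewrite eq_sym => ->; rewrite expr0.
Qed.

Section Restriction.
Variables (K : fieldType) (k l : nat) (phi : 'Hom('rV[K]_k, 'rV[K]_l)).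
Variables (A : {fset {vspace 'rV[K]_l}}) (H : {vspace 'rV[K]_l}).
Hypotheses (phi0 : lker phi = 0%VS) (phiH : limg phi = H) (dH : (\dim H).+1 = l).
Hypotheses (arrA : arrangement A) (HA : H \in A).
Hypothesis arrB : arrangement (restriction phi A H).
Local Notation S := {mpoly K[l]}.
Local Notation s := (enum_fset (A `\ H)%fset).
Local Notation B := (restriction phi A H).
Local Notation mH := (ziegler_mult phi A H).
Local Notation pi := (pullback phi).
Local Notation res L := (phi @^-1: (H :&: L))%VS.

Lemma res_in L : L \in s -> res L \in B.
Proof. by move=> Ls; apply/imfsetP; exists L. Qed.

Lemma res_form L : L \in s -> exists2 e : K, e != 0 &
  (defform L \o phi)%VF = e *: defform (res L).
Proof.
move=> Ls; have [LH dL] := in_BH arrA Ls.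
have dX := arrB (res_in Ls).
have [|e eE] := lker_multiple (f := defform (res L)) (g := (defform L \o phi)%VF)
  (defform_neq0 dX).
  rewrite lker_defform //; apply/subvP => x; rewrite -memv_preim memv_cap => /andP[_].
  by rewrite memv_ker comp_lfunE -{1}(lker_defform dL) memv_ker.
exists e => //; apply/eqP => e0; have := defform_phi_neq0 phiH dH dL LH.
by rewrite eE e0 scale0r eqxx.
Qed.

Lemma kvecZ n m (e : K) (f : 'Hom('rV[K]_n, K^o)) : kvec m (e *: f) = e%:MP *: kvec m f.
Proof.
by apply/ffunP => i; rewrite !ffunE scale_lfunE -[RHS]/(_ * _) -mpolyCM.
Qed.

Lemma mapf_kvec n (f : 'Hom('rV[K]_n, K^o)) : mapf pi (kvec l f) = kvec k f.
Proof. by apply/ffunP => i; rewrite !ffunE; exact: comp_mpolyC. Qed.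

Lemma pi_alpha L : pi (alpha L) = linpoly (defform L \o phi)%VF.
Proof. exact: pullback_linpoly. Qed.

Lemma linpolyZ' n (e : K) (f : 'Hom('rV[K]_n, K^o)) : linpoly (e *: f) = e%:MP * linpoly f.
Proof. by rewrite linpolyZ mul_mpolyC. Qed.

Lemma count_res X : count (fun L => res L == X) s = mH X.
Proof.
rewrite /ziegler_mult -size_filter; apply/perm_size/uniq_perm.
- exact/filter_uniq/fset_uniq.
- exact: fset_uniq.
by move=> L; rewrite mem_filter !inE capvC andbC.
Qed.

Lemma pi_alpha_neq0 L : L \in s -> pi (alpha L) != 0.
Proof.
move=> Ls; have [LH dL] := in_BH arrA Ls; rewrite pi_alpha.
by apply: contraNneq (defform_phi_neq0 phiH dH dL LH) => /linpoly_eq0 ->.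
Qed.

Lemma pullbackM x y : pi (x * y) = pi x * pi y. Proof. exact: (rmorphM pi). Qed.

(** [dvs u 1] makes [u] a unit; it collects the scalars between restricted forms and the chosen
    forms of the flats. *)
Lemma pi_prod (r : seq {vspace 'rV[K]_l}) : {subset r <= s} ->
  exists2 u : {mpoly K[k]}, dvs u 1 &
    pi (\prod_(L <- r) alpha L) = u * \prod_(L <- r) alpha (res L).
Proof.
elim: r => [|L r IH] rs.
  by exists 1; [exists 1; rewrite mulr1 | rewrite !big_nil rmorph1 mulr1].
have [|u [v uv] uE] := IH; first by move=> x xr; apply: rs; rewrite inE xr orbT.
have Ls : L \in s by apply: rs; rewrite mem_head.
have [e e0 eE] := res_form Ls; exists (e%:MP * u).
  by exists ((e^-1)%:MP * v); rewrite mulrACA -uv mulr1 -mpolyCM mulfV.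
by rewrite !big_cons pullbackM uE pi_alpha eE linpolyZ' mulrACA.
Qed.

Lemma res_fiber X : X \in B -> exists (r : seq {vspace 'rV[K]_l}) L0 (v : {mpoly K[k]}),
  [/\ uniq r, {subset r <= s}, forall L, L \in r -> exists u, cL phi L0 = u *: cL phi L,
      kvec k (defform X) = v *: mapf pi (cL phi L0)
    & dvs (alpha X ^+ mH X) (pi (\prod_(L <- r) alpha L))].
Proof.
move=> /imfsetP[L0 /= L0s XE]; pose r := [seq L <- s | res L == X].
have L0s' : L0 \in s by [].
have rs : {subset r <= s} by move=> L; rewrite mem_filter => /andP[].
have [e e0 eE] := res_form L0s'; rewrite -XE in eE.
exists r, L0, (e^-1)%:MP; split=> //.
- exact/filter_uniq/fset_uniq.
- move=> L Lr; have [e' e'0 e'E] := res_form (rs L Lr).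
  move: Lr; rewrite mem_filter => /andP[/eqP XL _]; rewrite XL in e'E.
  exists (e / e')%:MP; rewrite /cL eE e'E !kvecZ scalerA -mpolyCM divfK //.
- by rewrite mapf_kvec eE kvecZ scalerA -mpolyCM mulVf // scale1r.
have [u [v uv] ->] := pi_prod rs; apply: dvsM.
rewrite (_ : \prod_(L <- r) alpha (res L) = alpha X ^+ mH X); first by exists 1; rewrite mulr1.
transitivity (\prod_(L <- r) (alpha X : {mpoly K[k]})).
  by apply: eq_big_seq => L; rewrite mem_filter => /andP[/eqP ->].
by rewrite big_const_seq count_predT size_filter count_res iter_mulr_1.
Qed.

Lemma res_below L : L \in s -> exists X (v : {mpoly K[k]}),
  [/\ X \in B, mapf pi (cL phi L) = v *: kvec k (defform X)
    & dvs (pi (alpha L)) (alpha X ^+ mH X)].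
Proof.
move=> Ls; have [e e0 eE] := res_form Ls; exists (res L), e%:MP; split.
- exact: res_in.
- by rewrite mapf_kvec eE kvecZ.
have : (0 < mH (res L))%N by rewrite -count_res -has_count; apply/hasP; exists L.
case: (mH _) => // m _; exists ((e^-1)%:MP * alpha (res L) ^+ m).
by rewrite pi_alpha eE linpolyZ' mulrACA -mpolyCM mulfV // mul1r exprS.
Qed.

Lemma pi_prod_neq0 : pi (\prod_(L <- s) alpha L) != 0.
Proof.
by rewrite rmorph_prod prodf_seq_neq0; apply/allP => L; apply: pi_alpha_neq0.
Qed.

Lemma pi_prod_dvs : dvs (pi (\prod_(L <- s) alpha L)) (\prod_(X <- B) alpha X ^+ mH X).
Proof.
have [//|u [v uv] ->] := @pi_prod s.
rewrite (prod_fiber (s' := B) (fun X => alpha X)) ?fset_uniq //; last exact: res_in.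
exists v; rewrite mulrAC -uv mul1r; apply: eq_bigr => X _.
by rewrite -count_res.
Qed.

End Restriction.

(** * The equivalence *)

Section Equivalence.
Variables (K : fieldType) (n : nat).
Local Notation l := n.+2.
Local Notation k := n.+1.
Local Notation S := {mpoly K[l]}.
Local Notation S' := {mpoly K[k]}.
Variables (A : {fset {vspace 'rV[K]_l}}) (arrA : arrangement A).
Variables (H : {vspace 'rV[K]_l}) (HA : H \in A) (lfH : locally_free_along A H).
Variable phi : 'Hom('rV[K]_k, 'rV[K]_l).
Hypotheses (phi0 : lker phi = 0%VS) (phiH : limg phi = H).
Hypothesis k_gt3 : (3 < k)%N.
Local Notation M := (Mlog phi H A).
Local Notation B := (restriction phi A H).
Local Notation mH := (ziegler_mult phi A H).
Local Notation pi := (pullback phi).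
Local Notation s := (enum_fset (A `\ H)%fset).

Lemma dH : (\dim H).+1 = l. Proof. exact: arrA. Qed.

Lemma arrB : arrangement B.
Proof. exact: (@restriction_arrangement K l). Qed.

Lemma hs : hyperplane_section pi (alpha H).
Proof. exact: pullback_section phi0 phiH dH. Qed.

(** By [split_omega] this is a direct summand of a free module, and projectivity is all that
    [factors_free_proj] asks for. *)
Lemma localization_projective x : x \in H -> x != 0 ->
  projective (subT (Mlog phi H (localization A x) 1)).
Proof.
move=> xH x0; have arrx : arrangement (localization A x).
  by move=> L; rewrite !inE => /andP[LA _]; apply: arrA.
have Hx : H \in localization A x by rewrite !inE HA.
have := free_projective (lfH xH x0).
have := omega_logs mult1 1 arrx => /iso_sym i1 pO.
have i2 := split_omega phi0 phiH dH arrx 0 Hx.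
exact: proj_fst (iso_proj (iso_sym i2) (iso_proj i1 pO)).
Qed.

(** Passing to the localization drops the conditions at hyperplanes not containing [x]; multiplying
    by their forms restores them. *)
Lemma offprod_factors b (E : 'I_b -> forms k S) x : gens (M 1) E -> x \in H -> x != 0 ->
  factors_free s (cL phi) (@alpha K l) E (offprod A x).
Proof.
move=> gE xH x0; apply: (factors_free_proj gE (localization_projective xH x0)).
  by move=> w; apply: logs_sub => L; rewrite !inE => /andP[-> /andP[-> _]].
move=> w [pw hw]; split=> [|L Ls]; first exact: pformZ.
rewrite (linZ (ew _)); have [xL|xL] := boolP (x \in L).
  by apply/dvfZ/hw; move: Ls; rewrite !inE => /andP[-> ->].
have LA : L \in A by move: Ls; rewrite !inE => /andP[].
by rewrite /offprod (big_rem L) //= xL -scalerA; apply: dvf_self.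
Qed.

Definition flat_products (f : S) : Prop :=
  exists x, [/\ x \in H, x != 0 & f = offprod A x].

Lemma flat_products_seq q : exists (d : 'I_k -> nat) (h : vec k S),
  [/\ forall j, hmg (d j) (h j), forall j, pi (h j) = 'X_j ^+ d j
    & forall U : submodule (S^o), (forall f, flat_products f -> U (f ^+ q)) ->
        forall j, U (h j)].
Proof.
have [d [h [hI hd pih]]] := flat_sequence arrA HA phi0 phiH q.
exists d, h; split=> // U hU j; apply: hI => x xH x0; apply: hU.
by exists x.
Qed.

Lemma s_uniq : uniq s. Proof. exact: fset_uniq. Qed.

Lemma s_unit L : L \in s -> exists v, dot (cL phi L) v = 1.
Proof. by move=> Ls; apply: (Mlog_unit phiH dH arrA Ls). Qed.

Lemma B_unit X : X \in B -> exists v, dot (kvec k (defform X)) v = 1.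
Proof. by move=> XB; apply/kvec_unit/defform_neq0/arrB. Qed.

Lemma B_cop X Y : X \in B -> Y \in B -> X != Y ->
  dreg (alpha X ^+ mH X) (alpha Y ^+ mH Y).
Proof.
move=> /arrB dX /arrB dY XY; apply: dreg_expl; first exact: alpha_neq0.
exact/dreg_exp/dreg_alpha.
Qed.

Lemma M1_data : fres 2 (subT (M 1)) -> forall p, (p.+2 < k)%N ->
  fres p.+2 (subT (M p.+1)) /\ forall g, alogs B mH p.+1 g <-> imp hs (M p.+1) g.
Proof.
move=> /fres_gens[b [E [gE /fres1_basis[m [Z [Z_inj Z_ker]]]]]] p pk.
have F_free f : flat_products f -> factors_free s (cL phi) (@alpha K l) E f.
  by move=> [x [xH x0 ->]]; apply: offprod_factors.
have rM : fres p.+2 (subT (M p.+1)).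
  apply: (logs_res s_uniq (Mlog_cop arrA) s_unit (Mlog_neq0 arrA) gE Z_inj Z_ker F_free _ pk) => q.
  have [d [h [hd pih hF]]] := flat_products_seq q.
  by exists h; split=> //; apply: seq_regular hs _ hd pih.
split=> // g.
apply: (restriction_logs hs s_uniq (Mlog_cop arrA) s_unit (Mlog_neq0 arrA)
  (fset_uniq B) B_cop B_unit (res_fiber phiH dH arrA arrB)
  (pi_prod_neq0 phiH dH arrA) (pi_prod_dvs phiH dH arrA arrB) gE F_free
  flat_products_seq pk _ rM).
exact: (Mlog_saturated dH arrA).
Qed.

Lemma M1_graded : graded (fun=> 0%N) (M 1). Proof. exact: Mlog_graded. Qed.

Lemma M0_fres : fres 1 (subT (M 0)).
Proof.
exact: (logs0_fres s_uniq (Mlog_cop arrA) s_unit (Mlog_neq0 arrA)).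
Qed.

Lemma M_pres p : fres 2 (subT (M 1)) -> pres p.+1 (subT (M p)).
Proof.
move=> r2; case: p => [|p]; first exact: pres_fres M0_fres.
have [pk|kp] := ltnP p.+2 k; first exact: pres_fres (proj1 (M1_data r2 pk)).
(* Outside the range of [M1_data], Hilbert's bound is enough: [M] is saturated, so it needs only as
   many terms as [H] has coordinates. *)
apply: (res_le (proj_zero _) kp); apply: (hilbert_syzygy_sat _ hs).
- exact: ex_hyperplane_section.
- exact: Mlog_graded.
- exact: (Mlog_saturated dH arrA).
Qed.

Lemma tame_of_fres : fres 2 (subT (M 1)) -> tame A mult1.
Proof.
move=> r2 p _; apply/pd_leP; apply: (iso_res (omega_logs mult1 p arrA)).
case: p => [|p].
  suff h : fres 1 (subT (alogs A mult1 0)) by exact: pres_fres h.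
  apply: logs0_fres.
  - exact: fset_uniq.
  - move=> L L' /arrA dL /arrA dL' LL'; rewrite !expr1; exact: dreg_alpha.
  - by move=> L /arrA dL; apply/kvec_unit/defform_neq0.
  - by move=> L /arrA dL; rewrite expr1; apply: alpha_neq0.
apply: (iso_res (split_omega phi0 phiH dH arrA p HA)).
apply: res_prod; [exact: proj_prod | by [] | exact: M_pres | ].
by apply: (res_le (proj_zero _) (leqnSn _)); exact: M_pres.
Qed.

Lemma alogs_graded p : graded (fun=> 0%N) (alogs B mH p).
Proof.
by apply: logs_graded => X _; exists (mH X); apply/homogX/homog_alpha.
Qed.

Lemma restriction_tame_of_fres : fres 2 (subT (M 1)) -> tame B mH.
Proof.
move=> r2 p _; apply/pd_leP; apply: (iso_res (omega_logs mH p arrB)).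
case: p => [|p].
  suff h : fres 1 (subT (alogs B mH 0)) by exact: pres_fres h.
  apply: (logs0_fres (fset_uniq B) B_cop B_unit) => X /arrB dX.
  exact/expf_neq0/alpha_neq0.
have [pk|kp] := ltnP p.+2 k.
  have [rM NM] := M1_data r2 pk.
  suff h : fres p.+2 (subT (alogs B mH p.+1)) by exact: pres_fres h.
  apply: (res_eq (fun g => iff_sym (NM g))).
  exact: (fres_section hs (Mlog_saturated dH arrA (p := p.+1)) rM).
have hN := hilbert_syzygy (@ex_hyperplane_section K) (@alogs_graded p.+1).
exact: (res_le (proj_zero _) kp hN).
Qed.

(** The 1-forms of [A] are [M 1] times [M 0]. Dividing out [M 0], which has a resolution with one
    term, keeps the bound of two terms by [res_cone]. *)
Lemma fres_of_pd : pd_le (Omega A mult1 1) 1 -> fres 2 (subT (M 1)).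
Proof.
move=> /pd_leP pO; apply: (graded_fres M1_graded).
have pMM := iso_res (iso_sym (split_omega phi0 phiH dH arrA 0 HA))
  (iso_res (iso_sym (omega_logs mult1 1 arrA)) pO).
have [i [q iq]] := ses_prod' (subT (M 0)) (subT (M 1)).
apply: (res_cone (@proj_prod _) _ iq) pMM => //; exact: pres_fres M0_fres.
Qed.

(** Lifting is first possible after multiplication by each [h j]; [lift_one] removes this factor. So
    [imp] of [M 1] is the whole module of the restriction, and its bound passes to [M 1] by
    [pres_lift]. *)
Lemma fres_of_restriction_pd : pd_le (Omega B mH 1) 1 -> fres 2 (subT (M 1)).
Proof.
move=> /pd_leP pO; apply: (graded_fres M1_graded).
have pN := iso_res (iso_sym (omega_logs mH 1 arrB)) pO.
have rN := graded_fres (@alogs_graded 1) pN.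
have [b [E [e [gE _ _]]]] := mingens (w := fun=> 0%N) (M := M 1) M1_graded.
have F_free f : flat_products f -> factors_free s (cL phi) (@alpha K l) E f.
  by move=> [x [xH x0 ->]]; apply: offprod_factors.
have [d [h [hd pih hF]]] := flat_products_seq 1.
have lift_h v j : alogs B mH 1 v -> imp hs (M 1) (pi (h j) *: v).
  move=> Nv; apply: (lift_seq (hs := hs) s_uniq (Mlog_cop arrA) s_unit (Mlog_neq0 arrA)
    (fset_uniq B) B_cop B_unit (res_fiber phiH dH arrA arrB)
    (pi_prod_neq0 phiH dH arrA) (pi_prod_dvs phiH dH arrA arrB) gE F_free
    (U := fun x => imp hs (M 1) (pi x *: v)) Nv) => // V hV.
  exact: hF.
have imp_N v : imp hs (M 1) v -> alogs B mH 1 v.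
  exact: (imp_logs (Mlog_cop arrA) (res_fiber phiH dH arrA arrB)).
have N_imp v : alogs B mH 1 v -> imp hs (M 1) v.
  apply: (lift_one _ _ _ _ _ _ imp_N pih lift_h k_gt3 rN).
  - by move=> L _; apply: homog_alpha.
  - by move=> L d' w; apply: ew_kvec_wc.
  - by move=> L Ls; apply: (Mlog_reg dH arrA Ls).
  - by move=> L Ls; apply: (pi_alpha_neq0 phiH dH arrA Ls).
  - by move=> w [].
  - by move=> L w Ls; apply: (logs_below (res_below phiH dH arrA arrB)).
apply: (pres_lift (hs := hs) M1_graded (Mlog_saturated dH arrA (p := 1))).
by apply: (res_eq _ pN) => v; split; [apply: N_imp | apply: imp_N].
Qed.

End Equivalence.

Theorem corollary1p11 (K : fieldType) (l : nat) (l_ge5 : (5 <= l)%N)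
    (A : {fset {vspace 'rV[K]_l}}) (arrA : arrangement A)
    (H : {vspace 'rV[K]_l}) (HA : H \in A)
    (lfH : locally_free_along A H)
    (phi : 'Hom('rV[K]_l.-1, 'rV[K]_l))
    (phi_inj : lker phi = 0%VS) (phi_im : limg phi = H) :
  [<-> tame A mult1;
       pd_le (Omega A mult1 1) 1;
       tame (restriction phi A H) (ziegler_mult phi A H);
       pd_le (Omega (restriction phi A H) (ziegler_mult phi A H) 1) 1].
Proof.
case: l l_ge5 A arrA H HA lfH phi phi_inj phi_im => [|[|n]] // n3 A arrA H HA lfH phi phi0 phiH.
split; first by move=> /(_ 1%N isT).
split; first by move=> /(fres_of_pd arrA HA phi0 phiH); exact: restriction_tame_of_fres.
split; first by move=> /(_ 1%N isT).
move=> /(fres_of_restriction_pd arrA HA lfH phi0 phiH n3); exact: tame_of_fres.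
Qed.
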